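(* Fix an integer $r\ge5$. Let $\lambda=\frac{\binom r2-2}{r-2}$, let $\alpha_d=\frac{(d+1)^{d+1}}{d^d}$, and let $\gamma>0$ be the unique real satisfying $(r-2)!\,\gamma^{r-2}=\alpha_{\binom r2-2}$. Let $p=(\bar\gamma n)^{-1/\lambda}$ for some fixed $\bar\gamma>\gamma$, put $\bar\alpha=(r-2)!\,\bar\gamma^{r-2}$ (so $\bar\alpha>\alpha_{\binom r2-2}$), and let $\rho>1$ be the smallest root greater than $1$ of the equation $\rho^{\binom r2-1}=\bar\alpha(\rho-1)$. Then \[ |E(\langle\mathcal G_{n,p}\rangle_{K_r})|\sim \rho\cdot p\binom n2 \] in probability, as $n\to\infty$.
   Context: $\mathcal G_{n,p}$ is the Erdős–Rényi random graph. For $G\subseteq K_n$, the $K_r$-dynamics repeatedly adds an edge $e$ of $K_n$ whenever there is a copy of $K_r$ in $K_n$ in which $e$ is the only edge not yet present; $\langle G\rangle_{K_r}$ denotes the final graph when no more edges can be added. ''$X_n\sim a_n$ in probability'' means $X_n/a_n\to1$ in probability. *)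

(* Defs.v *)
From HB Require Import structures.
From mathcomp Require Import all_boot all_order all_algebra.
From mathcomp Require Import all_classical all_reals all_analysis.
Set Implicit Arguments. Unset Strict Implicit. Unset Printing Implicit Defensive.
Import Order.TTheory GRing.Theory Num.Theory.
Local Open Scope ring_scope.

Definition Kn (n : nat) : {set {set 'I_n}} := [set e : {set 'I_n} | #|e| == 2%N].

Definition Kr_step (n r : nat) (G : {set {set 'I_n}}) : {set {set 'I_n}} :=
  G :|: [set e in Kn n | [exists S : {set 'I_n},
      [&& #|S| == r, e \subset S &
          [forall f in Kn n, (f \subset S) ==> ((f == e) || (f \in G))]]]].

(* <G>_{K_r}: the final graph. Each round either adds an edge or is a
   fixpoint, so #|Kn n| rounds reach the final (unique) closure. *)
Definition Kr_closure (n r : nat) (G : {set {set 'I_n}}) : {set {set 'I_n}} :=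
  iter #|Kn n| (Kr_step r) G.

Definition Gnp_prob {R : realType} (n : nat) (p : R)
    (A : {set {set 'I_n}} -> bool) : R :=
  \sum_(G : {set {set 'I_n}} | (G \subset Kn n) && A G)
     p ^+ #|G| * (1 - p) ^+ (#|Kn n| - #|G|).

Definition alpha_d {R : realType} (d : nat) : R :=
  (d.+1%:R) ^+ d.+1 / (d%:R ^+ d).

Arguments Gnp_prob {R} n p A.
Arguments Kr_closure n r G.

(* Main.v *)
(** Write D = C(r,2) - 1. An edge of the closure is certified by a witness tree: its root is
either an edge of G or lies in a clique of size r whose D other pairs are roots of trees
meeting only inside the clique. A tree on v vertices has exactly phi(v) = lambda (v - 2) + 1
leaves, so at the present scale the expected number of trees at a given pair, divided by p,
obeys y -> 1 + y^D / alphabar, and its total is the smallest fixed point rho.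

Lower bound. A subgraph of a tree on u vertices has at most phi(u) edges, and strictly fewer if
it contains the root but not the whole tree. Hence trees of bounded size have variance
O(p n^2), few pairs are roots of two of them, and a tree is determined by its vertices and
edges. Overlaps cost only O(1/n) in the recursion, whose iterates increase to rho.

Upper bound. Take dense blocks covering as many pairs as possible. If no dense script, that is
no dense concatenation of trees, has its size in a window ]L, M], with L a small power of n
and M of order L^3, then every edge of the closure is the root of a tree of size at most L or
lies in a script of size at most L with more edges than phi allows; here r >= 5 is used, since
then K_r minus an edge is not separated by two vertices. Each repeated vertex or free leaf of a
script costs a power of p, which makes the total weight of scripts small: scripts in the window
are unlikely and those below it cover o(p n^2) pairs. The trees have expected number at most
rho p C(n,2), and combined with the lower bound this gives concentration. *)

Require Import Defs.
From mathcomp Require Import all_boot order ssralg ssrnum.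
From mathcomp Require Import boolp.
From mathcomp Require Import zify ring lra.
Set Implicit Arguments. Unset Strict Implicit. Unset Printing Implicit Defensive.
Import Order.TTheory GRing.Theory Num.Theory.

(** The closure takes an unbounded number of steps, while every gluing of trees and blocks may lose
    a little density. Hence nothing dense is carried from step to step: a reached pair is only known
    to be the root of a tree on at most [L] vertices whose free leaves lie in blocks. For each
    clique a family of components is rebuilt from the blocks by attaching at most D such trees, so
    the loss is a bounded multiple of [c0], and the window of forbidden sizes brings each new
    component back below [L]. Besides separation, r >= 5 supplies the gain in this bookkeeping. A
    clique not contained in a block has at most r/2 pairs inside it per vertex beyond the first two,
    and lambda - r/2 = (r - 4) / (2 (r - 2)) is positive for r > 4. So any overlap beyond one shared
    pair would make the union dense, against the maximal choice of blocks. At rho the fixed point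
    relation is an equality and leaves no room for error terms. These are estimated at the critical
    value D / (D - 1), where gammabar > gamma gives strict slack. *)

Lemma card_bigcup_disj (I T : finType) (B : {set I}) (W : I -> {set T}) :
  (forall g h, g \in B -> h \in B -> g != h -> [disjoint W g & W h]) ->
  #|\bigcup_(g in B) W g| = \sum_(g in B) #|W g|.
Proof.
elim: {B}_.+1 {-2}B (ltnSn #|B|) => // k IHk B leBk disj.
have [->|[i iB]] := set_0Vmem B; first by rewrite !big_set0 cards0.
rewrite (big_setD1 i) //= [in RHS](big_setD1 i) //= -IHk; last 2 first.
- by move: leBk; rewrite (cardsD1 i) iB.
- move=> g h /setD1P[_ gB] /setD1P[_ hB]; exact: disj.
rewrite cardsU disjoint_setI0 ?cards0 ?subn0 //.
apply/bigcup_disjointP => j /setD1P[nji jB].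
by rewrite disj // eq_sym.
Qed.

Lemma leq_card_bigcup (I T : finType) (B : {set I}) (W : I -> {set T}) :
  #|\bigcup_(g in B) W g| <= \sum_(g in B) #|W g|.
Proof.
apply: (big_rec2 (fun (A : {set T}) k => #|A| <= k)); first by rewrite cards0.
move=> i k A _ leAk; rewrite cardsU.
by apply: leq_trans (leq_subr _ _) _; rewrite leq_add2l.
Qed.

(** * Pairs, closed edge sets and witness trees *)

Section Pairs.
Variable T : finType.
Implicit Types (V W S U A : {set T}) (e f g h : {set T}) (E F P : {set {set T}}).

Definition pairs V : {set {set T}} := [set e : {set T} | (e \subset V) && (#|e| == 2)].

Lemma in_pairs e V : (e \in pairs V) = (e \subset V) && (#|e| == 2).
Proof. by rewrite inE. Qed.

Lemma pairs_sub e V : e \in pairs V -> e \subset V.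
Proof. by rewrite in_pairs => /andP[]. Qed.

Lemma pairs_card e V : e \in pairs V -> #|e| = 2.
Proof. by rewrite in_pairs => /andP[_ /eqP]. Qed.

Lemma pairsP e V : e \subset V -> #|e| = 2 -> e \in pairs V.
Proof. by rewrite in_pairs => -> ->. Qed.

Lemma pairsS V W : V \subset W -> pairs V \subset pairs W.
Proof.
move=> sVW; apply/subsetP=> e; rewrite !in_pairs => /andP[sV ->].
by rewrite (subset_trans sV sVW).
Qed.

Lemma card_pairs V : #|pairs V| = 'C(#|V|, 2).
Proof. exact: cards_draws. Qed.

Lemma set2_pairs x y V : x \in V -> y \in V -> x != y -> [set x; y] \in pairs V.
Proof.
by move=> xV yV nxy; rewrite in_pairs cards2 nxy subUset !sub1set xV yV.
Qed.

Lemma pair_eq e f : #|e| = 2 -> #|f| = 2 -> e \subset f -> e = f.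
Proof. by move=> e2 f2 sef; apply/eqP; rewrite eqEcard sef e2 f2. Qed.

(** [x] lies in at least two pairs of [S], and only one of them can be [e]. This is why the vertex
    set of a node, a union over the pairs other than its root, still contains the root and the whole
    clique. *)
Lemma pair_avoid S e x : 2 < #|S| -> e \in pairs S -> x \in S ->
  exists2 g, g \in pairs S :\ e & x \in g.
Proof.
move=> S3 eS xS.
have : 1 < #|S :\ x| by move: (cardsD1 x S); rewrite xS; lia.
case/card_gt1P => y [z [yS zS nyz]].
move: yS zS; rewrite !in_setD1 => /andP[nyx yS] /andP[nzx zS].
have py : [set x; y] \in pairs S by rewrite set2_pairs // eq_sym.
have pz : [set x; z] \in pairs S by rewrite set2_pairs // eq_sym.
case: (eqVneq [set x; y] e) => [eE|ne].
- exists [set x; z]; last by rewrite in_set2 eqxx.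
  rewrite in_setD1 pz andbT -eE; apply/eqP => /setP/(_ y).
  by rewrite !in_set2 eqxx orbT (negbTE nyx) (negbTE nyz).
- by exists [set x; y]; rewrite ?in_setD1 ?ne ?py // in_set2 eqxx.
Qed.

Variable r : nat.

Definition closed_E E := forall S e, #|S| = r -> e \in pairs S ->
  pairs S :\ e \subset E -> e \in E.

(* A witness tree rooted at the pair f, on the vertex set V: the leaves in F are to be
   edges of the random graph, the free leaves in P are to be supplied by other trees.
   The subtrees of a node meet only inside its clique S. *)
Inductive tr : {set T} -> {set T} -> {set {set T}} -> {set {set T}} -> Prop :=
| TrG f of #|f| = 2 : tr f f [set f] set0
| TrP f of #|f| = 2 : tr f f set0 [set f]
| TrN f S (V : {set T} -> {set T}) (F P : {set T} -> {set {set T}}) of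
    #|S| = r & f \in pairs S &
    (forall g, g \in pairs S :\ f -> tr g (V g) (F g) (P g)) &
    (forall g, g \in pairs S :\ f -> V g :&: S = g) &
    (forall g h, g \in pairs S :\ f -> h \in pairs S :\ f -> g != h ->
       V g :&: V h \subset S) :
    tr f (\bigcup_(g in pairs S :\ f) V g) (\bigcup_(g in pairs S :\ f) F g)
       (\bigcup_(g in pairs S :\ f) P g).

Hypothesis r5 : 4 < r.

Lemma tr_root f V F P : tr f V F P -> f \subset V /\ #|f| = 2.
Proof.
case=> [g g2|g g2|g S W F' P' S_r gS _ WS _]; split => //; last exact: pairs_card gS.
apply/subsetP => x xg.
have [||h hS xh] := @pair_avoid S g x _ gS; first by rewrite S_r; lia.
  exact: (subsetP (pairs_sub gS)).
by apply/bigcupP; exists h => //; move: xh; rewrite -{1}(WS h hS) inE => /andP[].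
Qed.

Lemma tr_card2 f V F P : tr f V F P -> #|f| = 2.
Proof. by case/tr_root. Qed.

Lemma tr_sub f V F P : tr f V F P -> f \subset V.
Proof. by case/tr_root. Qed.

Lemma node_sub f S (V : {set T} -> {set T}) : #|S| = r -> f \in pairs S ->
  (forall g, g \in pairs S :\ f -> V g :&: S = g) ->
  S \subset \bigcup_(g in pairs S :\ f) V g.
Proof.
move=> S_r fS VS; apply/subsetP => x xS.
have [||h hS xh] := @pair_avoid S f x _ fS => //; first by rewrite S_r; lia.
by apply/bigcupP; exists h => //; move: xh; rewrite -{1}(VS h hS) inE => /andP[].
Qed.

Lemma tr_leaves f V F P : tr f V F P -> F \subset pairs V /\ P \subset pairs V.
Proof.
elim=> {f V F P} [f f2|f f2|f S V F P S_r fS _ IH VS VV].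
- by rewrite sub1set sub0set; split=> //; rewrite pairsP.
- by rewrite sub1set sub0set; split=> //; rewrite pairsP.
- split; apply/bigcupsP => g gS; have [FV PV] := IH g gS;
  by apply: (subset_trans _ (pairsS (bigcup_sup g gS))).
Qed.

(** Outside the clique the children are disjoint, and the child at g meets the clique in g. The
    arbitrary [U] serves both the exact count ([U] full) and the density bounds for subgraphs. *)
Lemma node_card f S (V : {set T} -> {set T}) U : #|S| = r -> f \in pairs S ->
  (forall g, g \in pairs S :\ f -> V g :&: S = g) ->
  (forall g h, g \in pairs S :\ f -> h \in pairs S :\ f -> g != h ->
       V g :&: V h \subset S) ->
  #|(\bigcup_(g in pairs S :\ f) V g) :&: U| =
    #|S :&: U| + \sum_(g in pairs S :\ f) (#|V g :&: U| - #|g :&: U|).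
Proof.
move=> S_r fS VS VV.
have -> : (\bigcup_(g in pairs S :\ f) V g) :&: U =
  (S :&: U) :|: \bigcup_(g in pairs S :\ f) ((V g :\: S) :&: U).
  apply/setP => x; rewrite inE in_setU.
  have [xU|] := boolP (x \in U); last first.
    move=> nxU; rewrite !inE (negbTE nxU) !andbF /=; apply/esym/bigcupP => -[g _].
    by rewrite inE (negbTE nxU) andbF.
  rewrite !inE xU !andbT; have [xS|nxS] /= := boolP (x \in S).
    by apply: (subsetP (node_sub S_r fS VS)).
  apply/bigcupP/bigcupP => -[g gS xg]; exists g => //.
    by rewrite !inE nxS xg xU.
  by move: xg; rewrite !inE => /andP[/andP[]].
rewrite cardsU (_ : (S :&: U) :&: (\bigcup_(g in _) _) = set0) ?cards0 ?subn0; last first.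
  apply/setP => x; rewrite !inE; apply/negP => /andP[/andP[xS _]] /bigcupP[g _].
  by rewrite !inE xS.
congr (_ + _).
have -> : \sum_(g in pairs S :\ f) (#|V g :&: U| - #|g :&: U|) =
  \sum_(g in pairs S :\ f) #|(V g :\: S) :&: U|.
  apply: eq_bigr => g gS.
  rewrite setIDAC cardsD.
  by have <- : (V g :&: U) :&: S = g :&: U by rewrite -[in RHS](VS g gS) setIAC.
have disj g h : g \in pairs S :\ f -> h \in pairs S :\ f -> g != h ->
   [disjoint (V g :\: S) :&: U & (V h :\: S) :&: U].
  move=> gS hS ngh; rewrite -setI_eq0; apply/eqP/setP => x; rewrite !inE.
  apply/negP => /andP[/andP[/andP[nxS xg] _] /andP[/andP[_ xh] _]].
  by move: (subsetP (VV g h gS hS ngh) x); rewrite inE xg xh (negbTE nxS) => /(_ isT).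
pose W g := (V g :\: S) :&: U.
have {}disj g h : g \in pairs S :\ f -> h \in pairs S :\ f -> g != h -> [disjoint W g & W h] by exact: disj.
rewrite (eq_bigr (fun g => #|W g|)) // (eq_bigr W) //.
exact: card_bigcup_disj.
Qed.

End Pairs.

(* Integer form of R <= (beta / alpha) (u - 2) + 1. *)
Definition bound (alpha beta R u : nat) :=
  alpha * R <= if u < 2 then 0 else beta * (u - 2) + alpha.

Lemma twice_bin2 a : 2 * 'C(a, 2) = a * a.-1.
Proof. by rewrite -(mul_bin_diag a 1) bin1. Qed.

(** * Leaves of a tree inside a vertex set *)

Section Trees.
Variables (T : finType) (r : nat).
Hypothesis r5 : 4 < r.
Implicit Types (V W S U A : {set T}) (e f g h p : {set T}) (E F P Q : {set {set T}}).
Local Notation tr := (@tr T r).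

Definition ins Q U : {set {set T}} := [set p in Q | p \subset U].

Lemma card_root_out S f : #|S| = r -> f \in pairs S -> #|pairs S :\ f| = ('C(r, 2) - 1)%N.
Proof. by move=> Sr fS; rewrite -Sr -card_pairs [X in _ = X - 1](cardsD1 f) fS addKn. Qed.

Section Node.
Variables (S f : {set T}) (V : {set T} -> {set T}).
Hypotheses (S_r : #|S| = r) (fS : f \in pairs S).
Hypothesis VS : forall g, g \in pairs S :\ f -> V g :&: S = g.
Hypothesis VV : forall g h, g \in pairs S :\ f -> h \in pairs S :\ f -> g != h ->
  V g :&: V h \subset S.

Lemma node_root_sub g : g \in pairs S :\ f -> g \subset V g.
Proof. by move=> gS; rewrite -{1}(VS gS) subsetIl. Qed.

(** A pair common to two distinct children lies in the clique, hence equals the root of either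
    one. *)
Lemma node_pair_uniq g h p : g \in pairs S :\ f -> h \in pairs S :\ f ->
  p \in pairs (V g) -> p \in pairs (V h) -> g = h.
Proof.
move=> gS hS pg ph; apply/eqP/negP => /negP ngh.
have p2 := pairs_card pg.
have sub : p \subset S.
  by apply: subset_trans (VV gS hS ngh); rewrite subsetI (pairs_sub pg) (pairs_sub ph).
have pg' : p \subset g by rewrite -(VS gS) subsetI sub (pairs_sub pg).
have ph' : p \subset h by rewrite -(VS hS) subsetI sub (pairs_sub ph).
case/setD1P: gS hS => _ gS /setD1P[_ hS].
by case/eqP: ngh; rewrite -(pair_eq p2 (pairs_card gS) pg') (pair_eq p2 (pairs_card hS) ph').
Qed.

Lemma node_ins (Q : {set T} -> {set {set T}}) U :
  (forall g, g \in pairs S :\ f -> Q g \subset pairs (V g)) ->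
  #|ins (\bigcup_(g in pairs S :\ f) Q g) U| = \sum_(g in pairs S :\ f) #|ins (Q g) U|.
Proof.
move=> QV; have -> : ins (\bigcup_(g in pairs S :\ f) Q g) U =
   \bigcup_(g in pairs S :\ f) ins (Q g) U.
  apply/setP=> p; rewrite inE; apply/andP/bigcupP => [[/bigcupP[g gS pQ] pU]|[g gS]].
    by exists g => //; rewrite inE pQ.
  by rewrite inE => /andP[pQ pU]; split => //; apply/bigcupP; exists g.
apply: card_bigcup_disj => g h gS hS ngh; rewrite -setI_eq0; apply/eqP/setP => p.
rewrite !inE; apply/negP => /andP[/andP[pg _] /andP[ph _]]; move/eqP: ngh; apply.
by apply: (node_pair_uniq (p := p)) => //; [apply: (subsetP (QV g gS)) | apply: (subsetP (QV h hS))].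
Qed.

Lemma ins_setT Q : ins Q setT = Q.
Proof. by apply/setP => p; rewrite inE subsetT andbT. Qed.

Lemma node_card_leaves (Q : {set T} -> {set {set T}}) :
  (forall g, g \in pairs S :\ f -> Q g \subset pairs (V g)) ->
  #|\bigcup_(g in pairs S :\ f) Q g| = \sum_(g in pairs S :\ f) #|Q g|.
Proof.
move=> QV; have := node_ins setT QV; rewrite ins_setT => ->.
by apply: eq_bigr => g _; rewrite ins_setT.
Qed.

Lemma node_card_ins U : #|ins (pairs S :\ f) U| = 'C(#|S :&: U|, 2) - (f \subset U).
Proof.
rewrite -card_pairs.
have -> : ins (pairs S :\ f) U = pairs (S :&: U) :\ f.
  apply/setP => p; rewrite !inE subsetI; case: (p == f) => //=.
  by rewrite andbAC.
have := cardsD1 f (pairs (S :&: U)).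
have -> : (f \in pairs (S :&: U)) = (f \subset U).
  by rewrite in_pairs subsetI (pairs_sub fS) (pairs_card fS) eqxx andbT.
by move=> ->; rewrite addKn.
Qed.

(** A child whose root lies in [U] pays for its leaves by its vertices beyond the root, up to one
    leaf, which is charged to the root as a pair of the clique. Otherwise [U] misses a vertex of the
    root, so one more vertex of the child counts as new, and alpha <= beta lets it pay for that
    leaf. *)
Lemma node_bound0 alpha beta (Q : {set T} -> {set {set T}}) U : alpha <= beta ->
  (forall g, g \in pairs S :\ f -> Q g \subset pairs (V g)) ->
  (forall g, g \in pairs S :\ f -> bound alpha beta #|ins (Q g) U| #|V g :&: U|) ->
  let u := #|(\bigcup_(g in pairs S :\ f) V g) :&: U| in
  let a := #|S :&: U| in
  a <= u /\
  alpha * #|ins (\bigcup_(g in pairs S :\ f) Q g) U| <=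
     beta * (u - a) + alpha * #|ins (pairs S :\ f) U|.
Proof.
move=> ab QV bd; rewrite /= (node_card r5 U S_r fS VS VV); split; first exact: leq_addr.
rewrite addKn (node_ins U QV) -[#|ins (pairs S :\ f) U|]sum1_card.
rewrite !big_distrr /= (big_mkcond (mem (ins _ _))) /=.
rewrite [X in _ + X](_ : _ = \sum_(g in pairs S :\ f) (if g \subset U then alpha else 0)).
  rewrite -big_split /=; apply: leq_sum => g gS.
  apply: leq_trans (bd g gS) _.
  have g2 : #|g| = 2 by case/setD1P: gS => _ /pairs_card.
  have gV : #|g :&: U| <= #|V g :&: U| by apply/subset_leq_card/setSI/node_root_sub.
  case: ifP => u2; first by [].
  case: ifP => gU; first by rewrite (setIidPl gU) g2.
  have : #|g :&: U| < 2.
    rewrite ltnNge -g2; apply/negP => le; move/negP: gU; apply.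
    by apply/setIidPl/eqP; rewrite eqEcard subsetIl.
  rewrite addn0 => b1; apply: (@leq_trans (beta * (#|V g :&: U| - 2) + beta)).
    by rewrite leq_add2l.
  by rewrite addnC -mulnS leq_mul2l; apply/orP; right; lia.
rewrite [RHS]big_mkcond /=; apply: eq_bigr => g _; rewrite inE muln1.
by case: (g \in _).
Qed.

(** This induction step is shared by two densities: r/2 for the free leaves of a pruned tree, and
    lambda for the leaves of a tree. Besides alpha <= beta, only the last hypothesis, on the clique
    alone, depends on the density. *)
Lemma node_bound alpha beta (Q : {set T} -> {set {set T}}) U : alpha <= beta ->
  (forall g, g \in pairs S :\ f -> Q g \subset pairs (V g)) ->
  (forall g, g \in pairs S :\ f -> bound alpha beta #|ins (Q g) U| #|V g :&: U|) ->
  (2 <= #|S :&: U| ->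
    alpha * #|ins (pairs S :\ f) U| <= beta * (#|S :&: U| - 2) + alpha) ->
  bound alpha beta #|ins (\bigcup_(g in pairs S :\ f) Q g) U|
     #|(\bigcup_(g in pairs S :\ f) V g) :&: U|.
Proof.
move=> ab QV bd hN; have /= [au leR] := node_bound0 ab QV bd.
have [a2|a1] := leqP 2 #|S :&: U|.
  rewrite /bound ltnNge (leq_trans a2 au) /=; apply: leq_trans leR _.
  move: au a2 hN; move: #|_ :&: U| #|S :&: U| => u a au a2 hN.
  have -> : u - 2 = (u - a) + (a - 2) by lia.
  by rewrite mulnDr -addnA leq_add2l hN.
have [/existsP[g /andP[gS u2]]|/existsPn no2] :=
    boolP [exists g in pairs S :\ f, 2 <= #|V g :&: U|]; last first.
  rewrite /bound (node_ins U QV) big_distrr /= big1 // => g gS.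
  have := no2 g; rewrite gS /= => u2; have := bd g gS; rewrite /bound ltnNge u2 /=.
  by rewrite leqn0 => /eqP.
have uu h : h \in pairs S :\ f -> #|V h :&: U| <= #|(\bigcup_(g in pairs S :\ f) V g) :&: U|.
  by move=> hS; apply/subset_leq_card/setSI/bigcup_sup.
rewrite /bound ltnNge (leq_trans u2 (uu g gS)) /=.
(* one child carries at least two vertices of U: it pays for the first two *)
rewrite (node_ins U QV) (node_card r5 U S_r fS VS VV) (big_setD1 g) //= [X in _ <= _ * (_ + X - _) + _](big_setD1 g) //=.
have g2 : #|g| = 2 by case/setD1P: gS => _ /pairs_card.
have bg : #|g :&: U| <= #|S :&: U|.
  by apply/subset_leq_card/setSI; case/setD1P: gS => _ /pairs_sub.
have gV : #|g :&: U| <= #|V g :&: U| by apply/subset_leq_card/setSI/node_root_sub.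
have bdg := bd g gS; rewrite /bound ltnNge u2 /= in bdg.
have rest : alpha * \sum_(i in (pairs S :\ f) :\ g) #|ins (Q i) U| <=
   beta * \sum_(i in (pairs S :\ f) :\ g) (#|V i :&: U| - #|i :&: U|).
  rewrite !big_distrr /=; apply: leq_sum => h /setD1P[_ hS].
  apply: leq_trans (bd h hS) _; case: ifP => // u2h.
  have b1 : #|h :&: U| <= 1.
    apply: leq_trans (_ : #|S :&: U| <= _); last by rewrite -ltnS.
    by apply/subset_leq_card/setSI; case/setD1P: hS => _ /pairs_sub.
  apply: (@leq_trans (beta * (#|V h :&: U| - 2) + beta)); first by rewrite leq_add2l.
  by rewrite addnC -mulnS leq_mul2l; apply/orP; right; lia.
rewrite mulnDr; apply: leq_trans (leq_add bdg rest) _.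
rewrite addnAC leq_add2r -mulnDr leq_mul2l; apply/orP; right.
move: (\sum_(i in _ :\ g) _) u2 bg gV => c.
move: #|V g :&: U| #|g :&: U| #|S :&: U| => ug b a. lia.
Qed.

End Node.

(** Replacing a leaf by a clique adds r - 2 vertices and D - 1 leaves, and lambda is the ratio of
    these numbers. Free leaves are counted too; the equation is cleared of denominators to stay in
    [nat]. *)
Lemma tr_count f V F P : tr f V F P ->
  [disjoint F & P] /\
  (r - 2) * (#|F| + #|P|) + 2 * ('C(r, 2) - 2) = ('C(r, 2) - 2) * #|V| + (r - 2).
Proof.
elim=> {f V F P} [f f2|f f2|f S V F P S_r fS tg IH VS VV].
- by rewrite f2 cards1 cards0 -setI_eq0 setI0 eqxx; split => //; lia.
- by rewrite f2 cards1 cards0 -setI_eq0 set0I eqxx; split => //; lia.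
have FV g : g \in pairs S :\ f -> F g \subset pairs (V g) by move=> /tg/tr_leaves[].
have PV g : g \in pairs S :\ f -> P g \subset pairs (V g) by move=> /tg/tr_leaves[].
split.
  rewrite -setI_eq0; apply/eqP/setP => p; rewrite !inE; apply/negP => /andP[/bigcupP[g gS pg]].
  case/bigcupP => h hS ph.
  have gh := node_pair_uniq VS VV gS hS (subsetP (FV g gS) _ pg) (subsetP (PV h hS) _ ph).
  move: ph; rewrite -gh; case: (IH g gS) => /pred0P/(_ p) /=; by rewrite pg /= => ->.
rewrite (node_card_leaves VS VV FV) (node_card_leaves VS VV PV).
have := node_card r5 setT S_r fS VS VV; rewrite !setIT S_r => ->; rewrite -big_split /=.
set d := 'C(r, 2) - 2.
have Dd : #|pairs S :\ f| = d.+1.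
  rewrite card_root_out // /d; have : 2 < 'C(r, 2) by rewrite (leq_trans _ (leq_bin2l 2 r5)).
  lia.
have : \sum_(g in pairs S :\ f) ((r - 2) * (#|F g| + #|P g|)) =
   \sum_(g in pairs S :\ f) (d * (#|V g :&: setT| - #|g :&: setT|) + (r - 2)).
  apply: eq_bigr => g gS; rewrite !setIT.
  have [gV g2] := tr_root r5 (tg g gS); have := subset_leq_card gV.
  have [_] := IH g gS; rewrite -/d g2; nia.
rewrite big_split /= sum_nat_const Dd -!big_distrr /= => ->.
nia.
Qed.

End Trees.

Lemma choice_on (I A : Type) (D : I -> Prop) (R : I -> A -> Prop) (a0 : A) :
  (forall i, D i -> exists a, R i a) -> exists a, forall i, D i -> R i (a i).
Proof.
move=> h; have [|t ht] := @choice _ _ (fun i (t : A) => D i -> R i t); last by exists t.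
by move=> i; have [Di|nDi] := pselect (D i); [have [a] := h i Di; exists a|exists a0].
Qed.

Lemma choice3_on (I A B C : Type) (D : I -> Prop) (R : I -> A -> B -> C -> Prop)
    (a0 : A) (b0 : B) (c0 : C) :
  (forall i, D i -> exists a b c, R i a b c) ->
  exists a b c, forall i, D i -> R i (a i) (b i) (c i).
Proof.
move=> h; have [|t ht] := @choice_on _ _ D (fun i (t : A * B * C) => R i t.1.1 t.1.2 t.2) (a0, b0, c0).
  by move=> i /h [a [b [c abc]]]; exists (a, b, c).
by exists (fun i => (t i).1.1), (fun i => (t i).1.2), (fun i => (t i).2).
Qed.

(** * Pruning a tree at given vertex sets *)

Section Prune.
Variables (T : finType) (r : nat).
Hypothesis r5 : 4 < r.
Implicit Types (V W S U A : {set T}) (e f g h p : {set T}) (E F P Q : {set {set T}}).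
Local Notation tr := (@tr T r).

(** Equality holds at a = 2 and at a = r - 1: by convexity of a (a - 1) the bound is the chord
    between these points. At a = r, when the whole clique is inside, it fails. *)
Lemma bin2_prune a : 2 <= a -> a < r -> 2 * 'C(a, 2) <= r * (a - 2) + 2.
Proof. move=> a2 ar; rewrite twice_bin2; case: a a2 ar => [|[|a]] //= _ ar. nia. Qed.

Variable UU : {set {set T}}.

Definition in_some p := [exists U in UU, p \subset U].

(** The tree is cut at pairs that lie in a member of [UU]. Every free leaf remembers the subtree
    removed there; [attach] uses it to show that the leaf belongs to the closed set of its component
    and not merely to the vertex set. *)
Definition pruned f V F P V0 F0 P0 : Prop :=
  [/\ tr f V F P, V \subset V0, F \subset F0,
     (forall p, p \in P -> in_some p /\
        exists V1 F1 P1, [/\ tr p V1 F1 P1, V1 \subset V0, F1 \subset F0 & P1 \subset P0]) &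
     (forall p, p \in F -> ~~ in_some p)].

Definition prunable f V0 F0 P0 : Prop := exists V F P, pruned f V F P V0 F0 P0 /\
  forall U, U \in UU -> bound 2 r #|ins P U| #|V :&: U|.

Lemma prune_leaf f V0 F0 P0 : tr f V0 F0 P0 -> in_some f -> prunable f V0 F0 P0.
Proof.
move=> tf sf; have [fV f2] := tr_root r5 tf.
exists f, set0, [set f]; split.
  split; [exact: TrP | exact: fV | exact: sub0set | | by move=> p; rewrite inE].
  by move=> p; rewrite inE => /eqP ->; split => //; exists V0, F0, P0.
move=> U _; have -> : ins [set f] U = if f \subset U then [set f] else set0.
  apply/setP => p; rewrite inE in_set1; case: eqP => [->|] /=; case: ifP => //=; rewrite ?inE ?eqxx //.
  by move=> _ /eqP/negbTE.
case: ifP => fU; last by rewrite cards0 /bound muln0.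
by rewrite cards1 (setIidPl fU) f2 /bound /= muln0.
Qed.

Section PruneNode.
Variables (f S : {set T}) (V0 : {set T} -> {set T}) (F0 P0 : {set T} -> {set {set T}}).
Hypotheses (S_r : #|S| = r) (fS : f \in pairs S).
Hypothesis VS : forall g, g \in pairs S :\ f -> V0 g :&: S = g.
Hypothesis VV : forall g h, g \in pairs S :\ f -> h \in pairs S :\ f -> g != h ->
  V0 g :&: V0 h \subset S.
Hypothesis child : forall g, g \in pairs S :\ f -> prunable g (V0 g) (F0 g) (P0 g).

(** Only the children are pruned, so the root itself may lie in a member of [UU]. If it does, it is
    a pair of the clique inside [U] that carries no child, and the bound on free leaves improves by
    one. *)
Lemma prune_node : exists V F P,
  pruned f V F P (\bigcup_(g in pairs S :\ f) V0 g) (\bigcup_(g in pairs S :\ f) F0 g)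
    (\bigcup_(g in pairs S :\ f) P0 g) /\
  forall U, U \in UU -> ~~ (S \subset U) ->
    (~~ (f \subset U) -> bound 2 r #|ins P U| #|V :&: U|) /\
    (f \subset U -> 2 * #|ins P U| <= r * (#|V :&: U| - 2)).
Proof.
have [V [F [P VFP]]] := @choice3_on _ _ _ _ (fun g => g \in pairs S :\ f)
  (fun g V F P => pruned g V F P (V0 g) (F0 g) (P0 g) /\
  forall U, U \in UU -> bound 2 r #|ins P U| #|V :&: U|) set0 set0 set0 child.
have tV g : g \in pairs S :\ f -> tr g (V g) (F g) (P g) by move/VFP => [[]].
have sV g : g \in pairs S :\ f -> V g \subset V0 g by move/VFP => [[]].
have VS' g : g \in pairs S :\ f -> V g :&: S = g.
  move=> gS; apply/eqP; rewrite eqEsubset -{2}(VS gS) setSI ?sV //=.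
  rewrite subsetI (tr_sub r5 (tV g gS)) /=.
  by case/setD1P: gS => _ /pairs_sub.
have VV' g h : g \in pairs S :\ f -> h \in pairs S :\ f -> g != h -> V g :&: V h \subset S.
  by move=> gS hS ngh; apply: subset_trans (VV gS hS ngh); apply: setISS; apply: sV.
have PV g : g \in pairs S :\ f -> P g \subset pairs (V g) by move=> /tV/tr_leaves[].
have bd U : U \in UU -> forall g, g \in pairs S :\ f ->
  bound 2 r #|ins (P g) U| #|V g :&: U| by move=> UU_ g /VFP[_]; apply.
exists (\bigcup_(g in pairs S :\ f) V g), (\bigcup_(g in pairs S :\ f) F g),
  (\bigcup_(g in pairs S :\ f) P g); split.
  split; first exact: TrN.
  - by apply/bigcupsP => g gS; apply: subset_trans (sV g gS) (bigcup_sup _ gS).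
  - apply/bigcupsP => g gS; apply: subset_trans (bigcup_sup _ gS).
    by case: (VFP g gS) => -[].
  - move=> p /bigcupP[g gS pP]; case: (VFP g gS) => -[_ _ _ /(_ p pP)].
    move=> [sp [V1 [F1 [P1 [t1 V1s F1s P1s]]]]] _ _; split => //; exists V1, F1, P1.
    by split => //; [apply: subset_trans V1s _|apply: subset_trans F1s _|apply: subset_trans P1s _];
       apply: (bigcup_sup g gS).
  - by move=> p /bigcupP[g gS pF]; case: (VFP g gS) => -[_ _ _ _ /(_ p pF)].
move=> U UU_ nSU.
have aS : #|S :&: U| < r.
  rewrite -S_r; apply: proper_card; rewrite properEneq subsetIl andbT.
  by apply: contra nSU => /eqP/setIidPl.
split=> fU.
  apply: (node_bound r5 S_r fS VS' VV' _ PV (bd U UU_)); first by lia.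
  move=> a2; rewrite (node_card_ins fS) (negbTE fU) subn0; exact: bin2_prune.
have [|] := node_bound0 r5 S_r fS VS' VV' _ PV (bd U UU_); first by lia.
move=> /= au leR; apply: leq_trans leR _; rewrite (node_card_ins fS) fU.
have a2 : 2 <= #|S :&: U|.
  by rewrite -(pairs_card fS); apply: subset_leq_card; rewrite subsetI (pairs_sub fS).
have := bin2_prune a2 aS; move: au a2; move: #|S :&: U| #|_ :&: U| => a u au a2.
move: ('C(a, 2)) => b; nia.
Qed.

End PruneNode.

Lemma prune f V0 F0 P0 : tr f V0 F0 P0 -> (forall p, p \in P0 -> in_some p) ->
  ~~ in_some f -> prunable f V0 F0 P0.
Proof.
elim=> {f V0 F0 P0} [f f2|f f2|f S V F P S_r fS tg IH VS VV] Pin nf.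
- exists f, [set f], set0; split.
    split; [exact: TrG | by [] | by [] | by move=> p; rewrite inE |].
    by move=> p; rewrite inE => /eqP ->.
  move=> U _; have -> : ins set0 U = set0 by apply/setP => p; rewrite !inE.
  by rewrite cards0 /bound muln0.
- by rewrite Pin ?set11 in nf.
have child g : g \in pairs S :\ f -> prunable g (V g) (F g) (P g).
  move=> gS; have [gin|ngin] := boolP (in_some g); first exact: prune_leaf (tg g gS) gin.
  by apply: IH => // p pP; apply: Pin; apply/bigcupP; exists g.
have [V' [F' [P' [pr bd]]]] := prune_node S_r fS VS VV child.
exists V', F', P'; split => // U UU_.
have nfU : ~~ (f \subset U).
  by apply: contra nf => fU; apply/existsP; exists U; rewrite UU_.
apply: (bd U UU_ _).1 => //; apply: contra nfU; exact/subset_trans/(pairs_sub fS).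
Qed.

Lemma prunable_any f V0 F0 P0 : tr f V0 F0 P0 -> (forall p, p \in P0 -> in_some p) ->
  prunable f V0 F0 P0.
Proof.
by move=> tf Pin; have [/(prune_leaf tf)|/(prune tf Pin)] := boolP (in_some f).
Qed.

End Prune.

(** * Gluing closed edge sets, and scripts *)

Section Closed.
Variables (T : finType) (r : nat).
Hypothesis r5 : 4 < r.
Implicit Types (V W S U A : {set T}) (e f g h p : {set T}) (E F P Q : {set {set T}}).
Local Notation tr := (@tr T r).
Local Notation closed_E := (@closed_E T r).

Lemma closed_set1 f : closed_E [set f].
Proof.
move=> S e S_r eS /subset_leq_card; rewrite cards1 (card_root_out S_r eS).
have := leq_bin2l 2 r5; rewrite (_ : 'C(5, 2) = 10) //; lia.
Qed.

Lemma closed_pairs V : closed_E (pairs V).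
Proof.
move=> S e S_r eS sub; apply: pairsP; last exact: pairs_card eS.
apply/subsetP => x xe; have xS := subsetP (pairs_sub eS) x xe.
have [|g gS xg] := pair_avoid _ eS xS; first by rewrite S_r; lia.
exact: (subsetP (pairs_sub (subsetP sub g gS))).
Qed.

(* For r >= 5 a K_r minus an edge cannot be separated by two vertices, so gluing
   closed graphs along edges creates no new K_r minus an edge. *)
Lemma closed_star (I : finType) (B : {set I}) V0 E0 (V : I -> {set T})
    (E : I -> {set {set T}}) :
  E0 \subset pairs V0 -> closed_E E0 ->
  (forall i, i \in B -> E i \subset pairs (V i)) ->
  (forall i, i \in B -> closed_E (E i)) ->
  (forall i, i \in B -> V i :&: V0 \in E0) ->
  (forall i, i \in B -> V i :&: V0 \in E i) ->
  (forall i j, i \in B -> j \in B -> i != j -> V i :&: V j \subset V0) ->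
  closed_E (E0 :|: \bigcup_(i in B) E i).
Proof.
move=> E0V cE0 EV cE q0 qi VV S e S_r eS hE.
have in0 p : p \in E0 :|: \bigcup_(i in B) E i -> p \subset V0 -> p \in E0.
  case/setUP => // /bigcupP[i iB pE] pV0; have := q0 i iB.
  have pV := subsetP (EV i iB) p pE.
  suff -> : V i :&: V0 = p by [].
  apply/esym/pair_eq; first exact: pairs_card pV.
    exact: pairs_card (subsetP E0V _ (q0 i iB)).
  by rewrite subsetI (pairs_sub pV).
have ini i p : i \in B -> p \in E0 :|: \bigcup_(i in B) E i -> p \subset V i -> p \in E i.
  move=> iB pE pVi.
  have [pV0|npV0] := boolP (p \subset V0).
    have pE0 := in0 p pE pV0.
    suff <- : V i :&: V0 = p by apply: qi.
    apply/esym/pair_eq; first exact: pairs_card (subsetP E0V _ pE0).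
      exact: pairs_card (subsetP E0V _ (q0 i iB)).
    by rewrite subsetI pVi.
  case/setUP: pE => [/(subsetP E0V)/pairs_sub pV0|/bigcupP[j jB pEj]].
    by rewrite pV0 in npV0.
  have [->//|nij] := eqVneq i j.
  case/negP: npV0; apply: subset_trans (VV i j iB jB nij).
  by rewrite subsetI pVi (pairs_sub (subsetP (EV j jB) p pEj)).
have [SV0|/subsetPn[x xS nxV0]] := boolP (S \subset V0).
  apply/setUP; left; apply: (cE0 S) => //; apply/subsetP => g gS; apply: in0.
    exact: (subsetP hE).
  by apply: subset_trans SV0; case/setD1P: gS => _ /pairs_sub.
have inV v p : p \in E0 :|: \bigcup_(i in B) E i -> v \in p -> v \notin V0 ->
    exists2 i, i \in B & p \in E i.
  case/setUP => [/(subsetP E0V)/pairs_sub/subsetP sp vp|/bigcupP[i iB pE] _ _]; last by exists i.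
  by rewrite sp.
have [|g gS xg] := pair_avoid _ eS xS; first by rewrite S_r; lia.
have [i iB gE] := inV x g (subsetP hE g gS) xg nxV0.
have xV : x \in V i by apply: (subsetP (pairs_sub (subsetP (EV i iB) g gE))).
have [SVi|/subsetPn[y yS nyV]] := boolP (S \subset V i).
  apply/setUP; right; apply/bigcupP; exists i => //.
  apply: (cE i iB S) => //; apply/subsetP => h hS; apply: ini => //.
    exact: (subsetP hE).
  by apply: subset_trans SVi; case/setD1P: hS => _ /pairs_sub.
have key z w : z \in S -> z \in V i -> z \notin V0 -> w \in S -> w \notin V i -> [set z; w] = e.
  move=> zS zV nzV0 wS nwV; apply/eqP/negP => /negP ne.
  have nzw : z != w by apply: contraNneq nwV => <-.
  have zwE : [set z; w] \in E0 :|: \bigcup_(i in B) E i.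
    by apply: (subsetP hE); rewrite in_setD1 ne set2_pairs.
  have [j jB zwj] := inV z _ zwE (set21 z w) nzV0.
  have sub := pairs_sub (subsetP (EV j jB) _ zwj).
  have [ij|nij] := eqVneq i j.
    by move: nwV; rewrite ij (subsetP sub) // set22.
  move: nzV0; rewrite (subsetP (VV i j iB jB nij)) // inE zV (subsetP sub) //.
  exact: set21.
have exy := key x y xS xV nxV0 yS nyV.
have sub : S \subset [set x; y] :|: (V i :&: V0).
  apply/subsetP => z zS; rewrite !inE.
  have [zV|nzV] := boolP (z \in V i); last first.
    have := key x z xS xV nxV0 zS nzV; rewrite -exy => /setP/(_ z).
    rewrite !inE eqxx orbT => /esym/orP[/eqP->|->]; rewrite ?eqxx ?orbT //.
  have [zV0|nzV0] := boolP (z \in V0); first by rewrite orbT.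
  have := key z y zS zV nzV0 yS nyV; rewrite -exy => /setP/(_ z).
  by rewrite !inE eqxx => /esym ->.
suff : r <= 4 by rewrite leqNgt r5.
rewrite -S_r; apply: leq_trans (subset_leq_card sub) _.
apply: leq_trans (leq_card_setU _ _) _.
by rewrite cards2 (pairs_card (subsetP E0V _ (q0 i iB))); case: (x != y).
Qed.

Variables (G X : {set {set T}}).

Definition goodp g W : Prop :=
  exists V F P, [/\ tr g V F P, V \subset W, F \subset G & P \subset X].

Lemma goodpS g W W' : W \subset W' -> goodp g W -> goodp g W'.
Proof.
by move=> sW [V [F [P [tg VW FG PX]]]]; exists V, F, P; split => //; apply: subset_trans VW sW.
Qed.

(** [E] collects the pairs of all cliques of the tree. Each is the root of a subtree, so good trees
    placed on the free leaves make every pair of [E] good, and [closed_star] keeps [E] closed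
    through the recursion. *)
Lemma tr_graft f V F P : tr f V F P -> exists E,
  [/\ E \subset pairs V, closed_E E, f \in E, F \subset E & P \subset E] /\
  (F \subset G -> forall W : {set T} -> {set T},
     (forall p, p \in P -> goodp p (W p)) ->
     (forall p, p \in P -> W p :&: V = p) ->
     (forall p q, p \in P -> q \in P -> p != q -> W p :&: W q \subset V) ->
     forall g, g \in E -> goodp g (V :|: \bigcup_(p in P) W p)).
Proof.
elim=> {f V F P} [f f2|f f2|f S V F P S_r fS tg IH VS VV].
- exists [set f]; split.
    by rewrite set11 sub0set sub1set pairsP //; split => //; apply: closed_set1.
  move=> fG W _ _ _ g; rewrite inE => /eqP ->; exists f, [set f], set0.
  by split; [exact: TrG|exact: subsetUl|exact: fG|exact: sub0set].
- exists [set f]; split.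
    by rewrite set11 sub0set sub1set pairsP //; split => //; apply: closed_set1.
  move=> fG W gW _ _ g; rewrite inE => /eqP ->; apply: (goodpS _ (gW f (set11 f))).
  by apply: subset_trans (subsetUr _ _); apply: (bigcup_sup f); rewrite ?set11.
have [E hE] := choice_on set0 IH.
have gE g : g \in pairs S :\ f -> g \in E g by move/hE => [[]].
have EV g : g \in pairs S :\ f -> E g \subset pairs (V g) by move/hE => [[]].
have SV : S \subset \bigcup_(g in pairs S :\ f) V g := node_sub r5 S_r fS VS.
exists (pairs S :|: \bigcup_(g in pairs S :\ f) E g); split.
  split.
  - rewrite subUset pairsS //=; apply/bigcupsP => g gS.
    exact: subset_trans (EV g gS) (pairsS (bigcup_sup g gS)).
  - apply: (closed_star (subxx _)) (EV) _ _ _ VV; first exact: closed_pairs.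
    + by move=> g /hE[[]].
    + by move=> g gS; rewrite VS //; case/setD1P: gS.
    + by move=> g gS; rewrite VS // gE.
  - by rewrite inE fS.
  - apply: subset_trans (subsetUr _ _); apply/bigcupsP => g gS.
    by apply: subset_trans (bigcup_sup g gS); case/hE: gS => [[]].
  - apply: subset_trans (subsetUr _ _); apply/bigcupsP => g gS.
    by apply: subset_trans (bigcup_sup g gS); case/hE: gS => [[]].
move=> FG W gW WV WW.
set VV' := \bigcup_(g in pairs S :\ f) V g in WV WW *.
set PP := \bigcup_(g in pairs S :\ f) P g in gW WV WW *.
have Pin g p : g \in pairs S :\ f -> p \in P g -> p \in PP.
  by move=> gS pP; apply/bigcupP; exists g.
have Vin g : g \in pairs S :\ f -> V g \subset VV' by move=> gS; apply: bigcup_sup.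
have pV g p : g \in pairs S :\ f -> p \in P g -> p \subset V g.
  by move=> gS pP; apply/pairs_sub/(subsetP (tr_leaves (tg g gS)).2).
have sub g p : g \in pairs S :\ f -> p \in E g -> goodp p (V g :|: \bigcup_(q in P g) W q).
  move=> gS; have [_] := hE g gS; apply.
  - by apply: subset_trans FG; apply: bigcup_sup gS.
  - by move=> q qP; apply: gW (Pin g q gS qP).
  - move=> q qP; have qPP := Pin g q gS qP; apply/eqP; rewrite eqEsubset; apply/andP; split.
      by apply: subset_trans (setIS _ (Vin g gS)) _; rewrite WV.
    rewrite subsetI (pV g q gS qP) andbT.
    by apply: subset_trans (subsetIl (W q) VV'); rewrite WV.
  - move=> q q' qP q'P nqq'; apply: subset_trans (pV g q gS qP).
    have qPP := Pin g q gS qP; apply: subset_trans (_ : W q :&: VV' \subset _); last by rewrite WV.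
    by rewrite subsetI subsetIl WW //; apply: Pin gS q'P.
have big g : g \in pairs S :\ f ->
    V g :|: \bigcup_(q in P g) W q \subset VV' :|: \bigcup_(q in PP) W q.
  move=> gS; apply: setUSS; first exact: Vin.
  by apply/bigcupsP => q qP; apply: bigcup_sup; apply: Pin gS qP.
move=> g /setUP[gS|/bigcupP[h hS gEh]]; last exact: goodpS (big h hS) (sub h g hS gEh).
have [{g gS}->|ngf] := eqVneq g f; last first.
  have gS' : g \in pairs S :\ f by rewrite in_setD1 ngf.
  exact: goodpS (big g gS') (sub g g gS' (gE g gS')).
have [V' [F' [P' h']]] := @choice3_on _ _ _ _ (fun g => g \in pairs S :\ f)
   _ set0 set0 set0 (fun g gS => sub g g gS (gE g gS)).
exists (\bigcup_(g in pairs S :\ f) V' g), (\bigcup_(g in pairs S :\ f) F' g),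
  (\bigcup_(g in pairs S :\ f) P' g).
have inW g x : g \in pairs S :\ f -> x \in V' g -> x \in VV' -> x \in V g.
  move=> gS xV' xVV; have [_ /subsetP/(_ x xV') /setUP[//|/bigcupP[q qP xW]] _ _] := h' g gS.
  by apply: (subsetP (pV g q gS qP)); rewrite -(WV q (Pin g q gS qP)) inE xW.
split.
- apply: TrN => //; first by move=> g /h'[].
  + move=> g gS; have [tg' _ _ _] := h' g gS; apply/eqP; rewrite eqEsubset; apply/andP; split.
      apply/subsetP => x /setIP[xV' xS]; rewrite -(VS g gS) inE xS andbT.
      exact: inW gS xV' (subsetP SV x xS).
    by rewrite subsetI (tr_sub r5 tg'); case/setD1P: gS => _ /pairs_sub.
  + move=> g h gS hS ngh; apply/subsetP => x /setIP[xg xh].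
    suff xV : x \in VV'.
      by apply: (subsetP (VV g h gS hS ngh)); rewrite inE !inW.
    have [_ /subsetP/(_ x xg) /setUP[/(subsetP (Vin g gS))//|/bigcupP[q qP xq]] _ _] := h' g gS.
    have [_ /subsetP/(_ x xh) /setUP[/(subsetP (Vin h hS))//|/bigcupP[q' q'P xq']] _ _] := h' h hS.
    apply: (subsetP (WW q q' (Pin g q gS qP) (Pin h q' hS q'P) _)); last by rewrite inE xq.
    apply: contraNneq ngh => qq'; apply/eqP; apply: (node_pair_uniq VS VV gS hS (p := q)).
      exact: (subsetP (tr_leaves (tg g gS)).2).
    by rewrite qq'; apply: (subsetP (tr_leaves (tg h hS)).2).
- apply/bigcupsP => g gS; apply: subset_trans (big g gS); by have [] := h' g gS.
- by apply/bigcupsP => g gS; have [] := h' g gS.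
- by apply/bigcupsP => g gS; have [] := h' g gS.
Qed.

(* (V, F) is built by adding trees one after the other. Each tree adds
   1 + #|P1| + #|V1| to th, so that th - #|V| pays for every tree, every free leaf and
   every vertex that is used again. *)
Inductive scr : nat -> {set T} -> {set {set T}} -> Prop :=
| Scr0 : scr 0 set0 set0
| ScrS th V F g V1 F1 P1 of scr th V F & tr g V1 F1 P1 & [disjoint F & F1] :
    scr (th + (1 + #|P1| + #|V1|)) (V :|: V1) (F :|: F1).

Lemma scr_cat th V F th' V' F' : scr th V F -> scr th' V' F' -> [disjoint F & F'] ->
  scr (th + th') (V :|: V') (F :|: F').
Proof.
move=> s; elim=> {th' V' F'} [|th' V' F' g V1 F1 P1 _ IH t1 d1] dis.
  by rewrite addn0 !setU0.
rewrite addnA !setUA; move: dis; rewrite disjoints_subset setCU subsetI -!disjoints_subset.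
move=> /andP[dF' dF1]; apply: ScrS (IH dF') t1 _.
by rewrite disjoints_subset subUset -!disjoints_subset dF1 d1.
Qed.

Lemma scr_tr f V F P : tr f V F P -> scr (1 + #|P| + #|V|) V F.
Proof.
move=> tf; have := ScrS Scr0 tf; rewrite !set0U add0n; apply.
by rewrite -setI_eq0 set0I.
Qed.

Lemma scr_big (I : finType) (B : {set I}) (th : I -> nat) (V : I -> {set T})
    (F : I -> {set {set T}}) :
  (forall i, i \in B -> scr (th i) (V i) (F i)) ->
  (forall i j, i \in B -> j \in B -> i != j -> [disjoint F i & F j]) ->
  scr (\sum_(i in B) th i) (\bigcup_(i in B) V i) (\bigcup_(i in B) F i).
Proof.
elim: {B}_.+1 {-2}B (ltnSn #|B|) => // k IHk B leBk hs disj.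
have [->|[i iB]] := set_0Vmem B; first by rewrite !big_set0; exact: Scr0.
rewrite !(big_setD1 i iB) /=; apply: scr_cat; first exact: hs.
  apply: IHk; first by move: leBk; rewrite (cardsD1 i) iB.
    by move=> j /setD1P[_ jB]; apply: hs.
  by move=> j h /setD1P[_ jB] /setD1P[_ hB]; apply: disj.
apply/bigcup_disjointP => j /setD1P[nji jB].
by rewrite disj // eq_sym.
Qed.

Lemma scr_lt th V F : scr th V F -> #|V| + (0 < th) <= th /\ (V != set0 -> 0 < th).
Proof.
elim=> [|{}th {}V {}F g V1 F1 P1 _ [IH _] _ _]; first by rewrite cards0 eqxx.
by split; [rewrite cardsU; lia | lia].
Qed.

End Closed.

(** * Exponents and prices *)

Section Constants.
Variables (R : realFieldType) (r : nat).
Hypothesis r5 : 4 < r.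
Local Open Scope ring_scope.

Definition lam : R := ('C(r, 2) - 2)%N%:R / (r - 2)%N%:R.
(** The gain of the true density lambda over the chord slope of [bin2_prune]; by [kapE] it equals (r
    - 4) / (2 (r - 2)). *)
Definition kap : R := lam - r%:R / 2.
(** The price of one unit of the excess th - |V| of a script. The denominator makes room for D
    attached trees at 4 each and for the error terms of [num_step] and [num_merge]. *)
Definition c0 : R := kap / (4 * ('C(r, 2) - 1) + r + 10)%N%:R.
Definition phi (v : nat) : R := lam * (v%:R - 2) + 1.

Lemma bin2_ge10 : (10 <= 'C(r, 2))%N.
Proof. by rewrite (leq_trans _ (leq_bin2l 2 r5)). Qed.

Lemma r2_gt0 : 0 < (r - 2)%N%:R :> R.
Proof. by rewrite ltr0n; lia. Qed.

Lemma lamE : lam * (r - 2)%N%:R = ('C(r, 2) - 2)%N%:R.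
Proof. by rewrite /lam mulfVK // gt_eqF // r2_gt0. Qed.

Lemma bin2r : 2 * ('C(r, 2))%:R = r%:R * (r%:R - 1) :> R.
Proof.
have := congr1 (fun k => k%:R : R) (twice_bin2 r); rewrite /= !natrM => ->.
by rewrite -subn1 natrB //; lia.
Qed.

Lemma r_ge5 : 5 <= r%:R :> R.
Proof. by rewrite (ler_nat R 5). Qed.

Lemma lamE' : lam * (r%:R - 2) + 2 = ('C(r, 2))%:R.
Proof.
have := lamE; rewrite natrB; last by lia.
rewrite natrB ?(leq_trans _ bin2_ge10) // => ->. by rewrite subrK.
Qed.

Lemma kapE : 2 * kap * (r%:R - 2) = r%:R - 4.
Proof. have := lamE'; have := bin2r; rewrite /kap; nra. Qed.

Lemma kap_gt0 : 0 < kap.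
Proof. have := kapE; have := r_ge5; nra. Qed.

Lemma kap_le : kap <= 2^-1.
Proof.
have := kapE; have := r_ge5 => r_ge kE; rewrite leNgt; apply/negP => k.
have : 2 * 2^-1 * (r%:R - 2) < 2 * kap * (r%:R - 2) by rewrite ltr_pM2r ?ltr_pM2l //; lra.
by rewrite kE mulfV ?pnatr_eq0 // mul1r; lra.
Qed.

Lemma lam_kap : lam = r%:R / 2 + kap.
Proof. by rewrite /kap addrC subrK. Qed.

Lemma c0E : c0 * (4 * ('C(r, 2) - 1)%N%:R + r%:R + 10) = kap.
Proof.
rewrite /c0 2!natrD natrM mulfVK // gt_eqF //.
by rewrite ltr_pwDr // addr_ge0 ?mulr_ge0 ?ler0n.
Qed.

Lemma c0_gt0 : 0 < c0.
Proof. by rewrite divr_gt0 ?kap_gt0 // ltr0n; lia. Qed.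

Lemma lam_ge1 : 1 <= lam.
Proof. by rewrite lam_kap; have := r_ge5; have := kap_gt0; lra. Qed.

(* The one place where c0 has to be small: t copies of 4 and a few multiples of c0
   cannot eat up a cost of kap. *)
Lemma c0_small (t : nat) : (t <= 'C(r, 2) - 1)%N -> c0 * (4 * t%:R + r%:R + 10) <= kap.
Proof.
move=> tD; rewrite -c0E ler_wpM2l ?(ltW c0_gt0) // !lerD2r ler_wpM2l // ler_nat //.
Qed.

Lemma c0_le1 : c0 <= 1.
Proof.
have := c0_small (leq0n _); have := kap_le; have := c0_gt0; have := r_ge5 => h1 h2 h3.
rewrite mulr0 add0r => h4; rewrite -[leLHS]mulr1.
apply: (@le_trans _ _ (c0 * (r%:R + 10))); first by rewrite ler_wpM2l //; [exact: ltW | lra].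
by apply: le_trans h4 _; lra.
Qed.

End Constants.

(** * Dense blocks and components *)

Section Config.
Variables (T : finType) (r : nat) (R : realFieldType).
Hypothesis r5 : (4 < r)%N.
Implicit Types (V W S U A : {set T}) (e f g h p : {set T}) (E F P Q : {set {set T}}).
Local Notation tr := (@tr T r).
Local Notation closed_E := (@closed_E T r).
Local Notation scr := (@scr T r).
Local Notation lam := (lam R r).
Local Notation kap := (kap R r).
Local Notation c0 := (c0 R r).
Local Notation phi := (phi R r).
Local Notation D := ('C(r, 2) - 1)%N.

(** A component: its vertices, the edges of G that make it dense, and a closed set of pairs which
    are roots of trees inside it. *)
Definition comp : finType := ({set T} * {set {set T}} * {set {set T}})%type.
Definition cV (c : comp) : {set T} := c.1.1.
Definition cF (c : comp) : {set {set T}} := c.1.2.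
Definition cE (c : comp) : {set {set T}} := c.2.
Implicit Types (b c : comp) (B C K : {set comp}).

Variables (G : {set {set T}}) (L M : nat).

(** [t] counts the attached trees. The reserve 3 is what a component adds to the excess when it is
    glued to a tree along a free leaf: two repeated vertices and that leaf. The enlarged component
    is left with -1 instead of 3, hence the loss of 4 per tree. *)
Definition qual (t : nat) V F : Prop := exists th, scr th V F /\
  (phi #|V| + c0 * (th%:R - #|V|%:R + 3 - 4 * t%:R) <= #|F|%:R)%R.

(* Without dense scripts in the size window ]L, M], gluing boundedly many pieces of
   size at most L never produces a dense script larger than L. *)
Definition no_crossing : Prop := forall th V F, F \subset G -> F \subset pairs V ->
  scr th V F -> (phi #|V| + c0 * (th%:R - #|V|%:R - 4 * D%:R) <= #|F|%:R)%R ->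
  #|V| <= M -> #|V| <= L.

(* A configuration is a family of dense blocks, regarded as complete graphs. The
   structure theorem works with one that covers as many pairs as possible. *)
Definition config B : Prop :=
  (forall b, b \in B -> [/\ cF b \subset G, cF b \subset pairs (cV b), cE b = pairs (cV b),
      2 <= #|cV b| <= L & qual 0 (cV b) (cF b)]) /\
  (forall b c, b \in B -> c \in B -> b != c -> #|cV b :&: cV c| <= 1).

Definition fat B : {set {set T}} := \bigcup_(b in B) pairs (cV b).

Lemma exists_max_config : exists2 B, config B &
  forall B', config B' -> #|fat B'| <= #|fat B|.
Proof.
have c_0 : `[< config set0 >].
  by apply/asboolP; split=> [b|b c]; rewrite inE.
have [B /asboolP cB maxB] :=
  @arg_maxnP _ set0 (fun B => `[< config B >]) (fun B => #|fat B|) c_0.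
by exists B => // B' cB'; apply: maxB; apply/asboolP.
Qed.

Lemma disjoint_pairs V W F F' : F \subset pairs V -> F' \subset pairs W ->
  #|V :&: W| <= 1 -> [disjoint F & F'].
Proof.
move=> FV FW le1; rewrite -setI_eq0; apply/eqP/setP => p; rewrite !inE; apply/negP.
move=> /andP[/(subsetP FV) pV /(subsetP FW) pW].
have : #|p| <= #|V :&: W| by apply: subset_leq_card; rewrite subsetI !pairs_sub.
by rewrite (pairs_card pV) => /leq_trans/(_ le1).
Qed.

Hypothesis LM : L * L * L + (D + 3) * L <= M.
Hypothesis noX : no_crossing.
Variable B : {set comp}.
Hypothesis cfgB : config B.
Hypothesis maxB : forall B', config B' -> #|fat B'| <= #|fat B|.

(** A block is swallowed or edge disjoint, so that edge counts add up when a candidate is united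
    with a block. *)
Definition compat V F := [forall b in B,
  ((cV b \subset V) && (cF b \subset F)) || [disjoint cF b & F]].

Definition cand V F : Prop := [/\ F \subset G, F \subset pairs V, 1 < #|V|, qual 0 V F & compat V F].

Lemma qual_noX t V F : t <= D -> F \subset G -> F \subset pairs V -> qual t V F ->
  #|V| <= M -> #|V| <= L.
Proof.
move=> tD FG FV [th [s le]]; apply: (noX FG FV s); apply: le_trans le.
rewrite lerD2l ler_wpM2l ?(ltW (c0_gt0 R r5)) //.
have : (t%:R <= D%:R :> R)%R by rewrite ler_nat. lra.
Qed.

Lemma LM2 : L + L <= M.
Proof.
apply: leq_trans LM; apply: leq_trans (leq_addl _ _).
by rewrite mulnDl; apply: leq_trans (leq_addl _ _); lia.
Qed.

Lemma card_gt0_qual V F : 1 < #|V| -> qual 0 V F -> 0 < #|F|.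
Proof.
move=> V2 [th [s le]]; rewrite -(ltr0n R); apply: lt_le_trans le.
have [ltth _] := scr_lt r5 s.
have h1 : (2 <= #|V|%:R :> R)%R by rewrite (ler_nat R 2).
have h2 : (#|V|%:R <= th%:R :> R)%R by rewrite ler_nat; apply: leq_trans ltth; apply: leq_addr.
have := c0_gt0 R r5; have := lam_ge1 R r5; rewrite /phi; nra.
Qed.

(** With u common vertices the union has phi(u) edges more than phi requires, and the repeated
    vertices cost c0 each. Since c0 <= 1 <= lambda, u >= 2 is enough to keep the quality. *)
Lemma cand_union V F b : cand V F -> b \in B -> #|V| <= L ->
  [disjoint cF b & F] -> 1 < #|cV b :&: V| ->
  cand (V :|: cV b) (F :|: cF b) /\ #|V :|: cV b| <= L.
Proof.
move=> [FG FV V2 [th [s le]] cF_] bB VL dis u2.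
have [[bG bV bE /andP[b2 bL] [thb [sb leb]]]] := (cfgB.1 b bB, I).
have FG' : F :|: cF b \subset G by rewrite subUset FG.
have FV' : F :|: cF b \subset pairs (V :|: cV b).
  rewrite subUset (subset_trans FV) ?pairsS ?subsetUl //.
  by rewrite (subset_trans bV) ?pairsS ?subsetUr.
have q : qual 0 (V :|: cV b) (F :|: cF b).
  exists (th + thb); split; first by apply: scr_cat s sb _; rewrite disjoint_sym.
  have cU := cardsUI V (cV b); rewrite setIC in cU.
  have cF' := cardsUI F (cF b); rewrite disjoint_setI0 ?cards0 ?addn0 // in cF'; last first.
    by rewrite disjoint_sym.
  have {cU} : (#|V :|: cV b|%:R + #|cV b :&: V|%:R = #|V|%:R + #|cV b|%:R :> R)%R.
    by rewrite -!natrD cU.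
  have {cF'} -> : (#|F :|: cF b|%:R = #|F|%:R + #|cF b|%:R :> R)%R by rewrite -natrD cF'.
  have : (2 <= #|cV b :&: V|%:R :> R)%R by rewrite (ler_nat R 2).
  move: le leb; rewrite /phi natrD.
  move: (#|V|%:R)%R (#|cV b|%:R)%R (#|_ :|: _|%:R)%R (#|_ :&: _|%:R)%R (#|F|%:R)%R (#|cF b|%:R)%R (th%:R)%R (thb%:R)%R.
  move=> v vb w u x xb t tb le leb u2' wE.
  have -> : (w = v + vb - u)%R by lra.
  have c0p := c0_gt0 R r5; have l1 := lam_ge1 R r5; have c1 := c0_le1 R r5.
  have : (0 <= (lam - c0) * (u - 2))%R by rewrite mulr_ge0 ?subr_ge0 // (le_trans c1).
  move: lam c0 {l1} c0p c1 le leb => l c c0p c1 le leb; rewrite !mulrDr !mulrDl !mulrN !mulNr => h.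
  lra.
split; last first.
  apply: (qual_noX (leq0n _) FG' FV' q).
  exact: leq_trans (leq_card_setU _ _) (leq_trans (leq_add VL bL) LM2).
split => //; first by apply: leq_trans V2 _; apply/subset_leq_card/subsetUl.
apply/forall_inP => c cB; have [->|nbc] := eqVneq b c; first by rewrite !subsetUr.
have := forall_inP cF_ c cB; case/orP => [/andP[sV sF]|dF].
  by rewrite !(subset_trans sV, subset_trans sF) ?subsetUl.
apply/orP; right; rewrite disjoint_sym disjoints_subset subUset -!disjoints_subset.
rewrite disjoint_sym dF /=.
by apply: disjoint_pairs (bV) _ (cfgB.2 b c bB cB nbc); have [] := cfgB.1 c cB.
Qed.

(** Take a candidate around g on at most [L] vertices with the most edges. By [cand_union] every
    block meeting it in two vertices is already inside, so trading those blocks for the candidate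
    gives a configuration that covers g as well, against maximality. *)
Lemma no_cand V F g : cand V F -> #|V| <= M -> g \in pairs V -> g \notin fat B -> False.
Proof.
move=> cd VM gV ngB.
pose ok (x : {set T} * {set {set T}}) := `[< [/\ cand x.1 x.2, #|x.1| <= L & g \in pairs x.1] >].
have ok0 : ok (V, F).
  apply/asboolP; split => //=; case: cd => FG FV _ q _; exact: (qual_noX (leq0n _) FG FV q).
have [[{cd VM gV ok0}V {}F] /asboolP /= [cd VL gV] maxF] :=
  @arg_maxnP _ (V, F) ok (fun x => #|x.2|) ok0.
have sep b : b \in B -> ~~ ((cV b \subset V) && (cF b \subset F)) -> #|cV b :&: V| <= 1.
  move=> bB nab; rewrite leqNgt; apply/negP => u2.
  have [_ _ _ _ /forall_inP/(_ b bB)] := cd; rewrite (negbTE nab) /= => dis.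
  have [cd' L'] := cand_union cd bB VL dis u2.
  have le : #|F :|: cF b| <= #|F|.
    apply: (maxF (V :|: cV b, F :|: cF b)).
    by apply/asboolP; split => //; apply: (subsetP (pairsS (subsetUl _ _))).
  have := cardsUI F (cF b); rewrite (disjoint_setI0 (A := F)); last by rewrite disjoint_sym.
  have [_ _ _ /andP[b2 _] qb] := cfgB.1 b bB; have := card_gt0_qual b2 qb.
  rewrite cards0 addn0 => Fb eF; move: le; rewrite eF; lia.
pose n : comp := (V, F, pairs V).
pose B' := n |: [set b in B | #|cV b :&: V| <= 1].
have cB' : config B'.
  split=> [b /setU1P[->|]|b c]; first by case: cd => FG FV V2 q _; rewrite /= VL V2.
    by rewrite inE => /andP[/cfgB.1].
  move=> /setU1P[->|]; rewrite ?inE.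
    case/predU1P => [->|/andP[_ le1]]; first by rewrite eqxx.
    by rewrite setIC.
  move=> /andP[bB le1] /predU1P[->//|/andP[cB _]]; exact: cfgB.2.
have := maxB cB'; rewrite leqNgt => /negP; apply; apply: proper_card.
apply/properP; split; last first.
  by exists g => //; apply/bigcupP; exists n; rewrite // setU11.
apply/bigcupsP => b bB.
have [/andP[sV _]|nab] := boolP ((cV b \subset V) && (cF b \subset F)).
  by apply: (bigcup_max n); rewrite ?setU11 // pairsS.
by apply: (bigcup_max b) => //; apply/setU1P; right; rewrite inE bB sep.
Qed.

End Config.

Lemma card_bigcup_eq (I T : finType) (B : {set I}) (W : I -> {set T}) i j :
  \sum_(k in B) #|W k| <= #|\bigcup_(k in B) W k| ->
  i \in B -> j \in B -> i != j -> [disjoint W i & W j].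
Proof.
move=> le iB jB nij; rewrite -setI_eq0; apply/set0Pn => -[x /setIP[xi xj]].
move: le; rewrite !(big_setD1 i iB) /= cardsU leqNgt => /negP; apply.
have xI : x \in W i :&: \bigcup_(k in B :\ i) W k.
  by rewrite inE xi; apply/bigcupP; exists j; rewrite // in_setD1 eq_sym nij.
have := leq_card_bigcup (B :\ i) W; have : 0 < #|W i :&: \bigcup_(k in B :\ i) W k|.
  by apply/card_gt0P; exists x.
have := subset_leq_card (subsetIl (W i) (\bigcup_(k in B :\ i) W k)).
move: #|_ :&: _| #|\bigcup_(k in _) _| #|W i| (\sum_(k in _) _) => a b c d; lia.
Qed.

(** The defect counts the overlaps of the sets outside [A], so in the case of equality they meet
    only inside [A]. *)
Lemma overlap (I T : finType) (K : {set I}) (V : I -> {set T}) (A : {set T}) :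
  #|A :|: \bigcup_(c in K) V c| + \sum_(c in K) #|V c :&: A| <= #|A| + \sum_(c in K) #|V c| /\
  (#|A| + \sum_(c in K) #|V c| <= #|A :|: \bigcup_(c in K) V c| + \sum_(c in K) #|V c :&: A| ->
   forall c c', c \in K -> c' \in K -> c != c' -> V c :&: V c' \subset A).
Proof.
have eV : A :|: \bigcup_(c in K) V c = A :|: \bigcup_(c in K) (V c :\: A).
  apply/setP => x; rewrite !inE; case: (boolP (x \in A)) => //= nxA.
  by apply/bigcupP/bigcupP => -[c cK xc]; exists c => //; move: xc; rewrite inE ?nxA.
have eS : \sum_(c in K) #|V c| = \sum_(c in K) #|V c :&: A| + \sum_(c in K) #|V c :\: A|.
  by rewrite -big_split /=; apply: eq_bigr => c _; rewrite cardsID.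
have dA : #|A :|: \bigcup_(c in K) (V c :\: A)| = #|A| + #|\bigcup_(c in K) (V c :\: A)|.
  rewrite cardsU (_ : A :&: (\bigcup_(c in K) _) = set0) ?cards0 ?subn0 //.
  apply/setP => x; rewrite !inE; apply/negP => /andP[xA /bigcupP[c _]].
  by rewrite inE xA.
rewrite eV eS dA; have le := leq_card_bigcup K (fun c => V c :\: A).
split; first by rewrite -addnA leq_add2l addnC leq_add2l.
rewrite -addnA leq_add2l [X in _ <= X]addnC leq_add2l => le' c c' cK c'K ncc'.
have := card_bigcup_eq le' cK c'K ncc'; rewrite -setI_eq0 => /eqP/setP dis.
apply/subsetP => x /setIP[xc xc']; have := dis x; rewrite !inE xc xc' !andbT.
by case: (x \in A).
Qed.

(** * Families of components built from the blocks *)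

Section Family.
Variables (T : finType) (r : nat) (R : realFieldType).
Hypothesis r5 : (4 < r)%N.
Implicit Types (V W S U A : {set T}) (e f g h p : {set T}) (E F P Q : {set {set T}}).
Local Notation tr := (@tr T r).
Local Notation closed_E := (@closed_E T r).
Local Notation scr := (@scr T r).
Local Notation lam := (lam R r).
Local Notation kap := (kap R r).
Local Notation c0 := (c0 R r).
Local Notation phi := (phi R r).
Local Notation D := ('C(r, 2) - 1)%N.
Local Notation comp := (comp T).
Local Notation qual := (@qual T r R).
Implicit Types (b c : comp) (B C K : {set comp}).

Variables (G : {set {set T}}) (L M : nat).
Hypothesis LM : L * L * L + (D + 3) * L <= M.
Hypothesis noX : @no_crossing T r R G L M.
Variable B : {set comp}.
Hypothesis cfgB : @config T r R G L B.
Hypothesis maxB : forall B', @config T r R G L B' -> #|fat B'| <= #|fat B|.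
Local Notation goodp := (@goodp T r G (fat B)).

(** The state while the trees of one clique are being attached: [tau c] counts those merged into
    [c]. Components share at most one vertex, so a pair has at most one home, and every block
    survives inside some component. *)
Record fam C (tau : comp -> nat) (t : nat) : Prop := Fam {
  fam_FG : forall c, c \in C -> cF c \subset G;
  fam_FE : forall c, c \in C -> cF c \subset cE c;
  fam_EV : forall c, c \in C -> cE c \subset pairs (cV c);
  fam_cl : forall c, c \in C -> closed_E (cE c);
  fam_card : forall c, c \in C -> 1 < #|cV c| <= L;
  fam_q : forall c, c \in C -> qual (tau c) (cV c) (cF c);
  fam_good : forall c, c \in C -> forall g, g \in cE c -> goodp g (cV c);
  fam_pw : forall c c', c \in C -> c' \in C -> c != c' -> #|cV c :&: cV c'| <= 1;
  fam_B : forall b, b \in B -> exists2 c, c \in C &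
    [/\ cV b \subset cV c, cF b \subset cF c & pairs (cV b) \subset cE c];
  fam_t : \sum_(c in C) tau c <= t }.

Lemma fam_start : fam B (fun=> 0) 0.
Proof.
split.
- by move=> c /cfgB.1[].
- by move=> c /cfgB.1[_ FV ->].
- by move=> c /cfgB.1[_ _ ->].
- by move=> c /cfgB.1[_ _ -> _ _]; apply: closed_pairs.
- by move=> c /cfgB.1[].
- by move=> c /cfgB.1[].
- move=> c cB g; have [_ _ -> _ _] := cfgB.1 c cB => gV.
  exists g, set0, [set g]; split; [exact: TrP (pairs_card gV)|exact: pairs_sub|exact: sub0set|].
  by rewrite sub1set; apply/bigcupP; exists c.
- exact: cfgB.2.
- by move=> b bB; exists b => //; have [_ _ -> _ _] := cfgB.1 b bB.
- by rewrite big1.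
Qed.

Section Union.
Variables (C : {set comp}) (tau : comp -> nat) (t : nat).
Hypotheses (famC : fam C tau t) (tD : t <= D).

Lemma fam_uniq c c' p : c \in C -> c' \in C -> p \subset cV c -> p \subset cV c' ->
  #|p| = 2 -> c = c'.
Proof.
move=> cC c'C pc pc' p2; apply/eqP; apply/negP => /negP ncc'.
have := fam_pw famC cC c'C ncc'; rewrite leqNgt -p2 => /negP; apply.
by apply: subset_leq_card; rewrite subsetI pc.
Qed.

Lemma fam_disjF c c' : c \in C -> c' \in C -> c != c' -> [disjoint cF c & cF c'].
Proof.
move=> cC c'C ncc'; apply: disjoint_pairs (fam_pw famC cC c'C ncc').
  exact: subset_trans (fam_FE famC cC) (fam_EV famC cC).
exact: subset_trans (fam_FE famC c'C) (fam_EV famC c'C).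
Qed.

(** A fat pair inside [c] belongs to a block, and the component of that block must be [c] itself
    because components share at most one vertex. *)
Lemma nonfat g c : c \in C -> g \subset cV c -> #|g| = 2 -> g \notin cE c -> g \notin fat B.
Proof.
move=> cC gV g2; apply: contra => /bigcupP[b bB gb].
have [c' c'C [Vb _ Eb]] := fam_B famC bB.
have <- : c' = c by apply: (fam_uniq c'C cC _ gV g2); apply: subset_trans (pairs_sub gb) Vb.
exact: (subsetP Eb).
Qed.

Lemma nonfat' g : (forall c, c \in C -> ~~ (g \subset cV c)) -> g \notin fat B.
Proof.
move=> h; apply/negP => /bigcupP[b bB gb]; have [c cC [Vb _ _]] := fam_B famC bB.
by have := h c cC; rewrite (subset_trans (pairs_sub gb) Vb).
Qed.

Section UnionK.
Variables (K : {set comp}) (VT : {set T}) (FT : {set {set T}}) (thT : nat).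
Hypotheses (KC : K \subset C) (sT : scr thT VT FT) (FTG : FT \subset G)
  (FTV : FT \subset pairs VT)
  (FTE : forall p c, p \in FT -> c \in C -> p \notin cE c).
Let V := VT :|: \bigcup_(c in K) cV c.
Let F := FT :|: \bigcup_(c in K) cF c.

Lemma union_FV : F \subset pairs V.
Proof.
rewrite subUset (subset_trans FTV) ?pairsS ?subsetUl //=; apply/bigcupsP => c cK.
have cC := subsetP KC c cK.
apply: subset_trans (fam_FE famC cC) _; apply: subset_trans (fam_EV famC cC) _.
by apply: pairsS; apply: subset_trans (subsetUr _ _); apply: bigcup_sup.
Qed.

Lemma union_FG : F \subset G.
Proof. by rewrite subUset FTG; apply/bigcupsP => c /(subsetP KC)/(fam_FG famC). Qed.

Lemma union_disjT : [disjoint FT & \bigcup_(c in K) cF c].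
Proof.
apply/bigcup_disjointP => c cK; have cC := subsetP KC c cK.
rewrite disjoint_subset; apply/subsetP => p /FTE/(_ cC); rewrite inE.
by apply: contra; apply: (subsetP (fam_FE famC cC)).
Qed.

Lemma union_cardF : #|F| = #|FT| + \sum_(c in K) #|cF c|.
Proof.
rewrite cardsU disjoint_setI0 ?union_disjT // cards0 subn0 card_bigcup_disj //.
by move=> c c' cK c'K; apply: fam_disjF; apply: (subsetP KC).
Qed.

Lemma union_compat : compat B V F.
Proof.
apply/forall_inP => b bB; have [c cC [Vb Fb Eb]] := fam_B famC bB.
have [cK|ncK] := boolP (c \in K); apply/orP; [left|right].
  rewrite (subset_trans Vb) ?(subset_trans Fb) //; apply: subset_trans (subsetUr _ _);
  exact: (bigcup_sup c).
have [_ bV _ _ _] := cfgB.1 b bB.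
rewrite disjoint_sym disjoints_subset subUset -!disjoints_subset; apply/andP; split.
  rewrite disjoint_subset; apply/subsetP => p /FTE/(_ cC); rewrite inE; apply: contra => pb.
  exact: (subsetP Eb) (subsetP bV p pb).
rewrite disjoint_sym; apply/bigcup_disjointP => c' c'K; have c'C := subsetP KC c' c'K.
rewrite disjoint_sym; apply: disjointWr Fb (fam_disjF c'C cC _).
by apply: contraNneq ncK => <-.
Qed.

Lemma union_scr : exists th, [/\ scr (thT + th) V F, \sum_(c in K) #|cV c| <= th &
  (lam * ((\sum_(c in K) #|cV c|)%:R - 2 * #|K|%:R) + #|K|%:R +
   c0 * (th%:R - (\sum_(c in K) #|cV c|)%:R + 3 * #|K|%:R - 4 * (\sum_(c in K) tau c)%:R)
   <= (\sum_(c in K) #|cF c|)%:R)%R].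
Proof.
have [th hth] := choice_on 0 (fun c (cK : c \in K) => fam_q famC (subsetP KC c cK)).
exists (\sum_(c in K) th c); split.
  apply: scr_cat => //; last exact: union_disjT.
  apply: scr_big => [c /hth[]//|c c' cK c'K].
  by apply: fam_disjF; apply: (subsetP KC).
  apply: leq_sum => c /hth[/(scr_lt r5)[le _] _]; exact: leq_trans (leq_addr _ _) le.
rewrite !natr_sum; apply: le_trans (_ : \sum_(c in K)
   (phi #|cV c| + c0 * ((th c)%:R - #|cV c|%:R + 3 - 4 * (tau c)%:R)) <= _)%R; last first.
  by apply: ler_sum => c /hth[].
have [k0 k0E] : exists k0, (k0 = 1 - 2 * lam + 3 * c0)%R by exists (1 - 2 * lam + 3 * c0)%R.
have [k1 k1E] : exists k1, (k1 = lam - c0)%R by exists (lam - c0)%R.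
rewrite [leRHS](eq_bigr (fun c => k1 * #|cV c|%:R + c0 * (th c)%:R
   - 4 * c0 * (tau c)%:R + k0)%R); last first.
  by move=> c _; rewrite /phi k0E k1E; ring.
rewrite !big_split /= sumrN -!mulr_sumr (sumr_const _ k0) -[(k0 *+ _)%R]mulr_natl k0E k1E.
rewrite le_eqVlt; apply/orP; left; apply/eqP; ring.
Qed.

(** Otherwise the union of the script with the components in [K] would be a candidate around a pair
    that no block covers, against [no_cand]. *)
Lemma fam_union g : #|V| <= M -> g \in pairs V -> g \notin fat B ->
  (#|FT|%:R + lam * ((\sum_(c in K) #|cV c|)%:R - 2 * #|K|%:R - #|V|%:R + 2) + #|K|%:R - 1
   < c0 * (thT%:R + (\sum_(c in K) #|cV c|)%:R - 3 * #|K|%:R + 4 * t%:R - #|V|%:R + 3))%R.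
Proof.
move=> VM gV ngB; rewrite ltNge; apply/negP => le.
have V2 : 1 < #|V| by rewrite -(pairs_card gV) subset_leq_card // pairs_sub.
apply: (@no_cand T r R r5 G L M LM noX B cfgB maxB V F g) => //.
split; [exact: union_FG|exact: union_FV|exact: V2| |exact: union_compat].
have [th [s _ leF]] := union_scr; exists (thT + th); split => //.
rewrite union_cardF /phi !natrD.
have tt : (c0 * (\sum_(c in K) tau c)%:R <= c0 * t%:R)%R.
  rewrite ler_wpM2l ?(ltW (c0_gt0 R r5)) // ler_nat; apply: leq_trans (fam_t famC).
  rewrite [X in _ <= X](big_setID K) /= (setIidPr KC); exact: leq_addr.
move: le leF tt.
move: lam c0 (#|FT|%:R)%R (#|V|%:R)%R (#|K|%:R)%R (th%:R)%R (thT%:R)%R (t%:R)%R ((\sum_(c in K) #|cV c|)%:R)%R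
  ((\sum_(c in K) #|cF c|)%:R)%R ((\sum_(c in K) tau c)%:R)%R.
move=> l c ft w m th' tht t' v fk tk le leF tt.
lra.
Qed.

End UnionK.

(** [q] stands for the free leaves minus the components. The gain lambda x - q is at least kap x +
    s, while the price is c0 times an expression linear in x; by [c0_small] the price cannot exceed
    the gain once x or s reaches 1. *)
Lemma num_step (x q s t' : R) : (0 <= x)%R -> (t' <= D%:R)%R -> (0 <= t')%R ->
  (q <= r%:R / 2 * x - s)%R -> (s = 0 /\ 1 <= x \/ 1 <= s)%R ->
  (lam * x - q < c0 * (x + q + 4 + 4 * t'))%R -> False.
Proof.
move=> x0 t'D t'0 qx sx.
have c0p := c0_gt0 R r5; have kp := kap_gt0 R r5; have k2 := kap_le R r5.
have r_5 := r_ge5 R r5; have lk := lam_kap R r.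
have cs : (c0 * (4 * t' + r%:R + 10) <= kap)%R.
  apply: le_trans (c0_small R r5 (leqnn D)); rewrite ler_wpM2l ?(ltW c0p) //; lra.
rewrite lk; move: kap c0 c0p kp k2 cs => k c c0p kp k2 cs lt.
have h1 : (c * (x + q + 4 + 4 * t') <= c * ((1 + r%:R / 2) * x - s + 4 + 4 * t'))%R.
  by rewrite ler_wpM2l ?(ltW c0p) //; lra.
have h2 : (k * x + s <= (r%:R / 2 + k) * x - q)%R by lra.
have {lt h1 h2} : (k * x + s < c * ((1 + r%:R / 2) * x - s + 4 + 4 * t'))%R.
  by apply: le_lt_trans h2 (lt_le_trans lt h1).
have csx : (c * (4 * t' + r%:R + 10) * x <= k * x)%R by rewrite ler_wpM2r.
have a1 : (0 <= c * t' * x)%R by rewrite !mulr_ge0 // ltW.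
have a2 : (0 <= c * r%:R * x)%R by rewrite !mulr_ge0 // ltW.
have a3 : (0 <= c * x)%R by rewrite !mulr_ge0 // ltW.
have a4 : (0 <= c * t')%R by rewrite !mulr_ge0 // ltW.
have a5 : (0 <= c * r%:R)%R by rewrite !mulr_ge0 // ltW.
case: sx => [[-> x1]|s1].
  have b1 : (0 <= c * t' * (x - 1))%R by rewrite !mulr_ge0 ?subr_ge0 // ltW.
  have b2 : (0 <= c * (x - 1))%R by rewrite !mulr_ge0 ?subr_ge0 // ltW.
  lra.
have b1 : (0 <= c * (s - 1))%R by rewrite !mulr_ge0 ?subr_ge0 // ltW.
lra.
Qed.

(** The reason for M of order L^3: a tree on at most L vertices has at most L^2 free leaves, each
    inside a component of size at most L. The summand 2 leaves room for components added to the
    touched ones. *)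
Lemma card_union_le K V : K \subset C -> #|V| <= L -> #|K| <= L * L + 2 ->
  #|V :|: \bigcup_(c in K) cV c| <= M.
Proof.
move=> KC VL KL; apply: leq_trans (leq_card_setU _ _) _; apply: leq_trans LM.
apply: (@leq_trans (L + #|K| * L)).
  apply: leq_add => //; apply: leq_trans (leq_card_bigcup _ _) _.
  by rewrite -sum_nat_const; apply: leq_sum => c /(subsetP KC)/(fam_card famC)/andP[].
apply: (@leq_trans (L + (L * L + 2) * L)); first by rewrite leq_add2l leq_mul2r KL orbT.
clear; nia.
Qed.

Lemma tr_countR f V F P : tr f V F P -> (#|F|%:R = phi #|V| - #|P|%:R :> R)%R.
Proof.
move=> tf; have [_ cnt] := tr_count r5 tf.
have := congr1 (fun k => k%:R : R)%R cnt; rewrite /= !natrD !natrM natrD -(lamE R r5) /phi.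
have r2 := r2_gt0 R r5 => h.
have h2 : (((r - 2)%N%:R) * (#|F|%:R + #|P|%:R) = ((r - 2)%N%:R) * (lam * (#|V|%:R - 2) + 1) :> R)%R.
  by move: h; move: ((r - 2)%N%:R)%R => r2'; lra.
by move/(mulfI (lt0r_neq0 r2)): h2 => h2; lra.
Qed.

(* x is the overlap in excess of two vertices per component. *)
Lemma tree_step K f V F P g (x s : nat) :
  K \subset C -> tr f V F P -> #|V| <= L -> F \subset G ->
  (forall p c, p \in F -> c \in C -> p \notin cE c) -> #|K| <= L * L + 2 ->
  let W := V :|: \bigcup_(c in K) cV c in
  g \in pairs W -> g \notin fat B ->
  #|V| + \sum_(c in K) #|cV c| = #|W| + 2 * #|K| + x ->
  2 * #|P| + 2 * s <= r * x + 2 * #|K| -> s = 0 /\ x = 0.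
Proof.
move=> KC tf VL FG FE KL W gW ngB xE le.
have WM : #|W| <= M := card_union_le KC VL KL.
have := fam_union KC (scr_tr tf) FG (tr_leaves tf).1 FE WM gW ngB.
rewrite -/W; have fE := tr_countR tf.
rewrite fE /phi !natrD.
have xR : (#|V|%:R + (\sum_(c in K) #|cV c|)%:R = #|W|%:R + 2 * #|K|%:R + x%:R :> R)%R.
  by rewrite -natrM -!natrD xE.
have leR : (#|P|%:R - #|K|%:R <= r%:R / 2 * x%:R - s%:R :> R)%R.
  by have := le; rewrite -(ler_nat R) !natrD !natrM; lra.
have tR : (t%:R <= D%:R :> R)%R by rewrite ler_nat.
move=> lt.
have [s0|s0] := posnP s; last first.
  case: (@num_step x%:R (#|P|%:R - #|K|%:R) s%:R t%:R)%R; rewrite ?ler0n //; first by right; rewrite ler1n.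
  move: lt xR; move: lam c0 (#|V|%:R)%R (#|K|%:R)%R (#|P|%:R)%R (x%:R)%R (t%:R)%R (#|W|%:R)%R ((\sum_(c in K) #|cV c|)%:R)%R.
  move=> l c v m p x' t' w vk lt xR.
  have -> : x' = (v + vk - w - 2 * m)%R by lra.
  lra.
have [x0|x0] := posnP x; first by [].
case: (@num_step x%:R (#|P|%:R - #|K|%:R) s%:R t%:R)%R; rewrite ?ler0n //; first by left; rewrite s0 ler1n.
move: lt xR; move: lam c0 (#|V|%:R)%R (#|K|%:R)%R (#|P|%:R)%R (x%:R)%R (t%:R)%R (#|W|%:R)%R ((\sum_(c in K) #|cV c|)%:R)%R.
move=> l c v m p x' t' w vk lt xR.
have -> : x' = (v + vk - w - 2 * m)%R by lra.
lra.
Qed.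

End Union.
End Family.

(** * Trees against a family *)

Section Attach.
Variables (T : finType) (r : nat) (R : realFieldType).
Hypothesis r5 : (4 < r)%N.
Implicit Types (V W S U A : {set T}) (e f g h p : {set T}) (E F P Q : {set {set T}}).
Local Notation tr := (@tr T r).
Local Notation closed_E := (@closed_E T r).
Local Notation scr := (@scr T r).
Local Notation lam := (lam R r).
Local Notation kap := (kap R r).
Local Notation c0 := (c0 R r).
Local Notation phi := (phi R r).
Local Notation D := ('C(r, 2) - 1)%N.
Local Notation comp := (comp T).
Local Notation qual := (@qual T r R).
Implicit Types (b c : comp) (B C K : {set comp}).

Variables (G : {set {set T}}) (L M : nat).
Hypothesis LM : L * L * L + (D + 3) * L <= M.
Hypothesis noX : @no_crossing T r R G L M.
Variable B : {set comp}.
Hypothesis cfgB : @config T r R G L B.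
Hypothesis maxB : forall B', @config T r R G L B' -> #|fat B'| <= #|fat B|.
Local Notation goodp := (@goodp T r G (fat B)).
Local Notation fam := (@fam T r R G L B).

Section OneFamily.
Variables (C : {set comp}) (tau : comp -> nat) (t : nat).
Hypotheses (famC : fam C tau t) (tD : t <= D).

Definition hulls : {set {set T}} := (@cV T) @: C.

Definition touched P : {set comp} := [set c in C | [exists p in P, p \subset cV c]].

Lemma in_hulls p : reflect (exists2 c, c \in C & p \subset cV c) (in_some hulls p).
Proof.
apply: (iffP existsP) => [[U /andP[/imsetP[c cC ->] pU]]|[c cC pc]]; first by exists c.
by exists (cV c); rewrite pc andbT imset_f.
Qed.

Lemma touchedC P : touched P \subset C.
Proof. by apply/subsetP => c; rewrite inE => /andP[]. Qed.

Lemma fat_hulls p : p \in fat B -> in_some hulls p.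
Proof.
move=> /bigcupP[b bB pb]; have [c cC [Vb _ _]] := fam_B famC bB.
by apply/in_hulls; exists c => //; apply: subset_trans (pairs_sub pb) Vb.
Qed.

Lemma touched_card P V K : P \subset pairs V -> (forall p, p \in P -> in_some hulls p) ->
  touched P \subset K -> K \subset C ->
  #|P| = \sum_(c in K) #|ins P (cV c)|.
Proof.
move=> PV Pin tK KC.
rewrite -(@card_bigcup_disj _ _ K (fun c => ins P (cV c))).
  apply: eq_card => p; apply/idP/bigcupP => [pP|[c _]]; last by rewrite inE => /andP[].
  have [c cC pc] := in_hulls _ (Pin p pP); exists c; last by rewrite inE pP.
  by apply: (subsetP tK); rewrite inE cC; apply/existsP; exists p; rewrite pP.
move=> c c' cK c'K ncc'; rewrite -setI_eq0; apply/eqP/setP => p; rewrite !inE.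
apply/negP => /andP[/andP[pP pc] /andP[_ pc']].
case/eqP: ncc'; apply: (fam_uniq famC (subsetP KC c cK) (subsetP KC c' c'K) pc pc').
exact: pairs_card (subsetP PV p pP).
Qed.

Lemma touched_pos P c : c \in touched P -> 0 < #|ins P (cV c)|.
Proof.
rewrite inE => /andP[_ /existsP[p /andP[pP pc]]]; apply/card_gt0P; exists p.
by rewrite inE pP.
Qed.

Lemma card_touched P V : P \subset pairs V -> (forall p, p \in P -> in_some hulls p) ->
  #|touched P| <= #|P|.
Proof.
move=> PV Pin; rewrite (touched_card PV Pin (subxx _) (touchedC P)) -sum1_card.
by apply: leq_sum => c; apply: touched_pos.
Qed.

Lemma card_pairs_le P V : P \subset pairs V -> #|V| <= L -> #|P| <= L * L.
Proof.
move=> PV VL; apply: leq_trans (subset_leq_card PV) _; rewrite card_pairs. 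
move: #|V| VL => v vL; have := twice_bin2 v; move: (binomial v 2) => b; clear -vL; nia.
Qed.

(** Components may also meet each other outside the tree, so the true overlap x can exceed the sum
    of |V ∩ cV c| - 2; this only strengthens the right-hand side of the bound on free leaves. *)
Lemma excess V P K s : P \subset pairs V ->
  (forall p, p \in P -> in_some hulls p) -> touched P \subset K -> K \subset C ->
  (forall c, c \in K -> 2 <= #|V :&: cV c|) ->
  2 * \sum_(c in K) #|ins P (cV c)| + 2 * s <= r * \sum_(c in K) (#|V :&: cV c| - 2) + 2 * #|K| ->
  exists x, #|V| + \sum_(c in K) #|cV c| = #|V :|: \bigcup_(c in K) cV c| + 2 * #|K| + x /\
    2 * #|P| + 2 * s <= r * x + 2 * #|K| /\ \sum_(c in K) (#|V :&: cV c| - 2) <= x.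
Proof.
move=> PV Pin tK KC u2 le; have [ov _] := overlap K (@cV T) V.
have uE : \sum_(c in K) #|cV c :&: V| = \sum_(c in K) (#|V :&: cV c| - 2) + 2 * #|K|.
  rewrite mulnC -sum_nat_const -big_split /=; apply: eq_bigr => c cK.
  by rewrite subnK ?u2 // setIC.
rewrite uE in ov.
exists (#|V| + \sum_(c in K) #|cV c| - (#|V :|: \bigcup_(c in K) cV c| + 2 * #|K|)).
rewrite (touched_card PV Pin tK KC).
move: le ov; move: (\sum_(c in K) (#|V :&: cV c| - 2)) (\sum_(c in K) #|cV c|) (\sum_(c in K) #|ins _ _|) #|_ :|: _| #|V| #|K|.
clear -r5 => a b c d e k le ov; split; first lia.
have ax : a <= e + b - (d + 2 * k) by lia.
by split => //; apply: leq_trans le _; rewrite leq_add2r leq_mul2l ax orbT.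
Qed.

Lemma bound_pos R0 u : bound 2 r R0 u -> 0 < R0 -> 2 <= u /\ 2 * R0 <= r * (u - 2) + 2.
Proof.
rewrite /bound; case: ltnP => [_|u2 le _]; last by split.
by rewrite leqn0 muln_eq0 => /eqP ->.
Qed.

(** Suppose the root is missing from [cE c]. If the tree is a single edge, it is an additional edge
    inside c. If it is a node whose clique lies in c, closedness applies. For any other clique the
    pruned node has one free leaf less than allowed, because the root lies in the hull of c. The
    first and last cases contradict [tree_step] with s = 1. *)
Lemma fat_in g V F P : tr g V F P -> #|V| <= L -> F \subset G -> P \subset fat B ->
  forall c, c \in C -> g \subset cV c -> g \in cE c.
Proof.
elim=> {g V F P} [f f2|f f2|f S V F P S_r fS tg IH VS VV] VL FG PX c cC fc;
  apply: contraT => nE; exfalso.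
- have ngB := nonfat famC cC fc f2 nE.
  pose K : {set comp} := [set c].
  have fV : f \in pairs (f :|: \bigcup_(c in K) cV c) by apply: pairsP => //; apply: subsetUl.
  have [] // := @tree_step T r R r5 G L M LM noX B cfgB maxB C tau t famC tD K f f [set f] set0
    f 0 1 _ (TrG r f2) VL FG _ _ fV ngB.
  + by rewrite /K sub1set.
  + move=> p c'; rewrite inE => /eqP -> c'C; apply/negP => fE'.
    have fc' := pairs_sub (subsetP (fam_EV famC c'C) f fE').
    by move: nE; rewrite (fam_uniq famC cC c'C fc fc' f2) fE'.
  + by rewrite /K cards1; clear; lia.
  + by rewrite /K !big_set1 cards1 (setUidPr fc) f2 addn0 muln1 addnC.
  + by rewrite /K cards0 cards1 !muln0.
- have := nonfat famC cC fc f2 nE.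
  by rewrite (subsetP PX) ?set11.
have f2 := pairs_card fS.
have sub g : g \in pairs S :\ f -> [/\ #|V g| <= L, F g \subset G & P g \subset fat B].
  move=> gS; split; last 2 first.
  - by apply: subset_trans FG; apply: bigcup_sup gS.
  - by apply: subset_trans PX; apply: bigcup_sup gS.
  by apply: leq_trans VL; apply/subset_leq_card/(bigcup_sup g gS).
have [Sc|nSc] := boolP (S \subset cV c).
  case/negP: nE; apply: (fam_cl famC cC S_r fS); apply/subsetP => g gS.
  have [VgL FgG PgX] := sub g gS; apply: IH => //.
  by apply: subset_trans Sc; case/setD1P: gS => _ /pairs_sub.
have child g : g \in pairs S :\ f -> prunable r hulls g (V g) (F g) (P g).
  move=> gS; have [_ _ PgX] := sub g gS; apply: prunable_any (tg g gS) _ => //.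
  by move=> p /(subsetP PgX)/fat_hulls.
have [V' [F' [P' [[t' V'V F'F P'in F'out] bd]]]] := prune_node r5 S_r fS VS VV child.
have PV := (tr_leaves t').2; have Pin p (pP : p \in P') := (P'in p pP).1.
have V'L : #|V'| <= L by apply: leq_trans (subset_leq_card V'V) VL.
pose K := c |: touched P'.
have KC : K \subset C by rewrite subUset sub1set cC touchedC.
have tK : touched P' \subset K by apply: subsetUr.
have cK : c \in K by rewrite setU11.
have fV' := tr_sub r5 t'.
have bdc : 2 * #|ins P' (cV c)| <= r * (#|V' :&: cV c| - 2).
  by have [_] := bd (cV c) (imset_f _ cC) nSc; apply.
have uc : 2 <= #|V' :&: cV c|.
  by rewrite -f2 subset_leq_card // subsetI fV'.
have bdK c' : c' \in K -> c' != c -> 2 <= #|V' :&: cV c'| /\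
    2 * #|ins P' (cV c')| <= r * (#|V' :&: cV c'| - 2) + 2.
  move=> c'K ncc'; have c'C := subsetP KC c' c'K.
  have nfc' : ~~ (f \subset cV c').
    apply/negP => fc'; case/eqP: ncc'; exact: (fam_uniq famC c'C cC fc' fc f2).
  have nSc' : ~~ (S \subset cV c').
    by apply: contra nfc'; apply: subset_trans (pairs_sub fS).
  have [/(_ nfc') bd' _] := bd (cV c') (imset_f _ c'C) nSc'.
  apply: bound_pos bd' _; apply: touched_pos.
  by case/setU1P: c'K => // cc; rewrite cc eqxx in ncc'.
have [||x [xE [le _]]] := @excess V' P' K 1 PV Pin tK KC.
- by move=> c' c'K; have [->//|/(bdK c' c'K)[]] := eqVneq c' c.
- rewrite !(big_setD1 c cK) /= (cardsD1 c K) cK.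
  have : 2 * \sum_(c' in K :\ c) #|ins P' (cV c')| <=
     r * \sum_(c' in K :\ c) (#|V' :&: cV c'| - 2) + 2 * #|K :\ c|.
    rewrite !big_distrr /= mulnC -sum_nat_const -big_split /=; apply: leq_sum => c' /setD1P[nc c'K].
    by have [_] := bdK c' c'K nc.
  move: bdc; move: (\sum_(i in _) #|_|) (\sum_(i in _) (_ - _)) #|K :\ c| #|ins _ _| #|_ :&: _|.
  clear => a b k d u; nia.
have [|||||] // := @tree_step T r R r5 G L M LM noX B cfgB maxB C tau t famC tD K f V' F' P' f x 1
  KC t' V'L _ _ _ _ _ xE le.
- exact: subset_trans F'F FG.
- move=> p c' pF c'C; apply/negP => pE; case/negP: (F'out p pF); apply/in_hulls; exists c' => //.
  exact: pairs_sub (subsetP (fam_EV famC c'C) p pE).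
- apply: leq_trans (_ : (#|touched P'|).+1 <= _); first by rewrite cardsU1; case: (c \notin _); rewrite ?add1n ?add0n.
  have := card_touched PV Pin; have := card_pairs_le PV V'L; clear; lia.
- by apply: pairsP => //; apply: subset_trans fV' (subsetUl _ _).
- by have := nonfat famC cC fc f2 nE.
Qed.

End OneFamily.
End Attach.

(** * Attaching a tree to a family *)

Section Grow.
Variables (T : finType) (r : nat) (R : realFieldType).
Hypothesis r5 : (4 < r)%N.
Implicit Types (V W S U A : {set T}) (e f g h p : {set T}) (E F P Q : {set {set T}}).
Local Notation tr := (@tr T r).
Local Notation closed_E := (@closed_E T r).
Local Notation scr := (@scr T r).
Local Notation lam := (lam R r).
Local Notation kap := (kap R r).
Local Notation c0 := (c0 R r).
Local Notation phi := (phi R r).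
Local Notation D := ('C(r, 2) - 1)%N.
Local Notation comp := (comp T).
Local Notation qual := (@qual T r R).
Implicit Types (b c : comp) (B C K : {set comp}).

Variables (G : {set {set T}}) (L M : nat).
Hypothesis LM : L * L * L + (D + 3) * L <= M.
Hypothesis noX : @no_crossing T r R G L M.
Variable B : {set comp}.
Hypothesis cfgB : @config T r R G L B.
Hypothesis maxB : forall B', @config T r R G L B' -> #|fat B'| <= #|fat B|.
Local Notation goodp := (@goodp T r G (fat B)).
Local Notation fam := (@fam T r R G L B).

Section OneFamily.
Variables (C : {set comp}) (tau : comp -> nat) (t : nat).
Hypotheses (famC : fam C tau t) (tD : t <= D).
Local Notation touched := (touched C).
Local Notation hull K V := (V :|: \bigcup_(c in K) cV c).

(** The equality case of [tree_step]. The conditions on touched components are those of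
    [closed_star], and the last clause lets the hull replace the touched components in the
    family. *)
Definition attached f V F P (K := touched P) : Prop :=
  [/\ tr f V F P, #|V| <= L, F \subset G &
   [/\ forall p c, p \in F -> c \in C -> ~~ (p \subset cV c),
     #|P| = #|K|,
     forall c, c \in K -> (cV c :&: V \in P) /\ (cV c :&: V \in cE c),
     forall c c', c \in K -> c' \in K -> c != c' -> cV c :&: cV c' \subset V &
     #|V| + \sum_(c in K) #|cV c| = #|hull K V| + 2 * #|K| /\
     forall c, c \in C -> c \notin K -> #|hull K V :&: cV c| <= 1]].

(** Pruning at the hulls bounds the free leaves with density r/2, and [tree_step] with s = 0 then
    leaves no overlap beyond one pair per touched component. *)
Lemma attach f V0 F0 P0 : tr f V0 F0 P0 -> #|V0| <= L -> F0 \subset G -> P0 \subset fat B ->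
  (forall c, c \in C -> ~~ (f \subset cV c)) -> exists V F P, attached f V F P.
Proof.
move=> tf V0L F0G P0X nf.
have nfU : ~~ in_some (hulls C) f.
  by apply/negP => /in_hulls[c cC]; apply/negP/nf.
have P0in p : p \in P0 -> in_some (hulls C) p.
  by move=> /(subsetP P0X); apply: (fat_hulls famC).
have [V [F [P [[t' VV FF Pin' Fout] bd]]]] := prune r5 tf P0in nfU.
have PV := (tr_leaves t').2; have FV := (tr_leaves t').1.
have Pin p (pP : p \in P) := (Pin' p pP).1.
have VL : #|V| <= L by apply: leq_trans (subset_leq_card VV) V0L.
have FG : F \subset G by apply: subset_trans FF F0G.
pose K := touched P; have KC : K \subset C := touchedC C P.
have f2 := tr_card2 r5 t'; have fV := tr_sub r5 t'.
have ngB : f \notin fat B := nonfat' famC nf.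
have FE p c : p \in F -> c \in C -> p \notin cE c.
  move=> pF cC; apply/negP => pE; case/negP: (Fout p pF); apply/in_hulls; exists c => //.
  exact: pairs_sub (subsetP (fam_EV famC cC) p pE).
have bdK c : c \in K -> 2 <= #|V :&: cV c| /\
    2 * #|ins P (cV c)| <= r * (#|V :&: cV c| - 2) + 2.
  move=> cK; apply: bound_pos; last exact: touched_pos cK.
  by apply: bd; apply: imset_f; apply: (subsetP KC).
have KP : #|K| <= #|P| := card_touched famC PV Pin.
have KL : #|K| <= L * L by apply: leq_trans KP (card_pairs_le PV VL).
have [||x [xE [le ux]]] := @excess T r R r5 G L B C tau t famC V P K 0 PV Pin (subxx _) KC.
- by move=> c /bdK[].
- rewrite muln0 addn0 !big_distrr /= mulnC -sum_nat_const -big_split /=.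
  by apply: leq_sum => c /bdK[].
have fW K' : f \in pairs (hull K' V).
  by apply: pairsP => //; apply: subset_trans fV (subsetUl _ _).
have [|_ x0] := @tree_step T r R r5 G L M LM noX B cfgB maxB C tau t famC tD K f V F P f x 0
  KC t' VL FG FE _ (fW K) ngB xE le.
  by apply: leq_trans KL (leq_addr _ _).
rewrite {x}x0 ?muln0 ?addn0 ?add0n in xE le ux.
have PK : #|P| = #|K| by apply/eqP; rewrite eqn_leq KP andbT -(leq_pmul2l (m := 2)).
have u2 c : c \in K -> #|cV c :&: V| = 2.
  move=> cK; have [u _] := bdK c cK; apply/eqP; rewrite setIC eqn_leq u andbT -subn_eq0.
  by move: ux; rewrite leqn0 sum_nat_eq0 => /forall_inP/(_ c cK).
have pE c : c \in K -> cV c :&: V \in P.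
  move=> cK; have := cK; rewrite inE => /andP[cC /existsP[p /andP[pP pc]]].
  suff <- : p = cV c :&: V by [].
  have pp := subsetP PV p pP; apply: pair_eq (pairs_card pp) (u2 c cK) _.
  by rewrite subsetI pc (pairs_sub pp).
exists V, F, P; split => //; split => //.
- by move=> p c pF cC; apply: contra (Fout p pF) => pc; apply/in_hulls; exists c.
- move=> c cK; split; first exact: pE.
  have cC := subsetP KC c cK.
  (* The subtree cut off at this pair shows, by [fat_in], that the pair belongs to [cE c]. *)
  have [_ [V1 [F1 [P1 [t1 V1s F1s P1s]]]]] := Pin' _ (pE c cK).
  apply: (fat_in r5 LM noX cfgB maxB famC tD t1) => //; last exact: subsetIl.
  + exact: leq_trans (subset_leq_card V1s) V0L.
  + exact: subset_trans F1s F0G.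
  + exact: subset_trans P1s P0X.
- have [_ dis] := overlap K (@cV T) V; apply: dis.
  rewrite xE leq_add2l mulnC -sum_nat_const; apply: leq_sum => c cK; by rewrite u2.
split => // c cC ncK; rewrite leqNgt; apply/negP => u.
(* A further component with two common vertices brings no free leaf, so |P| = |K'| - 1 gives s = 1,
   which [tree_step] forbids. *)
pose K' := c |: K.
have K'E : \sum_(c' in K') #|cV c'| = #|cV c| + \sum_(c' in K) #|cV c'|.
  by rewrite /K' big_setU1.
have W'E : hull K' V = hull K V :|: cV c.
  by rewrite /K' big_setU1 //= setUCA setUC.
have cK' : #|K'| = #|K|.+1 by rewrite cardsU1 ncK.
have [] // := @tree_step T r R r5 G L M LM noX B cfgB maxB C tau t famC tD K' f V F P f
   (#|hull K V :&: cV c| - 2) 1 _ t' VL FG FE _ (fW K') ngB.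
- by rewrite subUset sub1set cC.
- by rewrite cK'; move: KL; clear; lia.
- rewrite K'E W'E cK' addnCA xE.
  have := cardsUI (hull K V) (cV c); move: u.
  move: #|_ :|: cV c| #|_ :&: cV c| #|hull K V| #|cV c| #|K|; clear; lia.
- by rewrite cK' PK muln1 mulnS addnC leq_addl.
Qed.

(** No edge is lost in the count: phi is additive along shared pairs when a component takes the
    place of each free leaf. The new excess is 1 + 3 |K| plus the old ones, and the reserves of the
    components pay for all of it but 1. *)
Lemma attached_comp f V F P (K := touched P) (W := hull K V) (F' := F :|: \bigcup_(c in K) cF c) :
  attached f V F P -> exists E' th,
  [/\ F' \subset G, F' \subset E', E' \subset pairs W & closed_E E'] /\
  [/\ f \in E', forall c, c \in K -> cE c \subset E', (forall g, g \in E' -> goodp g W),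
      scr th W F' & 1 + 3 * #|K| + #|W| <= th /\
      (phi #|W| + c0 * (th%:R - #|W|%:R - 1 - 4 * (\sum_(c in K) tau c)%:R) <= #|F'|%:R)%R].
Proof.
move=> [tf VL FG [Fout PK pE dis [cardW sep]]].
have KC : K \subset C := touchedC C P.
have [PV FV] := ((tr_leaves tf).2, (tr_leaves tf).1).
have FE p c : p \in F -> c \in C -> p \notin cE c.
  move=> pF cC; apply/negP => pE'; case/negP: (Fout p c pF cC).
  exact: pairs_sub (subsetP (fam_EV famC cC) p pE').
have [E [[EV clE fE FsE PsE] graft]] := tr_graft r5 G (fat B) tf.
exists (E :|: \bigcup_(c in K) cE c).
have [th [s thV leF]] := @union_scr T r R r5 G L B C tau t famC K V F _ KC (scr_tr tf) FE.
exists (1 + #|P| + #|V| + th); split; split.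
- exact: (union_FG famC KC FG).
- apply: setUSS => //; apply/bigcupsP => c cK; apply: (bigcup_max c) => //.
  exact: (fam_FE famC (subsetP KC c cK)).
- rewrite subUset (subset_trans EV) ?pairsS ?subsetUl //=; apply/bigcupsP => c cK.
  apply: subset_trans (fam_EV famC (subsetP KC c cK)) _; apply: pairsS.
  by apply: subset_trans (subsetUr _ _); apply: bigcup_sup.
- apply: (closed_star r5 EV clE (V := fun c => cV c)) => //.
  + by move=> c /(subsetP KC)/(fam_EV famC).
  + by move=> c /(subsetP KC)/(fam_cl famC).
  + by move=> c /pE[] /(subsetP PsE).
  + by move=> c /pE[].
- by rewrite inE fE.
- by move=> c cK; apply: subset_trans (subsetUr _ _); apply: bigcup_sup.
- move=> g /setUP[gE|/bigcupP[c cK gE]]; last first.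
    apply: goodpS (fam_good famC (subsetP KC c cK) gE).
    by apply: subset_trans (subsetUr _ _); apply: bigcup_sup.
  (* The component hanging on [p]: the map from c to [cV c :&: V] is injective from K to P, and |P|
     = |K|. *)
  pose cw p := odflt (p, set0, set0) [pick c in K | cV c :&: V == p].
  have cwP p : p \in P -> cw p \in K /\ cV (cw p) :&: V = p.
    move=> pP; rewrite /cw; case: pickP => [c /andP[cK /eqP cp] //|no].
    have le : #|[set cV c :&: V | c in K]| = #|P|.
      rewrite PK; apply: card_in_imset => c c' cK c'K eqc.
      have [pc _] := pE c cK; have pp := subsetP PV _ pc.
      apply: (fam_uniq famC (subsetP KC c cK) (subsetP KC c' c'K) _ _ (pairs_card pp)).
        exact: subsetIl.
      by rewrite eqc subsetIl.
    have sub : [set cV c :&: V | c in K] \subset P.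
      by apply/subsetP => q /imsetP[c cK ->]; case: (pE c cK).
    have : p \in [set cV c :&: V | c in K].
      suff -> : [set cV c :&: V | c in K] = P by [].
      by apply/eqP; rewrite eqEcard sub le leqnn.
    by case/imsetP => c cK pc; have := no c; rewrite cK -pc eqxx.
  apply: (goodpS _ (graft FG (fun p => cV (cw p)) _ _ _ g gE)).
  + apply: setUS; apply/bigcupsP => p /cwP[cK _]; exact: (bigcup_sup (cw p)).
  + move=> p /cwP[cK cp]; apply: (fam_good famC (subsetP KC _ cK)).
    by have [_] := pE _ cK; rewrite cp.
  + by move=> p /cwP[].
  + move=> p q pP qP npq; have [pK cp] := cwP p pP; have [qK cq] := cwP q qP.
    apply: dis => //; apply: contraNneq npq => eqc; by rewrite -cp -cq eqc.
- exact: s.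
rewrite PK -/K in s *.
have cardWR : (#|V|%:R + (\sum_(c in K) #|cV c|)%:R = #|W|%:R + 2 * #|K|%:R :> R)%R.
  by rewrite -natrM -!natrD cardW.
split; first by move: cardW thV; rewrite -/K -/W; move: (\sum_(_ in _) _) #|W| #|V| #|K|; clear; lia.
rewrite (union_cardF famC KC FE) (natrD _ #|F|) (tr_countR R r5 tf) PK -/K /phi !natrD.
move: leF cardWR; move: lam c0 (#|V|%:R)%R (#|K|%:R)%R (#|W|%:R)%R (th%:R)%R ((\sum_(c in K) #|cV c|)%:R)%R
  ((\sum_(c in K) #|cF c|)%:R)%R ((\sum_(c in K) tau c)%:R)%R.
move=> l c v k w th' vk fk tk le wE.
have -> : w = (v + vk - 2 * k)%R by lra.
lra.
Qed.

End OneFamily.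

(** If f lies in a component, [fat_in] suffices. Otherwise the tree and the components it touches
    become one component, charged with one tree more than they had together; its size is at most
    [M], hence at most [L] since nothing crosses the window. *)
Lemma add_tree C tau t f V0 F0 P0 : fam C tau t -> t < D ->
  tr f V0 F0 P0 -> #|V0| <= L -> F0 \subset G -> P0 \subset fat B ->
  exists C' tau', [/\ fam C' tau' t.+1, exists2 c, c \in C' & f \in cE c &
    forall c g, c \in C -> g \in cE c -> exists2 c', c' \in C' & g \in cE c'].
Proof.
move=> famC tD tf V0L F0G P0X.
have tD' := ltnW tD.
have [/existsP[c /andP[cC fc]]|/existsPn nf] := boolP [exists c in C, f \subset cV c].
  exists C, tau; split; last by move=> c' g c'C gE; exists c'.
    by case: famC => *; split => //; apply: leqW.
  exists c => //; exact: (fat_in r5 LM noX cfgB maxB famC tD' tf).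
have {}nf c : c \in C -> ~~ (f \subset cV c) by have := nf c; rewrite negb_and => /orP[/negP|].
have [V [F [P att]]] := attach famC tD' tf V0L F0G P0X nf.
have [E' [th [[F'G F'E E'W clE'] [fE' EsE' good s [thW q]]]]] := attached_comp famC att.
case: att => t' VL _ [_ PK pE dis [cardW sep]].
set K := touched C P in F'G F'E E'W EsE' good s thW q PK pE dis cardW sep.
have KC : K \subset C := touchedC C P.
set W := V :|: _ in F'G E'W good s thW q cardW sep.
set F' := F :|: _ in F'G F'E s q.
pose n : comp := (W, F', E').
have f2 := tr_card2 r5 tf.
have W2 : 1 < #|W|.
  by rewrite -f2 subset_leq_card // (pairs_sub (subsetP E'W f fE')).
have tauK : \sum_(c in K) tau c <= t.
  by apply: leq_trans (fam_t famC); rewrite [X in _ <= X](big_setID K) /= (setIidPr KC) leq_addr.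
have qn : qual (1 + \sum_(c in K) tau c) W F'.
  exists th; split => //; apply: le_trans q; rewrite lerD2l ler_wpM2l ?(ltW (c0_gt0 R r5)) //.
  by rewrite natrD; lra.
have WL : #|W| <= L.
  apply: (qual_noX r5 noX _ F'G (subset_trans F'E E'W) qn).
    by rewrite add1n; apply: leq_ltn_trans tD.
  have KL : #|K| <= L * L.
    by rewrite -PK; apply: card_pairs_le (tr_leaves t').2 VL.
  by apply: (card_union_le LM famC KC VL); apply: leq_trans KL (leq_addr _ _).
have sepn c : c \in C -> c \notin K -> #|W :&: cV c| <= 1 := sep c.
pose C' := n |: (C :\: K); pose tau' c := if c == n then 1 + \sum_(c in K) tau c else tau c.
have nC' : n \notin C :\: K.
  apply/negP; rewrite inE => /andP[nK nC]; have := sepn n nC nK.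
  by rewrite /n /cV /= setIid leqNgt W2.
have inC' c : c \in C' -> c = n \/ [/\ c \in C, c \notin K & c != n].
  case/setU1P => [->|cCK]; [by left|right]; have := cCK; rewrite inE => /andP[-> ->].
  by split => //; apply: contraNneq nC' => <-.
exists C', tau'; split.
- split.
  + by move=> c /inC'[->//|[cC _ _]]; apply: (fam_FG famC cC).
  + by move=> c /inC'[->//|[cC _ _]]; apply: (fam_FE famC cC).
  + by move=> c /inC'[->//|[cC _ _]]; apply: (fam_EV famC cC).
  + by move=> c /inC'[->//|[cC _ _]]; apply: (fam_cl famC cC).
  + by move=> c /inC'[->|[cC _ _]]; [apply/andP; split|apply: (fam_card famC cC)].
  + move=> c /inC'[->|[cC _ nc]]; first by rewrite /tau' eqxx.
    by rewrite /tau' (negbTE nc); apply: (fam_q famC cC).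
  + by move=> c /inC'[->//|[cC _ _]]; apply: (fam_good famC cC).
  + move=> c c' /inC'[->|[cC ncK _]] /inC'[->|[c'C nc'K _]]; rewrite ?eqxx //.
    * by move=> _; apply: sepn.
    * by move=> _; rewrite setIC; apply: sepn.
    * exact: (fam_pw famC cC c'C).
  + move=> b bB; have [c cC [Vb Fb Eb]] := fam_B famC bB.
    have [cK|ncK] := boolP (c \in K).
      exists n; first exact: setU11.
      split; last exact: subset_trans Eb (EsE' c cK).
        apply: subset_trans Vb _; apply: subset_trans (subsetUr _ _); exact: (bigcup_sup c).
      apply: subset_trans Fb _; apply: subset_trans (subsetUr _ _); exact: (bigcup_sup c).
    by exists c => //; apply/setU1P; right; rewrite inE ncK.
  + rewrite big_setU1 //= {1}/tau' eqxx addSn add0n ltnS; apply: leq_trans (fam_t famC).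
    rewrite [X in _ <= X](big_setID K) /= (setIidPr KC) leq_add2l.
    apply: leq_sum => c cCK; rewrite /tau'; case: eqP => // cn.
    by case/negP: nC'; rewrite -cn.
- by exists n; first exact: setU11.
move=> c g cC gE; have [cK|ncK] := boolP (c \in K).
  by exists n; [exact: setU11|apply: (subsetP (EsE' c cK))].
by exists c => //; apply/setU1P; right; rewrite inE ncK.
Qed.

End Grow.

(** * The closure in the absence of crossing scripts *)

Section Structure.
Variables (T : finType) (r : nat) (R : realFieldType).
Hypothesis r5 : (4 < r)%N.
Implicit Types (V W S U A : {set T}) (e f g h p : {set T}) (E F P Q : {set {set T}}).
Local Notation tr := (@tr T r).
Local Notation closed_E := (@closed_E T r).
Local Notation scr := (@scr T r).
Local Notation lam := (lam R r).
Local Notation kap := (kap R r).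
Local Notation c0 := (c0 R r).
Local Notation phi := (phi R r).
Local Notation D := ('C(r, 2) - 1)%N.
Local Notation comp := (comp T).
Local Notation qual := (@qual T r R).
Implicit Types (b c : comp) (B C K : {set comp}).

Variables (G : {set {set T}}) (L M : nat).
Hypothesis LM : L * L * L + (D + 3) * L <= M.
Hypothesis noX : @no_crossing T r R G L M.

Section MaxConfig.
Variable B : {set comp}.
Hypothesis cfgB : @config T r R G L B.
Hypothesis maxB : forall B', @config T r R G L B' -> #|fat B'| <= #|fat B|.
Local Notation goodp := (@goodp T r G (fat B)).
Local Notation fam := (@fam T r R G L B).

(** The analogue of [num_step] for merging along a clique. In [clique_step] the three redundancies
    are natural numbers, so a sum below 1 makes them vanish. *)
Lemma num_merge (y1 y2 y3 m t' v w : R) : (0 <= y1)%R -> (0 <= y2)%R -> (0 <= y3)%R ->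
  (0 <= t')%R -> (t' <= D%:R)%R -> (1 <= m)%R ->
  (D%:R + y2 <= r%:R / 2 * y1 + m)%R -> (v - w = y3 - r%:R + y1 + 2 * m)%R ->
  (lam * (v - 2 * m - w + 2) + m - 1 < c0 * (v - 3 * m + 4 * t' - w + 3))%R ->
  (y1 + y2 + y3 < 1)%R.
Proof.
move=> y1p y2p y3p tp tD m1 hD hv lt; rewrite ltNge; apply/negP => y.
have c0p := c0_gt0 R r5; have kp := kap_gt0 R r5; have k2 := kap_le R r5.
have r_5 := r_ge5 R r5; have lk := lam_kap R r; have l1 := lam_ge1 R r5.
have lE : (lam * (r%:R - 2) = D%:R - 1)%R.
  have := lamE' R r5; rewrite natrB; last by apply: leq_trans (bin2_ge10 r5).
  lra.
have cs : (c0 * (4 * t' + r%:R + 10) <= kap)%R.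
  apply: le_trans (c0_small R r5 (leqnn D)); rewrite ler_wpM2l ?(ltW c0p) //; lra.
have e1 : (lam * (v - 2 * m - w + 2) = lam * y3 + lam * y1 - (D%:R - 1))%R.
  have vE : (v = w + (y3 - r%:R + y1 + 2 * m))%R by lra.
  by rewrite -lE vE; ring.
have h1 : (kap * (y1 + y2 + y3) <= lam * (v - 2 * m - w + 2) + m - 1)%R.
  rewrite e1; have a1 : (lam * y1 = r%:R / 2 * y1 + kap * y1)%R by rewrite lk; ring.
  have a2 : (kap * y2 <= 1 * y2)%R by rewrite ler_wpM2r //; lra.
  have a3 : (kap * y3 <= lam * y3)%R by rewrite ler_wpM2r //; lra.
  lra.
have h2 : (c0 * (v - 3 * m + 4 * t' - w + 3) <= c0 * (y1 + y2 + y3 + 4 * t' + 3))%R.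
  by rewrite ler_wpM2l ?(ltW c0p) //; lra.
have : (c0 * (y1 + y2 + y3 + 4 * t' + 3) <= kap * (y1 + y2 + y3))%R.
  apply: (@le_trans _ _ (c0 * (4 * t' + r%:R + 10) * (y1 + y2 + y3))%R); last first.
    by rewrite ler_wpM2r //; lra.
  rewrite -mulrA ler_wpM2l ?(ltW c0p) //.
  have : ((4 * t' + r%:R + 10) * 1 <= (4 * t' + r%:R + 10) * (y1 + y2 + y3))%R.
    by rewrite ler_wpM2l //; lra.
  have : ((4 * t' + r%:R + 9) * 1 <= (4 * t' + r%:R + 9) * (y1 + y2 + y3))%R.
    by rewrite ler_wpM2l //; lra.
  lra.
lra.
Qed.

(** If one component contains S, closedness puts e into it. Otherwise any redundancy among the
    components would make their union a candidate around e; so each meets S in one pair, they meet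
    one another only inside S, and their trees are the children of a node rooted at e. *)
Lemma clique_step C tau t S e : fam C tau t -> t <= D ->
  #|S| = r -> e \in pairs S -> e \notin fat B ->
  (forall f, f \in pairs S :\ e -> exists2 c, c \in C & f \in cE c) ->
  exists2 W : {set T}, #|W| <= L & goodp e W.
Proof.
move=> famC tD S_r eS ngB cov; have r3 : 2 < #|S| by rewrite S_r; lia.
have [cf hcf] := choice_on (set0, set0, set0) (fun f fS => let: ex_intro2 c cC fc := cov f fS in
   ex_intro (fun c => c \in C /\ f \in cE c) c (conj cC fc)).
pose A := pairs S :\ e; pose K : {set comp} := cf @: A.
have cfC f : f \in A -> cf f \in C by case/hcf.
have cfE f : f \in A -> f \in cE (cf f) by case/hcf.
have cfV f : f \in A -> f \subset cV (cf f).
  by move=> fA; apply: pairs_sub (subsetP (fam_EV famC (cfC f fA)) f (cfE f fA)).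
have cfK f : f \in A -> cf f \in K by move=> fA; apply: imset_f.
have KC : K \subset C by apply/subsetP => c /imsetP[f fA ->]; apply: cfC.
have Ap f : f \in A -> f \in pairs S by case/setD1P.
have cA : #|A| = D by apply: card_root_out.
have [/existsP[c /andP[cK Sc]]|/existsPn nSc] := boolP [exists c in K, S \subset cV c].
  have cC := subsetP KC c cK; have [c2 cL] := andP (fam_card famC cC).
  exists (cV c); first by [].
  apply: (fam_good famC cC); apply: (fam_cl famC cC S_r eS); apply/subsetP => f fA.
  have [V [F [P [tf VV FG PX]]]] := fam_good famC (cfC f fA) (cfE f fA).
  have VL : #|V| <= L.
    apply: leq_trans (subset_leq_card VV) _; by case/andP: (fam_card famC (cfC f fA)).
  apply: (fat_in r5 LM noX cfgB maxB famC tD tf VL FG PX cC).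
  exact: subset_trans (pairs_sub (Ap f fA)) Sc.
pose W := \bigcup_(c in K) cV c.
have SW : S \subset W.
  apply/subsetP => x xS; have [f fA xf] := pair_avoid r3 eS xS.
  by apply/bigcupP; exists (cf f); [exact: cfK|apply: (subsetP (cfV f fA))].
pose a c := #|cV c :&: S|.
have a2 c : c \in K -> 2 <= a c.
  move=> /imsetP[f fA ->]; rewrite -(pairs_card (Ap f fA)); apply: subset_leq_card.
  by rewrite subsetI cfV // pairs_sub // Ap.
have ar c : c \in K -> a c < r.
  move=> cK; rewrite -S_r; apply: proper_card; rewrite properEneq subsetIr andbT.
  have := nSc c; rewrite cK /=; apply: contra => /eqP/setIidPr; by [].
have WM : #|W| <= M.
  apply: leq_trans (leq_card_bigcup _ _) _; apply: leq_trans LM.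
  apply: leq_trans (_ : D * L <= _); last first.
    by apply: leq_trans (leq_addl _ _); rewrite leq_mul2r leq_addr orbT.
  apply: (@leq_trans (\sum_(c in K) L)).
    by apply: leq_sum => c /(subsetP KC)/(fam_card famC)/andP[].
  by rewrite sum_nat_const leq_mul2r -cA leq_imset_card orbT.
have [ov dis] := overlap K (@cV T) S.
have SWE : S :|: \bigcup_(c in K) cV c = W by apply/setUidPr.
rewrite SWE S_r -/(a _) in ov dis.
have cov2 : D <= \sum_(c in K) 'C(a c, 2).
  rewrite -cA; apply: leq_trans (_ : #|\bigcup_(c in K) pairs (cV c :&: S)| <= _).
    apply: subset_leq_card; apply/subsetP => f fA; apply/bigcupP; exists (cf f); first exact: cfK.
    by apply: pairsP (pairs_card (Ap f fA)); rewrite subsetI cfV // pairs_sub // Ap.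
  apply: leq_trans (leq_card_bigcup _ _) _; apply: leq_sum => c _; by rewrite card_pairs.
have bnd : 2 * \sum_(c in K) 'C(a c, 2) <= r * \sum_(c in K) (a c - 2) + 2 * #|K|.
  rewrite !big_distrr /= mulnC -sum_nat_const -big_split /=; apply: leq_sum => c cK.
  exact: bin2_prune (a2 c cK) (ar c cK).
have aE : \sum_(c in K) a c = \sum_(c in K) (a c - 2) + 2 * #|K|.
  by rewrite mulnC -sum_nat_const -big_split /=; apply: eq_bigr => c cK; rewrite subnK ?a2.
have K1 : 0 < #|K|.
  have : 0 < #|A| by rewrite cA; have := bin2_ge10 r5; clear; lia.
  by case/card_gt0P => f fA; apply/card_gt0P; exists (cf f); apply: cfK.
have WE : set0 :|: \bigcup_(c in K) cV c = W by rewrite set0U.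
have eW : e \in pairs W by apply: (subsetP (pairsS SW)).
have lt := @fam_union T r R r5 G L M LM noX B cfgB maxB C tau t famC K set0 set0 0 KC
  (Scr0 T r) (sub0set G) (sub0set _) (fun p c => ltac:(by rewrite inE)) e.
rewrite WE cards0 in lt; have {}lt := lt WM eW ngB.
have [th [s vth q]] := @union_scr T r R r5 G L B C tau t famC K set0 set0 0 KC
  (Scr0 T r) (fun p c => ltac:(by rewrite inE)).
rewrite WE set0U add0n in s.
(* The redundancies: vertices of S in a component beyond the second, pairs of S covered in surplus,
   and overlaps of components outside S. *)
pose y1 := \sum_(c in K) (a c - 2); pose y2 := \sum_(c in K) 'C(a c, 2) - D.
pose y3 := r + \sum_(c in K) #|cV c| - (#|W| + \sum_(c in K) a c).
have y3E : r + \sum_(c in K) #|cV c| = y3 + (#|W| + \sum_(c in K) a c) by rewrite subnK.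
have y2E : \sum_(c in K) 'C(a c, 2) = y2 + D by rewrite subnK.
have vwE : (r%:R + (\sum_(c in K) #|cV c|)%:R = y3%:R + (#|W|%:R + (y1%:R + 2 * #|K|%:R)) :> R)%R.
  by rewrite -natrM -!natrD y3E aE.
have y0 : (y1%:R + y2%:R + y3%:R < 1 :> R)%R.
  apply: (@num_merge _ _ _ #|K|%:R t%:R (\sum_(c in K) #|cV c|)%:R #|W|%:R)%R; rewrite ?ler0n ?ler1n ?ler_nat //.
  - have : (2 * (y2%:R + D%:R) <= r%:R * y1%:R + 2 * #|K|%:R :> R)%R.
      by rewrite -natrD -!natrM -natrD ler_nat -y2E.
    lra.
  - by have := vwE; lra.
  - by move: lt; rewrite !add0r.
have {y0} [y10 y20 y30] : [/\ y1 = 0, y2 = 0 & y3 = 0].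
  have : (y1 + y2 + y3)%N == 0 by rewrite -leqn0 -ltnS -(ltr_nat R) 2!natrD.
  by rewrite !addn_eq0 -andbA => /and3P[/eqP ? /eqP ? /eqP ?].
have au c : c \in K -> a c = 2.
  move=> cK; apply/eqP; rewrite eqn_leq a2 // andbT -subn_eq0.
  by move/eqP: y10; rewrite sum_nat_eq0 => /forall_inP/(_ c cK).
have KD : #|K| = D.
  by have := y2E; rewrite y20 add0n => <-; rewrite -sum1_card; apply: eq_bigr => c cK; rewrite au.
have injcf : {in A &, injective cf}.
  by apply/imset_injP; rewrite -/K KD cA.
have cfS f : f \in A -> cV (cf f) :&: S = f.
  move=> fA; apply/esym/pair_eq; [exact: pairs_card (Ap f fA)|exact: au (cfK f fA)|].
  by rewrite subsetI cfV // pairs_sub // Ap.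
have {}dis := dis _ _ _ _ _ ; have {}dis c c' : c \in K -> c' \in K -> c != c' -> cV c :&: cV c' \subset S.
  by apply: dis; rewrite y3E y30.
have FG := union_FG famC KC (sub0set G); rewrite set0U in FG.
have FW : \bigcup_(c in K) cF c \subset pairs W.
  by have := union_FV famC KC (sub0set (pairs set0)); rewrite !set0U.
(* Without redundancy the sum of the phi of the components is exactly phi of the union, because D =
   lambda (r - 2) + 1. *)
have WL : #|W| <= L.
  apply: (qual_noX r5 noX tD FG FW _ WM); exists th; split => //.
  have -> : (#|\bigcup_(c in K) cF c| = \sum_(c in K) #|cF c|)%N.
    apply: card_bigcup_disj => c c' cK c'K; exact: (fam_disjF famC (subsetP KC c cK) (subsetP KC c' c'K)).
  apply: le_trans q; rewrite /phi.
  have vE : ((\sum_(c in K) #|cV c|)%:R = #|W|%:R + 2 * #|K|%:R - r%:R :> R)%R.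
    by have := vwE; rewrite y30 y10; lra.
  have lE : (lam * (r%:R - 2) = #|K|%:R - 1)%R.
    have := lamE' R r5; rewrite KD natrB; last by apply: leq_trans (bin2_ge10 r5).
    lra.
  have tk : ((\sum_(c in K) tau c)%:R <= t%:R :> R)%R.
    rewrite ler_nat; apply: leq_trans (fam_t famC).
    by rewrite [X in _ <= X](big_setID K) /= (setIidPr KC); exact: leq_addr.
  rewrite vE.
  have -> : (lam * (#|W|%:R + 2 * #|K|%:R - r%:R - 2 * #|K|%:R) + #|K|%:R = lam * (#|W|%:R - 2) + 1)%R.
    have -> : (#|K|%:R = lam * (r%:R - 2) + 1 :> R)%R by rewrite lE; lra.
    ring.
  rewrite lerD2l ler_wpM2l ?(ltW (c0_gt0 R r5)) //.
  have : (1 <= #|K|%:R :> R)%R by rewrite ler1n.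
  have := r_ge5 R r5; lra.
have [V [F [P hV]]] := choice3_on set0 set0 set0
  (fun f (fA : f \in A) => fam_good famC (cfC f fA) (cfE f fA)).
exists W; first exact: WL.
exists (\bigcup_(f in A) V f), (\bigcup_(f in A) F f), (\bigcup_(f in A) P f); split.
- apply: TrN => //; first by move=> f /hV[].
  + move=> f fA; have [tf Vf _ _] := hV f fA; apply/eqP; rewrite eqEsubset; apply/andP; split.
      by rewrite -{2}(cfS f fA) setSI.
    by rewrite subsetI (tr_sub r5 tf) pairs_sub // Ap.
  + move=> f g fA gA nfg; have [_ Vf _ _] := hV f fA; have [_ Vg _ _] := hV g gA.
    apply: subset_trans (setISS Vf Vg) (dis _ _ (cfK f fA) (cfK g gA) _).
    by apply: contraNneq nfg => /(injcf f g fA gA) ->.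
- by apply/bigcupsP => f fA; have [_ Vf _ _] := hV f fA; apply: (bigcup_max (cf f)) => //; apply: cfK.
- by apply/bigcupsP => f fA; have [] := hV f fA.
- by apply/bigcupsP => f fA; have [] := hV f fA.
Qed.

Definition reach e : Prop := exists2 W : {set T}, #|W| <= L & goodp e W.

Lemma add_trees (l : seq {set T}) : size l <= D -> (forall f, f \in l -> reach f) ->
  exists C tau, fam C tau (size l) /\ forall f, f \in l -> exists2 c, c \in C & f \in cE c.
Proof.
elim: l => [|f l IH] /= lD hl.
  by exists B, (fun=> 0); split => //; apply: (fam_start r5 cfgB).
have [||C [tau [famC cov]]] := IH; first exact: ltnW.
  by move=> g gl; apply: hl; rewrite inE gl orbT.
have [W WL [V [F [P [tf VW FG PX]]]]] := hl f (mem_head f l).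
have [C' [tau' [famC' covf covC]]] := add_tree r5 LM noX cfgB maxB famC lD tf
  (leq_trans (subset_leq_card VW) WL) FG PX.
exists C', tau'; split => // g /predU1P[->//|/cov[c cC gc]].
exact: covC cC gc.
Qed.

(** One tree is attached for each pair other than e, hence D in all; [c0] and [no_crossing] are
    calibrated for this number. *)
Lemma reach_closed S e : 1 < L -> #|S| = r -> e \in pairs S ->
  (forall f, f \in pairs S :\ e -> reach f) -> reach e.
Proof.
move=> L2 S_r eS hr; have e2 := pairs_card eS.
have [eX|neX] := boolP (e \in fat B).
  exists e; first by rewrite e2.
  exists e, set0, [set e]; split; [exact: TrP|exact: subxx|exact: sub0set|by rewrite sub1set].
have [||C [tau [famC cov]]] := @add_trees (enum (pairs S :\ e)).
- by rewrite -cardE (card_root_out S_r eS).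
- by move=> f; rewrite mem_enum; apply: hr.
apply: (clique_step famC _ S_r eS neX); first by rewrite -cardE (card_root_out S_r eS).
by move=> f fS; apply: cov; rewrite mem_enum.
Qed.

(** If e lies in the vertex set of a block, the script of that block serves. Otherwise the tree is
    attached to the family of blocks: touching none, it has no free leaf left; touching some, the
    union is a script with positive excess. *)
Lemma reach_class e : reach e ->
  (exists V F, [/\ tr e V F set0, F \subset G & #|V| <= L]) \/
  (exists V F th, [/\ e \subset V, F \subset G, F \subset pairs V & #|V| <= L] /\
     [/\ scr th V F, #|V| < th & (phi #|V| + c0 / 2 * (th%:R - #|V|%:R) <= #|F|%:R)%R]).
Proof.
move=> [W WL [V [F [P [tf VW FG PX]]]]].
have VL := leq_trans (subset_leq_card VW) WL.
have famB := fam_start r5 cfgB. have c0p := c0_gt0 R r5.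
have [/existsP[b /andP[bB eb]]|/existsPn ne] := boolP [exists b in B, e \subset cV b].
  right; have [bG bV bE /andP[b2 bL] [th [s q]]] := cfgB.1 b bB.
  have [lt pos] := scr_lt r5 s.
  have thp : 0 < th by apply: pos; rewrite -card_gt0; apply: ltnW.
  rewrite thp addn1 in lt.
  exists (cV b), (cF b), th; split => //; split => //; apply: le_trans q; rewrite lerD2l.
  have : (#|cV b|%:R <= th%:R :> R)%R by rewrite ler_nat ltnW.
  by move=> h; rewrite -mulrA ler_wpM2l ?(ltW c0p) // mulr0; lra.
have {}ne c : c \in B -> ~~ (e \subset cV c) by have := ne c; rewrite negb_and => /orP[/negP|].
have [V' [F' [P' att]]] := attach r5 LM noX cfgB maxB famB (leq0n D) tf VL FG PX ne.
have [E' [th [[FG' FE' EW clE] [eE _ _ s [thW q]]]]] := attached_comp r5 famB att.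
case: att => t' V'L F'G [_ PK pE dis [cardW sep]].
set K := touched B P' in FG' FE' EW s thW q PK pE cardW.
have [K0|K0] := set_0Vmem K.
  left; exists V', F'; split => //.
  by have <- : P' = set0 by apply/eqP; rewrite -cards_eq0 PK K0 cards0.
right; set W' := V' :|: _ in FG' EW s thW q cardW; set F'' := F' :|: _ in FG' FE' s q.
have K1 : 0 < #|K| by case: K0 => c cK; apply/card_gt0P; exists c.
have qq : qual 1 W' F''.
  exists th; split => //; apply: le_trans q; rewrite big1 // lerD2l ler_wpM2l ?(ltW c0p) //; lra.
have W'M : #|W'| <= M.
  apply: (card_union_le LM famB (touchedC B P') V'L).
  by apply: leq_trans (leq_addr 2 _); rewrite -/K -PK; apply: card_pairs_le (tr_leaves t').2 V'L.
have D1 : 0 < D by have := bin2_ge10 r5; clear; lia.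
exists W', F'', th; split; split => //.
- exact: pairs_sub (subsetP EW e eE).
- exact: subset_trans FE' EW.
- by apply: (qual_noX r5 noX D1 FG' (subset_trans FE' EW) qq).
- by apply: leq_trans thW; clear; lia.
(* The excess is at least 1 + 3 |K| >= 4, so half of it covers the 1 lost by attaching the tree; the
   price drops to c0 / 2. *)
apply: le_trans q; rewrite big1 // lerD2l -mulrA ler_wpM2l ?(ltW c0p) //.
have : (4 + #|W'|%:R <= th%:R :> R)%R.
  by rewrite -natrD ler_nat; apply: leq_trans thW; move: K1; clear; lia.
lra.
Qed.

End MaxConfig.

(** [Z] enters through minimality: the reached pairs contain G and form a closed set by
    [reach_closed]. *)
Theorem structure (Z : {set {set T}}) : 1 < L -> G \subset pairs setT ->
  (forall Z' : {set {set T}}, G \subset Z' -> closed_E Z' -> Z \subset Z') ->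
  forall e, e \in Z ->
  (exists V F, [/\ tr e V F set0, F \subset G & #|V| <= L]) \/
  (exists V F th, [/\ e \subset V, F \subset G, F \subset pairs V & #|V| <= L] /\
     [/\ scr th V F, #|V| < th & (phi #|V| + c0 / 2 * (th%:R - #|V|%:R) <= #|F|%:R)%R]).
Proof.
move=> L2 Gp minZ e eZ; have [B cB mB] := exists_max_config r R G L.
apply: (@reach_class B cB mB).
have := subsetP (minZ [set e | `[< reach B e >]] _ _) e eZ; rewrite inE => h.
apply/asboolP; apply: h.
- apply/subsetP => f fG; rewrite inE; apply/asboolP; have f2 := pairs_card (subsetP Gp f fG).
  exists f; first by rewrite f2.
  by exists f, [set f], set0; split; [exact: TrG|exact: subxx|rewrite sub1set|exact: sub0set].
- move=> S f S_r fS sub; rewrite inE; apply/asboolP; apply: (reach_closed cB mB L2 S_r fS).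
  by move=> g gS; have := subsetP sub g gS; rewrite inE => /asboolP.
Qed.

End Structure.

(** * Weighted counting of trees and scripts *)

Section Sums.
Local Open Scope ring_scope.
Variable R : realFieldType.

(** For upper bounds every object has to be built at least once; repeated preimages only enlarge the
    right-hand side. *)
Lemma sum_cover (I J : finType) (A : pred J) (P : pred I) (h : I -> J) (w : J -> R) :
  (forall i, P i -> 0 <= w (h i)) -> (forall j, A j -> exists2 i, P i & h i = j) ->
  \sum_(j | A j) w j <= \sum_(i | P i) w (h i).
Proof.
move=> w0 hA; rewrite [leRHS](partition_big h predT) //= [leLHS]big_mkcond /=.
apply: ler_sum => j _; case: ifP => Aj; last by apply: sumr_ge0 => i /andP[/w0].
have [i Pi hi] := hA j Aj; rewrite (bigD1 i) ?Pi ?hi ?eqxx //= -[leLHS]addr0 lerD2l.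
by apply: sumr_ge0 => k /andP[/andP[/w0]].
Qed.

Lemma ler_sum_pred (I : finType) (P Q : pred I) (w : I -> R) :
  (forall i, Q i -> 0 <= w i) -> (forall i, P i -> Q i) -> \sum_(i | P i) w i <= \sum_(i | Q i) w i.
Proof.
by move=> w0 PQ; apply: (@sum_cover _ _ P Q id w) => // i /PQ Qi; exists i.
Qed.

Lemma prod_setU (T : finType) (A B : {set T}) (w : T -> R) : [disjoint A & B] ->
  \prod_(i in A :|: B) w i = (\prod_(i in A) w i) * (\prod_(i in B) w i).
Proof. by move=> dis; rewrite -bigU //; apply: eq_bigl => i; rewrite !inE. Qed.

Lemma prod_bigcup (I T : finType) (B : {set I}) (W : I -> {set T}) (w : T -> R) :
  (forall g h, g \in B -> h \in B -> g != h -> [disjoint W g & W h]) ->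
  \prod_(v in \bigcup_(g in B) W g) w v = \prod_(g in B) \prod_(v in W g) w v.
Proof.
elim: {B}_.+1 {-2}B (ltnSn #|B|) => // k IHk B leBk disj.
have [->|[i iB]] := set_0Vmem B; first by rewrite !big_set0.
rewrite (big_setD1 i) //= [in RHS](big_setD1 i) //= prod_setU ?IHk //.
- by move: leBk; rewrite (cardsD1 i) iB.
- move=> g h /setD1P[_ gB] /setD1P[_ hB]; exact: disj.
apply/bigcup_disjointP => j /setD1P[nji jB].
by rewrite disj // eq_sym.
Qed.

Variables (T : finType).

(** The elementary symmetric polynomial of degree k in the weights. *)
Definition esum (w : T -> R) (k : nat) := \sum_(A : {set T} | #|A| == k) \prod_(v in A) w v.

Lemma esum_le (w : T -> R) k : (forall v, 0 <= w v) -> esum w k * k`!%:R <= (\sum_v w v) ^+ k.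
Proof.
move=> w0; have p0 (A : {set T}) : 0 <= \prod_(v in A) w v by apply: prodr_ge0.
elim: k => [|k IH].
  rewrite expr0 fact0 mulr1 /esum (bigD1 set0) ?cards0 //= big_set0 big1 ?addr0 // => A /andP[].
  by rewrite cards_eq0 => ->.
rewrite factS natrM exprS mulrA; apply: le_trans (_ : (\sum_v w v) * (esum w k * k`!%:R) <= _); last first.
  by rewrite ler_wpM2l // sumr_ge0.
rewrite mulrA ler_wpM2r ?ler0n //.
have -> : esum w k.+1 * k.+1%:R =
   \sum_(j : {set T} * T | (#|j.1| == k.+1) && (j.2 \in j.1)) \prod_(v in j.1) w v.
  rewrite -(pair_big_dep (fun A : {set T} => #|A| == k.+1) (fun A v => v \in A)
    (fun A _ => \prod_(v in A) w v)) /= mulr_suml; apply: eq_bigr => A /eqP <-.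
  by rewrite sumr_const mulr_natr.
apply: le_trans (@sum_cover _ _ _ (fun i : T * {set T} => (#|i.2| == k) && (i.1 \notin i.2))
   (fun i => (i.1 |: i.2, i.1)) (fun j => \prod_(v in j.1) w v) _ _) _.
- by move=> i _; apply: p0.
- move=> [A v] /= /andP[/eqP cA vA]; exists (v, A :\ v); last by rewrite /= setD1K.
  by rewrite /= setD11 andbT -eqSS -cA (cardsD1 v A) vA.
rewrite /= (eq_bigr (fun i : T * {set T} => w i.1 * \prod_(v in i.2) w v)); last first.
  by move=> [v A] /= /andP[_ nvA]; rewrite big_setU1.
apply: le_trans (_ : \sum_(i : T * {set T} | #|i.2| == k) w i.1 * \prod_(v in i.2) w v <= _).
  by apply: ler_sum_pred => [i _|i /andP[]//]; apply: mulr_ge0.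
rewrite -(pair_big_dep xpredT (fun _ (A : {set T}) => #|A| == k)
  (fun v A => w v * \prod_(u in A) w u)) /= mulr_suml.
by apply: ler_sum => v _; rewrite mulr_sumr.
Qed.

End Sums.

Section TreeSums.
Local Open Scope ring_scope.
Variables (R : realFieldType) (T : finType) (r : nat).
Hypothesis r5 : (4 < r)%N.
Local Notation D := ('C(r, 2) - 1)%N.
Local Notation tr := (@tr T r).
Implicit Types (f g h p : {set T}) (V S : {set T}).

Definition triple : finType := ({set T} * {set {set T}} * {set {set T}})%type.
Implicit Types (z : triple).

Definition is_tr f (m : nat) z : bool := `[< tr f z.1.1 z.1.2 z.2 >] && (#|z.1.1| <= m)%N.

Variables (chi : T -> R) (y rho : R).
Hypotheses (chi0 : forall v, 0 <= chi v) (y0 : 0 <= y) (rho0 : 0 <= rho).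

(** The root carries no weight, so the weight of a node factors into its r - 2 new clique vertices
    and its children. Vertex weights vary because scripts charge old vertices differently and
    [marked_sum_le] singles out one vertex. *)
Definition wt f z : R := (\prod_(v in z.1.1 :\: f) chi v) * y ^+ #|z.2|.

Definition tree_sum m f : R := \sum_(z | is_tr f m z) wt f z.

Lemma wt_ge0 f z : 0 <= wt f z.
Proof. by rewrite mulr_ge0 ?exprn_ge0 // prodr_ge0. Qed.

Section NodeWeight.
Variables (f S : {set T}) (V : {set T} -> {set T}) (F P : {set T} -> {set {set T}}).
Hypotheses (S_r : #|S| = r) (fS : f \in pairs S).
Hypothesis tg : forall g, g \in pairs S :\ f -> tr g (V g) (F g) (P g).
Hypothesis VS : forall g, g \in pairs S :\ f -> V g :&: S = g.
Hypothesis VV : forall g h, g \in pairs S :\ f -> h \in pairs S :\ f -> g != h ->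
  V g :&: V h \subset S.

Lemma node_weight :
  wt f (\bigcup_(g in pairs S :\ f) V g, \bigcup_(g in pairs S :\ f) F g,
    \bigcup_(g in pairs S :\ f) P g) =
  (\prod_(v in S :\: f) chi v) * \prod_(g in pairs S :\ f) wt g (V g, F g, P g).
Proof.
rewrite /wt /= big_split /= mulrA; congr (_ * _); last first.
  rewrite (node_card_leaves VS VV (Q := P)) ?expr_sum //.
  by move=> g /tg/tr_leaves[].
have VgS g : g \in pairs S :\ f -> V g :\: g = V g :\: S.
  by move=> gS; rewrite -{2}(VS gS) setDIr setDv set0U.
rewrite -(prod_bigcup (W := fun g => V g :\: g)); last first.
  move=> g h gS hS ngh; rewrite !VgS // -setI_eq0; apply/eqP/setP => x; rewrite !inE.
  apply/negP => /andP[/andP[nxS xg] /andP[_ xh]].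
  by move: (subsetP (VV gS hS ngh) x); rewrite inE xg xh (negbTE nxS) => /(_ isT).
rewrite -prod_setU.
  apply: eq_bigl => x; rewrite !inE.
  have [xS|nxS] := boolP (x \in S).
    rewrite (subsetP (node_sub r5 S_r fS VS)) // !andbT.
    suff -> : (x \in \bigcup_(g in pairs S :\ f) (V g :\: g)) = false by rewrite orbF.
    by apply/bigcupP => -[g gS]; rewrite VgS // inE xS.
  rewrite andbF /=; have -> : x \notin f by apply: contra nxS; apply: (subsetP (pairs_sub fS)).
  apply/bigcupP/bigcupP => -[g gS xg]; exists g => //; first by rewrite VgS // inE nxS xg.
  by move: xg; rewrite inE => /andP[].
apply/bigcup_disjointP => g gS; rewrite VgS // -setI_eq0; apply/eqP/setP => x.
by rewrite !inE; case: (x \in S); rewrite /= ?andbF.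
Qed.

End NodeWeight.

Lemma clique_sum f : #|f| = 2 ->
  \sum_(S : {set T} | (#|S| == r) && (f \in pairs S)) \prod_(v in S :\: f) chi v
   <= (\sum_v chi v) ^+ (r - 2) / (r - 2)`!%:R.
Proof.
move=> f2; have f0 : 0 < (r - 2)`!%:R :> R by rewrite ltr0n fact_gt0.
rewrite ler_pdivlMr //; apply: le_trans (esum_le (r - 2) chi0); rewrite ler_wpM2r ?ler0n //.
apply: le_trans (@sum_cover _ _ _ _ (fun A : {set T} => (#|A| == r - 2) && [disjoint A & f])%N
   (fun A => A :|: f) (fun S => \prod_(v in S :\: f) chi v) _ _) _.
- by move=> A _; apply: prodr_ge0.
- move=> S /andP[/eqP S_r fS]; have sf := pairs_sub fS; exists (S :\: f).
    rewrite cardsD (setIidPr sf) S_r f2 eqxx /= -setI_eq0; apply/eqP/setP => x; rewrite !inE.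
    by case: (x \in f); rewrite /= ?andbF.
  by apply/setP => x; rewrite !inE; case: (boolP (x \in f)) => [/(subsetP sf)->|_]; rewrite /= ?orbT ?orbF.
rewrite /esum (eq_bigr (fun A : {set T} => \prod_(v in A) chi v)).
  by apply: ler_sum_pred => [A _|A /andP[]//]; apply: prodr_ge0.
move=> A /andP[_ dis]; apply: eq_bigl => x; rewrite !inE.
case: (boolP (x \in f)) => xf /=; last by rewrite orbF.
by apply/esym/negP => xA; move/pred0P: dis => /(_ x); rewrite /= xA xf.
Qed.

Lemma tr_inv f V F P : tr f V F P ->
  [\/ (V, F, P) = (f, [set f], set0), (V, F, P) = (f, set0, [set f]) |
   exists S (V' : {set T} -> {set T}) (F' P' : {set T} -> {set {set T}}),
   [/\ #|S| = r, f \in pairs S,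
     (forall g, g \in pairs S :\ f -> tr g (V' g) (F' g) (P' g)) &
     [/\ (forall g, g \in pairs S :\ f -> V' g :&: S = g),
     (forall g h, g \in pairs S :\ f -> h \in pairs S :\ f -> g != h ->
        V' g :&: V' h \subset S) &
     (V, F, P) = (\bigcup_(g in pairs S :\ f) V' g, \bigcup_(g in pairs S :\ f) F' g,
       \bigcup_(g in pairs S :\ f) P' g)]]].
Proof.
case=> [g _|g _|g S V' F' P' S_r gS tg VS VV]; [by constructor 1|by constructor 2|].
by constructor 3; exists S, V', F', P'.
Qed.

Lemma child_card f S (V : {set T} -> {set T}) g : #|S| = r -> f \in pairs S ->
  (forall g, g \in pairs S :\ f -> V g :&: S = g) -> g \in pairs S :\ f ->
  (#|V g| < #|\bigcup_(g in pairs S :\ f) V g|)%N.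
Proof.
move=> S_r fS VS gS; apply: proper_card; apply/properP; split; first exact: (bigcup_sup g).
have /subsetPn[x xS nxg] : ~~ (S \subset g).
  apply/negP => /subset_leq_card; rewrite S_r; case/setD1P: gS => _ /pairs_card ->.
  by rewrite leqNgt (leq_trans _ r5).
exists x; first exact: (subsetP (node_sub r5 S_r fS VS)).
by apply: contra nxg => xV; rewrite -(VS g gS) inE xV.
Qed.

Hypothesis rho_fix : 1 + y + (\sum_v chi v) ^+ (r - 2) / (r - 2)`!%:R * rho ^+ D <= rho.

(** Induction on the size bound, as children are strictly smaller. Dropping the disjointness of the
    children turns the sum over nodes into a clique sum times a product of D tree sums. *)
Lemma tree_sum_le m f : tree_sum m f <= rho.
Proof.
elim: m f => [|m IH] f.
  rewrite /tree_sum big1 // => z /andP[/asboolP tz]; rewrite leqn0 cards_eq0 => /eqP z0.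
  have := subset_leq_card (tr_sub r5 tz); rewrite z0 cards0 (tr_card2 r5 tz) //.
have [f2|nf2] := eqVneq #|f| 2; last first.
  rewrite /tree_sum big1 // => z /andP[/asboolP tz]; by rewrite (tr_card2 r5 tz) in nf2.
pose z0 : triple := (set0, set0, set0).
(* The two kinds of leaves, or a clique with a choice of children; [z0] extends the choice beyond
   the pairs of the clique, so that it is a finite function on all sets. *)
pose I : finType := (bool + {set T} * {ffun {set T} -> triple})%type.
pose U (S : {set T}) (x : {set T} -> triple) : triple := (\bigcup_(g in pairs S :\ f) (x g).1.1,
  \bigcup_(g in pairs S :\ f) (x g).1.2, \bigcup_(g in pairs S :\ f) (x g).2).
pose h (i : I) : triple := match i with
  | inl b => if b then (f, [set f], set0) else (f, set0, [set f])
  | inr (S0, x) => U S0 x end.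
pose Q (g : {set T}) z := is_tr g m z.
pose ok S (x : {ffun {set T} -> triple}) := [&& #|S| == r, f \in pairs S,
  x \in pfamily z0 (mem (pairs S :\ f)) Q,
  [forall g in pairs S :\ f, (x g).1.1 :&: S == g] &
  [forall g in pairs S :\ f, forall k in pairs S :\ f, (g != k) ==> ((x g).1.1 :&: (x k).1.1 \subset S)]].
pose P (i : I) := match i with inl b => true | inr (S0, x) => ok S0 x end.
apply: le_trans (@sum_cover R I triple (is_tr f m.+1) P h (wt f) _ _) _.
- by move=> i _; apply: wt_ge0.
- move=> z /andP[/asboolP /= tz zm]; have [zE|zE|[S [V [F [L [S_r fS tg [VS VV zE]]]]]]] := tr_inv tz.
  + by exists (inl true) => //=; case: (z) zE => -[].
  + by exists (inl false) => //=; case: (z) zE => -[].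
  pose x := [ffun g => if g \in pairs S :\ f then (V g, F g, L g) else z0].
  have xE g : g \in pairs S :\ f -> x g = (V g, F g, L g) by move=> gS; rewrite ffunE gS.
  exists (inr (S, x)); last first.
    case: (z) zE => -[a b] c /= ->; rewrite /U.
    by congr (_, _, _); apply: eq_bigr => g gS; rewrite xE.
  have zV : z.1.1 = \bigcup_(g in pairs S :\ f) V g by case: (z) zE => -[a b] c [].
  rewrite /= /ok S_r eqxx fS /=; apply/and3P; split.
  + apply/pfamilyP; split; first by apply/subsetP => g; apply: contraTT => ng; rewrite unfold_in /= ffunE (negbTE ng) eqxx.
    move=> g gS; rewrite /Q /is_tr /= xE //=; apply/andP; split; first by apply/asboolP/tg.
    rewrite -ltnS; apply: leq_trans zm; rewrite zV; exact: child_card VS gS.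
  + by apply/forall_inP => g gS; rewrite xE //= VS.
  + apply/forall_inP => g gS; apply/forall_inP => k kS; apply/implyP => ngk.
    by rewrite !xE //= VV.
rewrite big_sumType /=.
have -> : \sum_(b : bool) wt f (if b then (f, [set f], set0) else (f, set0, [set f])) = 1 + y.
  by rewrite big_bool /wt /= setDv big_set0 !mul1r cards0 cards1 expr0 expr1.
apply: le_trans rho_fix; rewrite lerD2l.
have mono S : \prod_(g in pairs S :\ f) tree_sum m g <= rho ^+ #|pairs S :\ f|.
  rewrite -prodr_const; apply: ler_prod => g _; rewrite IH andbT.
  by apply: sumr_ge0 => z _; apply: wt_ge0.
apply: le_trans (_ : \sum_(S : {set T} | (#|S| == r) && (f \in pairs S))
   (\prod_(v in S :\: f) chi v) * \prod_(g in pairs S :\ f) tree_sum m g <= _); last first.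
  apply: le_trans (_ : \sum_(S : {set T} | (#|S| == r) && (f \in pairs S))
     (\prod_(v in S :\: f) chi v) * rho ^+ D <= _).
    apply: ler_sum => S /andP[/eqP S_r fS]; rewrite ler_wpM2l ?prodr_ge0 //.
    by rewrite -(card_root_out S_r fS).
  by rewrite -mulr_suml ler_wpM2r ?exprn_ge0 // clique_sum.
rewrite [leRHS](eq_bigr (fun S => \sum_(x in pfamily z0 (mem (pairs S :\ f)) Q)
   (\prod_(v in S :\: f) chi v) * \prod_(g in pairs S :\ f) wt g (x g))); last first.
  by move=> S _; rewrite -mulr_sumr /tree_sum (big_distr_big_dep z0).
rewrite pair_big_dep /=.
rewrite (eq_bigr (fun i : {set T} * {ffun {set T} -> triple} => (\prod_(v in i.1 :\: f) chi v) *
   \prod_(g in pairs i.1 :\ f) wt g (i.2 g))); last first.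
  move=> [S x] /= /and5P[/eqP S_r fS /pfamilyP[_ xQ] /forall_inP VS /forall_inP VV].
  have tg g : g \in pairs S :\ f -> tr g (x g).1.1 (x g).1.2 (x g).2.
    by move=> gS; have /andP[/asboolP] := xQ g gS.
  rewrite /U (node_weight S_r fS tg).
  - by congr (_ * _); apply: eq_bigr => g _; rewrite -!surjective_pairing.
  - by move=> g gS; apply/eqP/VS.
  - by move=> g k gS kS ngk; have /forall_inP/(_ k kS)/implyP/(_ ngk) := VV g gS.
apply: ler_sum_pred => [[S x] _|[S x] /=].
  by rewrite mulr_ge0 ?prodr_ge0 // => *; apply: wt_ge0.
by move=> /and5P[-> -> ->].
Qed.

End TreeSums.

(** * Weighted sums over scripts *)

Section ScriptSums.
Local Open Scope ring_scope.
Variables (R : realFieldType) (T : finType) (r : nat).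
Hypothesis r5 : (4 < r)%N.
Local Notation D := ('C(r, 2) - 1)%N.
Local Notation tr := (@tr T r).
Local Notation scr := (@scr T r).
Local Notation triple := (triple T).
Implicit Types (f g h p : {set T}) (V S O : {set T}).

Lemma scr_inv th V F : scr th V F ->
  (th = 0%N /\ V = set0 /\ F = set0) \/
  exists th0 V0 F0 g V1 F1 P1, [/\ scr th0 V0 F0, tr g V1 F1 P1 &
    [/\ th = (th0 + (1 + #|P1| + #|V1|))%N, V = V0 :|: V1 & F = F0 :|: F1]].
Proof.
case=> [|th0 V0 F0 g V1 F1 P1 s t _]; first by left.
by right; exists th0, V0, F0, g, V1, F1, P1.
Qed.

Variables (x y rho : R) (N : nat).
Hypotheses (x0 : 0 <= x) (y0 : 0 <= y) (rho0 : 0 <= rho).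
Let sigma : R := y * N%:R + x * #|T|%:R.
Hypothesis fixpt : 1 + y + sigma ^+ (r - 2) / (r - 2)`!%:R * rho ^+ D <= rho.
(** The factor for one further tree: [y] for the tree itself, [sigma] for each vertex of its root
    and [rho] for the rest. Here [sigma] bounds the total vertex weight when at most [N] vertices
    are old. *)
Let q := y * (rho * sigma ^+ 2).
Hypothesis q_small : q <= 2^-1.

Definition vf : finType := ({set T} * {set {set T}})%type.
Definition is_scr (th : nat) (u : vf) : bool := `[< scr th u.1 u.2 >] && (#|u.1| <= N)%N.
Definition swt (th : nat) (u : vf) : R := x ^+ #|u.1| * y ^+ (th - #|u.1|).
(** The bound [b] on th makes the sum finite; the final estimate is uniform in [b]. *)
Definition all_scr_sum b := \sum_(i : 'I_b * vf | is_scr i.1 i.2) swt i.1 i.2.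
Definition scr_sum b := \sum_(i : 'I_b * vf | is_scr i.1 i.2 && (0 < i.1)%N) swt i.1 i.2.

(* A new tree pays y instead of x for each vertex of the previously built set O. *)
Definition old_weight O (v : T) : R := if v \in O then y else x.

Lemma sigma_ge0 : 0 <= sigma.
Proof. by rewrite addr_ge0 ?mulr_ge0. Qed.

Lemma swt_ge0 th u : 0 <= swt th u.
Proof. by rewrite mulr_ge0 ?exprn_ge0. Qed.

Lemma old_weight_ge0 O v : 0 <= old_weight O v.
Proof. by rewrite /old_weight; case: ifP. Qed.

Lemma old_weight_prod O V : \prod_(v in V) old_weight O v = x ^+ #|V :\: O| * y ^+ #|V :&: O|.
Proof.
rewrite (big_setID O) /= mulrC -!prodr_const; congr (_ * _); apply: eq_bigr => v;
by rewrite inE /old_weight => /andP[]; case: (v \in O).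
Qed.

Lemma old_weight_sum O : (#|O| <= N)%N -> \sum_v old_weight O v <= sigma.
Proof.
move=> ON; rewrite (bigID (mem O)) /=; apply: lerD.
  rewrite (eq_bigr (fun _ => y)) => [|v vO]; last by rewrite /old_weight vO.
  by rewrite sumr_const -[y *+ _]mulr_natr ler_wpM2l // ler_nat.
rewrite (eq_bigr (fun _ => x)) => [|v /negbTE vO]; last by rewrite /old_weight vO.
by rewrite sumr_const -[x *+ _]mulr_natr ler_wpM2l // ler_nat max_card.
Qed.

Lemma rooted_sum O : (#|O| <= N)%N ->
  \sum_(g in pairs setT) \sum_(z | is_tr r g N z)
     (\prod_(v in z.1.1) old_weight O v) * y ^+ #|z.2| <= rho * sigma ^+ 2.
Proof.
move=> ON; have s0 := sigma_ge0; have w0 := old_weight_ge0 O; have sle := old_weight_sum ON.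
have ssum0 : 0 <= \sum_v old_weight O v by apply: sumr_ge0.
have tle g : tree_sum r (old_weight O) y N g <= rho.
  apply: tree_sum_le => //; apply: le_trans fixpt; rewrite lerD2l.
  apply: ler_wpM2r; first exact: exprn_ge0.
  by apply: ler_wpM2r; rewrite ?invr_ge0 ?ler0n // lerXn2r // nnegrE.
apply: le_trans (_ : \sum_(g in pairs setT) (\prod_(v in g) old_weight O v) * rho <= _).
  apply: ler_sum => g _; apply: le_trans (_ : (\prod_(v in g) old_weight O v) *
      tree_sum r (old_weight O) y N g <= _); last by rewrite ler_wpM2l ?prodr_ge0.
  rewrite /tree_sum mulr_sumr; apply: ler_sum => z /andP[/asboolP tz _].
  rewrite /wt mulrA ler_wpM2r ?exprn_ge0 // -prod_setU.
    rewrite (_ : g :|: (z.1.1 :\: g) = z.1.1) //.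
    apply/setP => v; rewrite !inE; case: (boolP (v \in g)) => //= vg.
    by rewrite (subsetP (tr_sub r5 tz)).
  by rewrite -setI_eq0; apply/eqP/setP => v; rewrite !inE; case: (v \in g).
rewrite -mulr_suml mulrC ler_wpM2l //.
apply: le_trans (_ : esum (old_weight O) 2 <= _).
  apply: ler_sum_pred => [g _|g /pairs_card ->//]; exact: prodr_ge0.
apply: le_trans (_ : esum (old_weight O) 2 * 2`!%:R <= _).
  by rewrite ler_peMr ?ler1n // sumr_ge0 // => g _; apply: prodr_ge0.
by apply: le_trans (esum_le 2 w0) _; rewrite lerXn2r // nnegrE.
Qed.

(** The last tree is peeled off. Given the earlier part, the sum over all trees that may follow is
    at most [q] by [rooted_sum]. *)
Lemma scr_sum_step b : scr_sum b.+1 <= q * all_scr_sum b.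
Proof.
pose I : finType := (('I_b * vf) * ({set T} * triple))%type.
pose th' (i : I) : nat := (i.1.1 + (1 + #|i.2.2.2| + #|i.2.2.1.1|))%N.
pose P (i : I) := [&& is_scr i.1.1 i.1.2, i.2.1 \in pairs setT, is_tr r i.2.1 N i.2.2 &
  (th' i < b.+1)%N].
pose h (i : I) : 'I_b.+1 * vf :=
  (inord (th' i), (i.1.2.1 :|: i.2.2.1.1, i.1.2.2 :|: i.2.2.1.2)).
apply: le_trans (@sum_cover R I ('I_b.+1 * vf)%type (fun j => is_scr j.1 j.2 && (0 < j.1)%N) P h
   (fun j => swt j.1 j.2) _ _) _.
- by move=> i _; apply: swt_ge0.
- move=> [th [V F]] /= /andP[/andP[/asboolP /= s VN] th0].
  have [[E _]|[t0 [V0 [F0 [g [V1 [F1 [P1 [s0 t1 [E VE FE]]]]]]]]]] := scr_inv s.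
    by rewrite E in th0.
  have lt0 : (t0 < b)%N by rewrite -ltnS; apply: leq_ltn_trans (ltn_ord th); rewrite E; lia.
  exists (Ordinal lt0, (V0, F0), (g, (V1, F1, P1))).
    rewrite /P /is_scr /is_tr /th' /=; apply/and4P; split.
    + apply/andP; split; first exact/asboolP.
      by apply: leq_trans VN; rewrite VE subset_leq_card // subsetUl.
    + by apply: pairsP (subsetT _) (tr_card2 r5 t1).
    + apply/andP; split; first exact/asboolP.
      by apply: leq_trans VN; rewrite VE subset_leq_card // subsetUr.
    + by rewrite -E ltn_ord.
  rewrite /h /th' /= -E -VE -FE; congr (_, _); apply: val_inj; rewrite /= inordK //.
have -> : \sum_(i | P i) swt (h i).1 (h i).2 =
  \sum_(i | P i) swt i.1.1 i.1.2 * (y * ((\prod_(v in i.2.2.1.1) old_weight i.1.2.1 v) * y ^+ #|i.2.2.2|)).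
  apply: eq_bigr => -[[t0 [V0 F0]] [g [[V1 F1] P1]]] /and4P[/andP[/asboolP /= s0 _] _ _ lt].
  rewrite /swt /= inordK // old_weight_prod /th' /=.
  have [lt0 _] := scr_lt r5 s0; have V0t : (#|V0| <= t0)%N by apply: leq_trans lt0; apply: leq_addr.
  have cU : #|V0 :|: V1| = (#|V0| + #|V1 :\: V0|)%N.
    by rewrite -(cardsID V0 (V0 :|: V1)) setUK setDUl setDv set0U.
  have c1 := cardsID V0 V1.
  (* The excess grows by one for the tree, by its free leaves and by its old vertices. *)
  have -> : (t0 + (1 + #|P1| + #|V1|) - #|V0 :|: V1| =
     (t0 - #|V0|) + (1 + (#|V1 :&: V0| + #|P1|)))%N.
    rewrite cU -c1; move: V0t; move: #|V1 :&: V0| #|V1 :\: V0| #|V0| #|P1|; clear; lia.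
  rewrite cU !exprD expr1.
  move: (y ^+ (_ - _)%N) (y ^+ #|V1 :&: V0|) (y ^+ #|P1|) (x ^+ #|V0|) (x ^+ #|V1 :\: V0|) => *.
  by ring.
apply: le_trans (_ : \sum_(i : I | is_scr i.1.1 i.1.2 && ((i.2.1 \in pairs setT) && is_tr r i.2.1 N i.2.2))
   swt i.1.1 i.1.2 * (y * ((\prod_(v in i.2.2.1.1) old_weight i.1.2.1 v) * y ^+ #|i.2.2.2|)) <= _).
  apply: ler_sum_pred => [i _|i /and4P[-> -> ->]//].
  rewrite !mulr_ge0 ?exprn_ge0 ?swt_ge0 // prodr_ge0 // => v _; exact: old_weight_ge0.
rewrite -(pair_big_dep (fun j : 'I_b * vf => is_scr j.1 j.2)
   (fun _ k => (k.1 \in pairs setT) && is_tr r k.1 N k.2)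
   (fun j k => swt j.1 j.2 * (y * ((\prod_(v in k.2.1.1) old_weight j.2.1 v) * y ^+ #|k.2.2|)))) /=.
rewrite /all_scr_sum mulr_sumr; apply: ler_sum => j /andP[_ VN].
rewrite -mulr_sumr mulrC ler_wpM2r ?swt_ge0 // -mulr_sumr ler_wpM2l //.
apply: le_trans (rooted_sum VN).
by rewrite -(pair_big_dep (fun g => g \in pairs setT) (fun g z => is_tr r g N z)
  (fun g z => (\prod_(v in z.1.1) old_weight j.2.1 v) * y ^+ #|z.2|)).
Qed.

Lemma all_scr_sum_le b : all_scr_sum b <= 1 + scr_sum b.
Proof.
rewrite /all_scr_sum (bigID (fun i : 'I_b * vf => (0 < i.1)%N)) /= addrC lerD2r.
case: b => [|b]; first by rewrite big1 // => -[[]].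
rewrite [leRHS](_ : _ = swt 0 (set0, set0)); last by rewrite /swt /= cards0 !expr0 mulr1.
rewrite [leLHS]big_mkcond /= (bigD1 (ord0, (set0, set0))) //= big1 ?addr0.
  by case: ifP => // _; apply: swt_ge0.
move=> [th [V F]] ne; case: ifP => //= /andP[/andP[/asboolP /= s _]]; rewrite -eqn0Ngt => /eqP th0.
case/negP: ne; have [[_ [-> ->]]|[t0 [V0 [F0 [g [V1 [F1 [P1 [_ _ [E _ _]]]]]]]]]] := scr_inv s.
  by rewrite !xpair_eqE !eqxx !andbT; apply/eqP/val_inj.
by move: E; rewrite th0 => /eqP; rewrite eq_sym !addn_eq0 /= andbF.
Qed.

(** The recursion s <= q (1 + s) stays below 2 q because q <= 1/2. *)
Lemma scr_sum_le b : scr_sum b <= 2 * q.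
Proof.
have s0 := sigma_ge0; have q0 : 0 <= q by rewrite !mulr_ge0 ?exprn_ge0.
elim: b => [|b IH]; first by rewrite /scr_sum big1 ?mulr_ge0 // => -[[]].
apply: le_trans (scr_sum_step b) _; rewrite mulrC ler_wpM2r //.
apply: le_trans (all_scr_sum_le b) _.
have : scr_sum b <= 1 by apply: le_trans IH _; rewrite -ler_pdivlMl ?mulr1.
lra.
Qed.

End ScriptSums.

(** * Random edge sets *)

Section RandomSet.
Local Open Scope ring_scope.
Variables (R : realFieldType) (X : finType) (K : {set X}) (p : R).
Hypotheses (p0 : 0 <= p) (p1 : p <= 1).
Implicit Types (G F : {set X}) (A : {set X} -> bool) (f g : {set X} -> R).

Definition gw G : R := p ^+ #|G| * (1 - p) ^+ (#|K| - #|G|).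
Definition EX f : R := \sum_(G : {set X} | G \subset K) gw G * f G.
Definition Pr A : R := \sum_(G : {set X} | (G \subset K) && A G) gw G.

Lemma gw_ge0 G : 0 <= gw G.
Proof. by rewrite mulr_ge0 ?exprn_ge0 // subr_ge0. Qed.

Lemma PrE A : Pr A = EX (fun G => (A G)%:R).
Proof.
by rewrite /Pr /EX big_mkcondr /=; apply: eq_bigr => G _; case: (A G); rewrite ?mulr1 ?mulr0.
Qed.

Lemma EX_le f g : (forall G, G \subset K -> f G <= g G) -> EX f <= EX g.
Proof. by move=> fg; apply: ler_sum => G GK; rewrite ler_wpM2l ?gw_ge0 // fg. Qed.

Lemma EXD f g : EX (fun G => f G + g G) = EX f + EX g.
Proof. by rewrite /EX -big_split /=; apply: eq_bigr => G _; rewrite mulrDr. Qed.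

Lemma EXZ c f : EX (fun G => c * f G) = c * EX f.
Proof. by rewrite /EX mulr_sumr; apply: eq_bigr => G _; rewrite mulrCA. Qed.

Lemma EX_sum (I : finType) (Q : pred I) (f : I -> {set X} -> R) :
  EX (fun G => \sum_(i | Q i) f i G) = \sum_(i | Q i) EX (f i).
Proof. by rewrite /EX exchange_big /=; apply: eq_bigr => G _; rewrite mulr_sumr. Qed.

(** The product of all [a i + b i] expands into a sum over the sets G that use the factors [a]
    inside and [b] outside. Setting [b i] = 0 on F forces F into G, and [a i] = 0 off K keeps G
    inside K. *)
Lemma EX_sub F : F \subset K -> EX (fun G => (F \subset G)%:R) = p ^+ #|F|.
Proof.
move=> FK.
pose a i : R := if i \in K then p else 0.
pose b i : R := if i \in F then 0 else if i \in K then 1 - p else 1.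
have <- : \prod_i (a i + b i) = p ^+ #|F|.
  rewrite (bigID (mem F)) /= [X in _ * X]big1 ?mulr1; last first.
    by move=> i niF; rewrite /a /b (negbTE niF); case: ifP => _; rewrite ?subrKC ?add0r.
  rewrite -prodr_const; apply: eq_bigr => i iF.
  by rewrite /a /b iF (subsetP FK) // addr0.
rewrite bigA_distr /EX big_mkcond /=; apply: eq_bigr => G _.
case: ifP => GK; last first.
  have [i iG niK] := subsetPn (negbT GK).
  by rewrite (bigD1 i) //= iG /a (negbTE niK) mul0r.
have [FG|/subsetPn[i iF niG]] := boolP (F \subset G); last first.
  by rewrite mulr0 (bigD1 i) //= (negbTE niG) /b iF mul0r.
rewrite mulr1 /gw (bigID (mem G)) /= -prodr_const; congr (_ * _).
  by apply: eq_bigr => i iG; rewrite iG /a (subsetP GK).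
rewrite (bigID (mem K)) /= [X in _ = _ * X]big1 ?mulr1; last first.
  move=> i /andP[niG niK]; rewrite (negbTE niG) /b (negbTE niK).
  by case: ifP => // iF; rewrite (subsetP FK i iF) in niK.
rewrite (eq_bigr (fun _ => 1 - p)); last first.
  move=> i /andP[niG iK]; rewrite (negbTE niG) /b iK; case: ifP => // iF.
  by rewrite (subsetP FG i iF) in niG.
rewrite prodr_const; congr (_ ^+ _); rewrite -(cardsID G K) (setIidPr GK) addKn.
by apply: eq_card => i; rewrite !inE.
Qed.

Lemma EX_const c : EX (fun=> c) = c.
Proof.
have := EX_sub (sub0set K); rewrite cards0 expr0 => e1.
rewrite -[RHS]mulr1 -e1 -EXZ; apply: eq_bigr => G _; by rewrite sub0set mulr1.
Qed.

Lemma Pr_ge0 A : 0 <= Pr A.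
Proof. by apply: sumr_ge0 => G _; apply: gw_ge0. Qed.

Lemma Pr_EX A f : (forall G, G \subset K -> 0 <= f G) ->
  (forall G, G \subset K -> A G -> 1 <= f G) -> Pr A <= EX f.
Proof.
move=> f0 fA; rewrite PrE; apply: EX_le => G GK.
by have := fA G GK; case: (A G) => [h|_]; [exact: h | exact: f0].
Qed.

Lemma Pr_sub A (B : {set X} -> bool) : (forall G, G \subset K -> A G -> B G) -> Pr A <= Pr B.
Proof.
move=> AB; rewrite !PrE; apply: EX_le => G GK.
by have := AB G GK; case: (A G) => [h|_]; rewrite ?h ?ler0n.
Qed.

Lemma Pr_or A (B : {set X} -> bool) : Pr (fun G => A G || B G) <= Pr A + Pr B.
Proof.
rewrite !PrE -EXD; apply: EX_le => G _; case: (A G); case: (B G) => /=; rewrite ?addr0 ?add0r //.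
by rewrite lerDl.
Qed.

Lemma union_bound (I : finType) (Q : pred I) (F : I -> {set X}) A :
  (forall i, Q i -> F i \subset K) ->
  (forall G, G \subset K -> A G -> exists2 i, Q i & F i \subset G) ->
  Pr A <= \sum_(i | Q i) p ^+ #|F i|.
Proof.
move=> FK hA; rewrite -(eq_bigr _ (fun i Qi => EX_sub (FK i Qi))) -EX_sum; apply: Pr_EX.
  by move=> G _; apply: sumr_ge0.
move=> G GK /(hA G GK)[i Qi FG]; rewrite (bigD1 i) //= FG lerDl.
by apply: sumr_ge0.
Qed.

Lemma markov A f c : 0 < c -> (forall G, G \subset K -> 0 <= f G) ->
  (forall G, G \subset K -> A G -> c <= f G) -> Pr A <= EX f / c.
Proof.
move=> c0 f0 fA; rewrite mulrC -EXZ; apply: Pr_EX => G GK.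
  by rewrite mulr_ge0 ?f0 // invr_ge0 ltW.
by move=> AG; rewrite mulrC ler_pdivlMr // mul1r fA.
Qed.

End RandomSet.

(** * Density of subgraphs of a tree *)

Section Density.
Variables (T : finType) (r : nat).
Hypothesis r5 : 4 < r.
Implicit Types (V W S U A : {set T}) (e f g h p : {set T}) (E F P Q : {set {set T}}).
Local Notation tr := (@tr T r).
Local Notation alpha := (r - 2).
Local Notation beta := ('C(r, 2) - 2).

Lemma alpha_lt_beta : alpha < beta.
Proof.
have := twice_bin2 r; have := r5; case: r => // k; rewrite /= => k4; nia.
Qed.

(** By convexity only extreme values of a = |S ∩ U| matter. If f lies in U it is subtracted from the
    pairs, and among a = 2 and a = r equality holds at r alone. If not, a is at most r - 1, and
    equality holds at 2 alone. *)
Lemma clique_density S f U : #|S| = r -> f \in pairs S -> 2 <= #|S :&: U| ->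
  alpha * #|ins (pairs S :\ f) U| <= beta * (#|S :&: U| - 2) + alpha /\
  (beta * (#|S :&: U| - 2) + alpha <= alpha * #|ins (pairs S :\ f) U| ->
    S \subset U \/ (#|S :&: U| = 2 /\ ~~ (f \subset U))).
Proof.
move=> S_r fS a2; rewrite (node_card_ins fS).
have leS : #|S :&: U| <= r by rewrite -S_r subset_leq_card // subsetIl.
have SU : #|S :&: U| = r -> S \subset U.
  by move=> E; apply/setIidPl/eqP; rewrite eqEcard subsetIl E S_r leqnn.
have fU : #|S :&: U| = r -> f \subset U by move/SU; apply: subset_trans (pairs_sub fS).
have := twice_bin2 #|S :&: U|; have := twice_bin2 r.
move: a2 leS SU fU; move: #|S :&: U| => a a2 ar SU fU rE aE.
have [j jE] : exists j, r = a + j by exists (r - a); lia.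
have [b bE] : exists b, a = b.+2 by exists (a - 2); lia.
have {}rE : 2 * beta + 2 = (b + j) * (b + j + 3).
  by move: rE jE bE r5; clear; case: r => // -[|k]; nia.
have {}aE : 2 * 'C(a, 2) = b * (b + 3) + 2 by move: aE; rewrite bE /=; clear; nia.
have al : alpha = b + j by lia.
have bj : 3 <= b + j by lia.
have r4 := r5; rewrite al (_ : a - 2 = b) ?bE //; last by lia.
rewrite -bE; case fUE: (f \subset U) => /=.
  split; first by move: rE aE bj; clear; move: beta 'C(a, 2) => B N; nia.
  move=> h; left; apply: SU; suff : j = 0 by lia.
  by move: h rE aE bj; clear; move: beta 'C(a, 2) => B N; nia.
have j0 : 0 < j by case: (posnP j) => // j0; have := fU; rewrite fUE jE j0 addn0 => /(_ erefl).
rewrite subn0; split; first by move: rE aE bj j0; clear; move: beta 'C(a, 2) => B N; case: j => // j; nia.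
move=> h; right; split => //; rewrite bE; suff : b = 0 by lia.
by move: h rE aE bj j0; clear; move: beta 'C(a, 2) => B N; case: j => // j; case: b => // b; nia.
Qed.


Lemma tr_density f V F P : tr f V F P -> forall U, bound alpha beta #|ins F U| #|V :&: U|.
Proof.
have ab := ltnW alpha_lt_beta.
have leaf g (Q : {set {set T}}) U : #|g| = 2 -> Q \subset [set g] -> bound alpha beta #|ins Q U| #|g :&: U|.
  move=> g2 Qg; rewrite /bound; case: ltnP => gU.
    rewrite (_ : ins Q U = set0) ?cards0 ?muln0 //; apply/setP => p; rewrite !inE; apply/negP.
    move=> /andP[/(subsetP Qg)/set1P -> gsub]; by rewrite (setIidPl gsub) g2 in gU.
  apply: leq_trans (leq_addl _ _); rewrite -[leqRHS]muln1 leq_mul2l; apply/orP; right.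
  rewrite -(cards1 g) subset_leq_card //; apply: subset_trans Qg; apply/subsetP => p.
  by rewrite inE => /andP[].
elim=> {f V F P} [f f2|f f2|f S V F P S_r fS tg IH VS VV] U; [exact: leaf|by apply: leaf; rewrite ?sub0set|].
apply: (node_bound r5 S_r fS VS VV ab) => [g /tg/tr_leaves[]//|g gS|a2]; first exact: IH.
by have [] := clique_density S_r fS a2.
Qed.

Section Node.
Variables (f S : {set T}) (V : {set T} -> {set T}) (F P : {set T} -> {set {set T}}).
Hypotheses (S_r : #|S| = r) (fS : f \in pairs S).
Hypothesis tg : forall g, g \in pairs S :\ f -> tr g (V g) (F g) (P g).
Hypothesis VS : forall g, g \in pairs S :\ f -> V g :&: S = g.
Hypothesis VV : forall g h, g \in pairs S :\ f -> h \in pairs S :\ f -> g != h ->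
  V g :&: V h \subset S.
Let C := pairs S :\ f.
Let VN := \bigcup_(g in pairs S :\ f) V g.
Let FN := \bigcup_(g in pairs S :\ f) F g.

Let FV g : g \in pairs S :\ f -> F g \subset pairs (V g).
Proof. by move=> /tg/tr_leaves[]. Qed.

Let g2 g : g \in pairs S :\ f -> #|g| = 2.
Proof. by case/setD1P => _ /pairs_card. Qed.

Let gV U g : g \in pairs S :\ f -> #|g :&: U| <= #|V g :&: U|.
Proof. by move=> gS; apply/subset_leq_card/setSI/(node_root_sub VS). Qed.

(** With the clique inside [U] the bounds of the children add up to the bound of the node, so each
    of them is attained. *)
Lemma tight_root U : S \subset U -> 
  beta * (#|VN :&: U| - 2) + alpha <= alpha * #|ins FN U| ->
  forall g, g \in pairs S :\ f -> beta * (#|V g :&: U| - 2) + alpha <= alpha * #|ins (F g) U|.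
Proof.
move=> SU tight g gS.
have gU h : h \in pairs S :\ f -> #|h :&: U| = 2.
  move=> hS; rewrite (setIidPl _) ?g2 //; apply: subset_trans SU.
  by case/setD1P: hS => _ /pairs_sub.
have dens h : h \in pairs S :\ f -> alpha * #|ins (F h) U| <= beta * (#|V h :&: U| - 2) + alpha.
  move=> hS; have := tr_density (tg hS) U; by rewrite /bound ltnNge (_ : (1 < _) = true) //; rewrite -(gU h hS) gV.
move: tight; rewrite /VN /FN (node_ins VS VV U FV) (node_card r5 U S_r fS VS VV) (setIidPl SU) S_r.
rewrite (big_setD1 g) //= (big_setD1 (A := pairs S :\ f) g) //= (gU g gS).
have : alpha * \sum_(h in (pairs S :\ f) :\ g) #|ins (F h) U| <=
   beta * \sum_(h in (pairs S :\ f) :\ g) (#|V h :&: U| - #|h :&: U|) + alpha * ('C(r, 2) - 2).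
  rewrite [X in _ + alpha * X](_ : _ = #|(pairs S :\ f) :\ g|); last first.
    by have := cardsD1 g (pairs S :\ f); rewrite gS (card_root_out S_r fS); move: #|_|; clear; lia.
  rewrite -sum1_card !big_distrr -big_split /=; apply: leq_sum => h /setD1P[_ hS].
  by rewrite (gU h hS) // muln1 dens.
move: (\sum_(h in _) _) (\sum_(h in _) _) #|V g :&: U| #|ins (F g) U| r5; clear.
move: ('C(r, 2) - 2) => b x y u w r5; nia.
Qed.

(** Some child g has two vertices in [U], and the roots of the others have at most one there. Since
    alpha < beta, such a child loses density with every further vertex, so a tight [U] meets the
    tree only inside the child g. *)
Lemma tight_out U : ~~ (f \subset U) -> 2 <= #|VN :&: U| ->
  beta * (#|VN :&: U| - 2) + alpha <= alpha * #|ins FN U| ->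
  exists2 g, g \in pairs S :\ f & VN :&: U \subset V g.
Proof.
move=> nfU u2 tight; have ab := alpha_lt_beta.
have dens h : h \in pairs S :\ f -> bound alpha beta #|ins (F h) U| #|V h :&: U|.
  by move=> hS; apply: tr_density (tg hS) U.
have [g gS [gu gh]] : exists2 g, g \in pairs S :\ f & 2 <= #|V g :&: U| /\
    forall h, h \in pairs S :\ f -> h != g -> #|h :&: U| <= 1.
  have [a2|a1] := leqP 2 #|S :&: U|.
    have [_ h] := clique_density S_r fS a2.
    have [/= au leR] := node_bound0 r5 S_r fS VS VV (ltnW ab) FV dens (U := U).
    case: h => [|SU|[aE _]].
    - move: tight leR au a2; rewrite -/VN -/FN; move: #|VN :&: U| #|S :&: U| #|ins FN U| #|ins _ _|.
      clear; move: alpha beta => a b u k x y; have e : u - 2 = (u - k) + (k - 2) \/ u < k \/ k < 2 by lia.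
      move=> tight leR ku k2; case: e => [e|[|]]; [|lia|lia].
      by move: tight; rewrite e mulnDr -addnA => /leq_trans/(_ leR); rewrite leq_add2l.
    - by case/negP: nfU; apply: subset_trans SU; apply: pairs_sub.
    have gS : S :&: U \in pairs S :\ f.
      rewrite in_setD1 pairsP ?subsetIl ?andbT //; apply: contra nfU => /eqP <-; exact: subsetIr.
    exists (S :&: U) => //; split.
      by rewrite -aE; apply/subset_leq_card; rewrite subsetI subsetIr (node_root_sub VS).
    move=> h hS ne; rewrite leqNgt; apply/negP => h2; case/eqP: ne.
    have hE : h :&: U = h by apply/eqP; rewrite eqEcard subsetIl g2.
    apply: pair_eq => //; first exact: g2.
    by rewrite -hE setSI //; case/setD1P: hS => _ /pairs_sub.
  have [/existsP[g /andP[gS u2']]|/existsPn no2] :=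
      boolP [exists g in pairs S :\ f, 2 <= #|V g :&: U|].
    exists g => //; split => // h hS _; apply: leq_trans (_ : #|S :&: U| <= _); last by rewrite -ltnS.
    by apply/subset_leq_card/setSI; case/setD1P: hS => _ /pairs_sub.
  move: tight; rewrite /FN (node_ins VS VV U FV) big_distrr /= [X in _ <= X -> _]big1.
    by have := r5; move: (beta * _); clear; lia.
  move=> g gS.
  have := no2 g; rewrite gS /= => u2'; have := dens g gS; rewrite /bound ltnNge u2' /=.
  by rewrite leqn0 => /eqP.
have child h : h \in pairs S :\ f -> h != g ->
    alpha * #|ins (F h) U| <= beta * (#|V h :&: U| - #|h :&: U|) /\
   (#|h :&: U| < #|V h :&: U| -> alpha * #|ins (F h) U| < beta * (#|V h :&: U| - #|h :&: U|)).
  move=> hS ne; have := dens h hS; have := gh h hS ne; rewrite /bound.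
  move: #|ins _ _| #|V h :&: U| #|h :&: U| ab; clear.
  move: alpha beta => a b x u k ab; case: ltnP; nia.
have densg := dens g gS; rewrite /bound ltnNge gu /= in densg.
have bg : #|g :&: U| <= #|S :&: U|.
  by apply/subset_leq_card/setSI; case/setD1P: gS => _ /pairs_sub.
have gV1 := gV U gS.
have uE : #|VN :&: U| = #|S :&: U| + (#|V g :&: U| - #|g :&: U| +
   \sum_(h in (pairs S :\ f) :\ g) (#|V h :&: U| - #|h :&: U|)).
  by rewrite (node_card r5 U S_r fS VS VV) (big_setD1 g).
have RE : #|ins FN U| = #|ins (F g) U| + \sum_(h in (pairs S :\ f) :\ g) #|ins (F h) U|.
  by rewrite /FN (node_ins VS VV U FV) (big_setD1 g).
have le (B : {set {set T}}) : B \subset (pairs S :\ f) :\ g ->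
    alpha * \sum_(h in B) #|ins (F h) U| <= beta * \sum_(h in B) (#|V h :&: U| - #|h :&: U|).
  move=> BC; rewrite !big_distrr /=; apply: leq_sum => h /(subsetP BC)/setD1P[ne hS].
  by case: (child h hS ne).
have b0 : 0 < beta by apply: leq_ltn_trans ab.
have noext h : h \in pairs S :\ f -> h != g -> #|V h :&: U| <= #|h :&: U|.
  move=> hS ne; rewrite leqNgt; apply/negP => lt.
  have hC : h \in (pairs S :\ f) :\ g by apply/setD1P.
  have := le _ (subD1set _ h).
  move: tight; rewrite uE RE (big_setD1 h) //= (big_setD1 (A := (pairs S :\ f) :\ g) h) //=.
  have := (child h hS ne).2 lt; move: densg bg gV1 gu b0; rewrite -!/(_ < _).
  move: (\sum_(h in _) _) (\sum_(h in _) _) (#|V h :&: U| - _) #|ins (F h) U|.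
  move: #|V g :&: U| #|ins (F g) U| #|g :&: U| #|S :&: U|; clear.
  move: alpha beta => a b vg xg k s X Y z w densg bg gV1 gu b0 lt.
  have -> : s + (vg - k + (z + Y)) - 2 = (s - k) + (vg - 2) + z + Y by lia.
  rewrite !mulnDr; nia.
have aE : #|S :&: U| <= #|g :&: U|.
  have := le _ (subxx _); move: tight; rewrite uE RE; move: densg bg gV1 gu b0.
  move: (\sum_(h in _) _) (\sum_(h in _) _).
  move: #|V g :&: U| #|ins (F g) U| #|g :&: U| #|S :&: U|; clear.
  move: alpha beta => a b vg xg k s X Y densg bg gV1 gu b0.
  have -> : s + (vg - k + Y) - 2 = (s - k) + (vg - 2) + Y by lia.
  rewrite !mulnDr => tight LE; suff : s - k = 0 by lia.
  nia.
have gUS : S :&: U \subset V g.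
  have sub : g :&: U \subset S :&: U by apply: setSI; case/setD1P: gS => _ /pairs_sub.
  have -> : S :&: U = g :&: U by apply/esym/eqP; rewrite eqEcard sub.
  by apply: subset_trans (subsetIl _ _) (node_root_sub VS gS).
exists g => //; apply/subsetP => v /setIP[/bigcupP[h hS vh] vU].
have [hg|ne] := eqVneq h g; first by rewrite -hg.
apply: (subsetP gUS); rewrite inE vU andbT.
have hE : h :&: U = V h :&: U by apply/eqP; rewrite eqEcard noext // andbT setSI // (node_root_sub VS).
have : v \in h :&: U by rewrite hE inE vh vU.
by rewrite inE => /andP[vh' _]; case/setD1P: hS => _ /pairs_sub/subsetP; apply.
Qed.

End Node.

Lemma tr_tight f V F P : tr f V F P -> forall U, f \subset U ->
  beta * (#|V :&: U| - 2) + alpha <= alpha * #|ins F U| -> V \subset U.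
Proof.
elim=> {f V F P} [f f2|f f2|f S V F P S_r fS tg IH VS VV] U fU // tight.
have a2 : 2 <= #|S :&: U|.
  by rewrite -(pairs_card fS) subset_leq_card // subsetI (pairs_sub fS).
have SU : S \subset U.
  have [_ h] := clique_density S_r fS a2.
  have FV g : g \in pairs S :\ f -> F g \subset pairs (V g) by move=> /tg/tr_leaves[].
  have dens g : g \in pairs S :\ f -> bound alpha beta #|ins (F g) U| #|V g :&: U|.
    by move=> gS; apply: tr_density (tg g gS) U.
  have [/= au leR] := node_bound0 r5 S_r fS VS VV (ltnW alpha_lt_beta) FV dens.
  case: h => [|//|[_]]; last by rewrite fU.
  move: tight leR au a2.
  move: #|(\bigcup_(g in pairs S :\ f) V g) :&: U| #|S :&: U| #|ins (\bigcup_(g in pairs S :\ f) F g) U| #|ins _ _|.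
  clear; move: alpha beta => a b u k x y; have e : u - 2 = (u - k) + (k - 2) \/ u < k \/ k < 2 by lia.
      move=> tight leR ku k2; case: e => [e|[|]]; [|lia|lia].
      by move: tight; rewrite e mulnDr -addnA => /leq_trans/(_ leR); rewrite leq_add2l.
apply/bigcupsP => g gS; apply: IH => //.
  by apply: subset_trans SU; case/setD1P: gS => _ /pairs_sub.
exact: (tight_root S_r fS tg VS VV SU tight).
Qed.

End Density.

(** * A tree is determined by its vertices and leaves *)

Section Unique.
Variables (T : finType) (r : nat).
Hypothesis r5 : 4 < r.
Implicit Types (U : {set T}) (e f g h p : {set T}).
Local Notation tr := (@tr T r).
Local Notation alpha := (r - 2).
Local Notation beta := ('C(r, 2) - 2).

Definition node f (S : {set T}) (V : {set T} -> {set T}) (F : {set T} -> {set {set T}}) : Prop :=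
  [/\ #|S| = r, f \in pairs S, forall g, g \in pairs S :\ f -> tr g (V g) (F g) set0,
   forall g, g \in pairs S :\ f -> V g :&: S = g &
   forall g h, g \in pairs S :\ f -> h \in pairs S :\ f -> g != h -> V g :&: V h \subset S].

Lemma pure_card f V F : tr f V F set0 -> alpha * #|F| = beta * (#|V| - 2) + alpha.
Proof.
move=> t; have [_] := tr_count r5 t; have [fV f2] := tr_root r5 t.
have := subset_leq_card fV; rewrite f2 cards0 addn0.
by move: #|F| #|V| alpha beta; clear => x [|[|v]] a b //= _; rewrite !subSS subn0; nia.
Qed.

Lemma ins_id (V : {set T}) (F : {set {set T}}) : F \subset pairs V -> ins F V = F.
Proof.
move=> FV; apply/setP => p; rewrite inE; case: (boolP (p \in F)) => //= /(subsetP FV).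
exact: pairs_sub.
Qed.

Lemma insS (F F' : {set {set T}}) U : F \subset F' -> ins F U \subset ins F' U.
Proof. by move=> /subsetP FF; apply/subsetP => p; rewrite !inE => /andP[/FF-> ->]. Qed.

Section Two.
Variables (f S S' : {set T}) (V V' : {set T} -> {set T}) (F F' : {set T} -> {set {set T}}).
Hypotheses (nd : node f S V F) (nd' : node f S' V' F').
Let VN := \bigcup_(g in pairs S :\ f) V g.
Let FN := \bigcup_(g in pairs S :\ f) F g.
Let VN' := \bigcup_(g in pairs S' :\ f) V' g.
Let FN' := \bigcup_(g in pairs S' :\ f) F' g.
Hypotheses (eqV : VN = VN') (eqF : FN = FN').

Lemma node_child_sub g : g \in pairs S :\ f -> exists2 h, h \in pairs S' :\ f & V g \subset V' h.
Proof.
move=> gS; case: nd => S_r fS tg VS VV; case: nd' => S1_r fS1 tg1 VS1 VV1.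
have g2 : #|g| = 2 by case/setD1P: gS => _ /pairs_card.
have VgN : VN' :&: V g = V g by rewrite -eqV; apply/setIidPr/(bigcup_sup g).
have gV : 2 <= #|V g| by rewrite -g2 subset_leq_card // (tr_sub r5 (tg g gS)).
have [||| h hS] := tight_out r5 S1_r fS1 tg1 VS1 VV1 (U := V g).
- apply/negP => fV; have fg : f \subset g by rewrite -(VS g gS) subsetI fV (pairs_sub fS).
  by case/setD1P: gS => /eqP ne _; case: ne; rewrite (pair_eq (pairs_card fS) g2 fg).
- by rewrite -/VN' VgN.
- rewrite -/VN' VgN -/FN' -eqF -(pure_card (tg g gS)) leq_mul2l; apply/orP; right.
  rewrite -{1}(ins_id (tr_leaves (tg g gS)).1) subset_leq_card // insS //.
  exact: (bigcup_sup g).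
by rewrite -/VN' VgN; exists h.
Qed.

Lemma node_leaves g : g \in pairs S :\ f -> F g = ins FN (V g).
Proof.
move=> gS; case: nd => S_r fS tg VS VV; have gF := (tr_leaves (tg g gS)).1.
apply/eqP; rewrite eqEcard -{1}(ins_id gF) insS ?(bigcup_sup g) //=.
have tN : tr f VN FN set0.
  have := TrN S_r fS tg VS VV; rewrite (_ : \bigcup_(g in _) set0 = set0) //.
  by apply: big1.
have := tr_density r5 tN (V g); rewrite (setIidPr (bigcup_sup g gS)) /bound.
have gV : 2 <= #|V g|.
  by have [gV <-] := tr_root r5 (tg g gS); apply: subset_leq_card.
rewrite ltnNge gV /= -(pure_card (tg g gS)) leq_mul2l => /orP[/eqP r2|//].
by move: r5 r2; clear; lia.
Qed.

End Two.

(** Passing to the second decomposition and back puts V g into some V g'. For g' different from g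
    this would place V g inside the clique, so V g = g would be a pair contained in g'. *)
Lemma node_child_eq f (S S1 : {set T}) V V1 F F1 : node f S V F -> node f S1 V1 F1 ->
  \bigcup_(g in pairs S :\ f) V g = \bigcup_(g in pairs S1 :\ f) V1 g ->
  \bigcup_(g in pairs S :\ f) F g = \bigcup_(g in pairs S1 :\ f) F1 g ->
  forall g, g \in pairs S :\ f -> exists2 h, h \in pairs S1 :\ f & V g = V1 h.
Proof.
move=> nd nd' eqV eqF g gS; have [h hS gh] := node_child_sub nd nd' eqV eqF gS.
have [g' gS' hg] := node_child_sub nd' nd (esym eqV) (esym eqF) hS.
exists h => //; apply/eqP; rewrite eqEsubset gh /=; case: nd => S_r fS tg VS VV.
suff <- : g' = g by [].
apply/eqP/negP => /negP ne.
have sub : V g \subset V g' by apply: subset_trans hg.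
have gVS : V g \subset S by have := VV g g' gS gS'; rewrite (setIidPl sub) eq_sym; apply.
have gE : V g = g by rewrite -(setIidPl gVS) VS.
have gg' : g \subset g' by rewrite -(VS g' gS') subsetI -gE sub.
case/eqP: ne; apply/esym/pair_eq => //; [case/setD1P: gS|case/setD1P: gS'] => _ /pairs_card //.
Qed.

Lemma node_clique_sub f (S S1 : {set T}) V V1 F F1 : node f S V F -> node f S1 V1 F1 ->
  \bigcup_(g in pairs S :\ f) V g = \bigcup_(g in pairs S1 :\ f) V1 g ->
  \bigcup_(g in pairs S :\ f) F g = \bigcup_(g in pairs S1 :\ f) F1 g -> S \subset S1.
Proof.
move=> nd nd' eqV eqF; have ch := node_child_eq nd nd' eqV eqF.
case: nd => S_r fS tg VS VV; case: nd' => S1_r fS1 tg1 VS1 VV1.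
apply/subsetP => x xS; have S3 : 2 < #|S| by rewrite S_r; move: r5; clear; lia.
have [g gS xg] := pair_avoid S3 fS xS.
(* Since r >= 5, some y in S avoids the at most four vertices of g and f. Then x is common to the
   children at g and at {x, y}, and distinct children of the second decomposition meet only in its
   clique. *)
have [y [yS yx ygf]] : exists y, [/\ y \in S, y != x & y \notin g :|: f].
  have : 0 < #|S :\: (x |: (g :|: f))|.
    have gp : #|g| = 2 by case/setD1P: gS => _ /pairs_card.
    have fp := pairs_card fS.
    have := cardsD S (x |: (g :|: f)).
    have : #|S :&: (x |: (g :|: f))| <= 4.
      apply: leq_trans (subset_leq_card (subsetIr _ _)) _.
      rewrite (setUidPr _) ?sub1set ?inE ?xg //.
      by apply: leq_trans (leq_card_setU g f) _; rewrite gp fp.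
    by rewrite S_r; move: r5; move: #|_| #|_|; clear; lia.
  by case/card_gt0P => y; rewrite !inE !negb_or => /andP[/and3P[yx yg yf] yS]; exists y; rewrite !inE negb_or yg yf.
have hS : [set x; y] \in pairs S :\ f.
  rewrite in_setD1 set2_pairs // 1?eq_sym // andbT; apply/eqP => E; move: ygf.
  by rewrite E !inE eqxx !orbT.
have gh : g != [set x; y].
  by apply/eqP => E; move: ygf; rewrite E !inE eqxx !orbT.
have [g' gS' gE] := ch g gS; have [h' hS' hE] := ch _ hS.
have ng : g' != h'.
  apply: contra gh => /eqP E; rewrite -(VS g gS) -(VS _ hS) gE hE E //.
apply: (subsetP (VV1 g' h' gS' hS' ng)); rewrite -gE -hE inE.
rewrite (subsetP (tr_sub r5 (tg g gS))) // (subsetP (tr_sub r5 (tg _ hS))) //.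
by rewrite !inE eqxx.
Qed.

(* The tight subgraphs that avoid the root lie inside subtrees, so the subtrees can be
   read off from the union. *)
Lemma node_unique f (S S1 : {set T}) V V1 F F1 : node f S V F -> node f S1 V1 F1 ->
  \bigcup_(g in pairs S :\ f) V g = \bigcup_(g in pairs S1 :\ f) V1 g ->
  \bigcup_(g in pairs S :\ f) F g = \bigcup_(g in pairs S1 :\ f) F1 g ->
  S = S1 /\ forall g, g \in pairs S :\ f -> V g = V1 g /\ F g = F1 g.
Proof.
move=> nd nd' eqV eqF.
have SS : S = S1.
  apply/eqP; rewrite eqEsubset (node_clique_sub nd nd' eqV eqF).
  exact: (node_clique_sub nd' nd (esym eqV) (esym eqF)).
split=> // g gS; have [h hS VE] := node_child_eq nd nd' eqV eqF gS.
have VgE : V g = V1 g.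
  suff hg : h = g by rewrite VE hg.
  case: nd => _ _ _ VS _; case: nd' => _ _ _ VS' _.
  by rewrite -(VS' h hS) -VE -SS (VS g gS).
split=> //; rewrite (node_leaves nd gS) (node_leaves nd') ?VgE ?eqF //.
by rewrite -SS.
Qed.

(** The common root and tightness put each vertex set inside the other by [tr_tight]; over equal
    vertex sets the leaves are equally many. *)
Lemma pure_overlap f V F V' F' : tr f V F set0 -> tr f V' F' set0 ->
  beta * (#|V :&: V'| - 2) + alpha <= alpha * #|F :&: F'| -> V = V' /\ F = F'.
Proof.
move=> t t' tight; have [FV _] := tr_leaves t; have [FV' _] := tr_leaves t'.
have sub W K W' K' : tr f W K set0 -> tr f W' K' set0 ->
    beta * (#|W :&: W'| - 2) + alpha <= alpha * #|K :&: K'| -> W \subset W'.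
  move=> s s' le; apply: (tr_tight r5 s (tr_sub r5 s')); apply: leq_trans le _.
  rewrite leq_mul2l; apply/orP; right; apply/subset_leq_card/subsetP => p.
  rewrite !inE => /andP[-> pK']; apply: pairs_sub (subsetP (tr_leaves s').1 _ pK').
have VE : V = V'.
  apply/eqP; rewrite eqEsubset (sub _ _ _ _ t t' tight) /=.
  by apply: (sub _ _ _ _ t' t); rewrite setIC (setIC F').
split=> //; move: tight; rewrite VE setIid -(pure_card t') leq_mul2l => /orP[/eqP r2|le].
  by move: r5 r2; clear; lia.
have cF : #|F| <= #|F'|.
  have := pure_card t; rewrite VE -(pure_card t') => /eqP; rewrite eqn_mul2l => /orP[/eqP r2|/eqP->//].
  by move: r5 r2; clear; lia.
have E' : F :&: F' = F' by apply/eqP; rewrite eqEcard subsetIr.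
by apply/esym/eqP; rewrite eqEcard cF andbT -E' subsetIl.
Qed.

End Unique.

(** * Counting trees without free leaves *)

Section PureTrees.
Local Open Scope ring_scope.
Variables (R : realFieldType) (T : finType) (r : nat).
Hypothesis r5 : (4 < r)%N.
Local Notation D := ('C(r, 2) - 1)%N.
Local Notation tr := (@tr T r).
Local Notation vf := (vf T).
Implicit Types (f g h p : {set T}) (V S : {set T}) (u : vf) (chi : T -> R).

Definition is_pure f (m : nat) u : bool := `[< tr f u.1 u.2 set0 >] && (#|u.1| <= m)%N.
Definition pwt chi f u : R := \prod_(v in u.1 :\: f) chi v.
Definition pure_sum chi m f : R := \sum_(u | is_pure f m u) pwt chi f u.

Lemma pwt_ge0 chi f u : (forall v, 0 <= chi v) -> 0 <= pwt chi f u.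
Proof. by move=> chi0; apply: prodr_ge0. Qed.

Lemma pure_sum_ge0 chi m f : (forall v, 0 <= chi v) -> 0 <= pure_sum chi m f.
Proof. by move=> chi0; apply: sumr_ge0 => u _; apply: pwt_ge0. Qed.

(** The case y = 0 of [tree_sum_le]: free leaves give weight 0, and their absence gives y^0 = 1. *)
Lemma pure_sum_le chi rho m f : (forall v, 0 <= chi v) -> 0 <= rho ->
  1 + (\sum_v chi v) ^+ (r - 2) / (r - 2)`!%:R * rho ^+ D <= rho ->
  pure_sum chi m f <= rho.
Proof.
move=> chi0 rho0 fx; apply: le_trans (tree_sum_le r5 chi0 (lexx 0) rho0 _ m f); last first.
  by rewrite addr0.
pose P (u : vf) : triple T := (u.1, u.2, set0).
apply: le_trans (_ : \sum_(z in P @: [set u | is_pure f m u]) wt chi 0 f z <= _).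
  rewrite big_imset /=; last by move=> [V F] [V' F'] _ _ [-> ->].
  rewrite big_set /=; apply: ler_sum => u _.
  by rewrite /wt /= cards0 expr0 mulr1.
apply: ler_sum_pred => [z _|z /imsetP[u]]; first by apply: wt_ge0.
by rewrite inE => pu ->.
Qed.

Section Recursion.
Variables (x rho kappa : R).
Hypotheses (x0 : 0 <= x) (rho0 : 0 <= rho) (kappa1 : 1 <= kappa).
Hypothesis fixpt : 1 + (x * (#|T|%:R + kappa)) ^+ (r - 2) / (r - 2)`!%:R * rho ^+ D <= rho.
Local Notation chi := (fun=> x).

Let k0 : 0 < kappa. Proof. exact: lt_le_trans kappa1. Qed.

Definition marked (v : T) u : R := (v \in u.1)%:R.

(* Giving v the weight kappa * x multiplies the trees through v by kappa, and the
   total still stays below rho. *)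
Lemma marked_sum_le m g v : v \notin g ->
  \sum_(u | is_pure g m u) pwt chi g u * marked v u <= rho / kappa.
Proof.
move=> vg; rewrite ler_pdivlMr // mulr_suml.
pose chi' (w : T) := if w == v then x * kappa else x.
have chi0 w : 0 <= chi' w by rewrite /chi'; case: ifP => _ //; rewrite mulr_ge0 // ltW.
apply: le_trans (_ : pure_sum chi' m g <= _); last first.
  apply: pure_sum_le => //; apply: le_trans fixpt; rewrite lerD2l.
  apply: ler_wpM2r; first exact: exprn_ge0.
  apply: ler_wpM2r; first by rewrite invr_ge0.
  apply: lerXn2r; rewrite ?nnegrE ?sumr_ge0 // ?mulr_ge0 // ?addr_ge0 // ?(ltW k0) //.
  rewrite mulrDr addrC (bigD1 v) //= {1}/chi' eqxx lerD2l (eq_bigr (fun=> x)).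
    by rewrite sumr_const -[x *+ _]mulr_natr ler_wpM2l // ler_nat max_card.
  by move=> u /negbTE nu; rewrite /chi' nu.
apply: ler_sum => u _; rewrite /marked; case: (boolP (v \in u.1)) => vu; last first.
  by rewrite mulr0 mul0r; apply: pwt_ge0.
rewrite mulr1 /pwt; have vS : v \in u.1 :\: g by rewrite inE vg.
rewrite !(big_setD1 v vS) /= {1}/chi' eqxx mulrAC ler_wpM2l ?mulr_ge0 ?(ltW k0) //.
by apply/ler_prod => w /setD1P[/negbTE nw _]; rewrite /chi' nw x0 lexx.
Qed.

Lemma pure_sum_const_le m g : pure_sum chi m g <= rho.
Proof.
apply: pure_sum_le => //; apply: le_trans fixpt; rewrite lerD2l.
apply: ler_wpM2r; first exact: exprn_ge0.
apply: ler_wpM2r; first by rewrite invr_ge0.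
apply: lerXn2r; rewrite ?nnegrE ?sumr_ge0 // ?mulr_ge0 // ?addr_ge0 // ?(ltW k0) //.
by rewrite sumr_const -[x *+ _]mulr_natr ler_wpM2l // lerDl ltW.
Qed.

Variables (f : {set T}) (m : nat).
Hypothesis f2 : #|f| = 2%N.
Local Notation z0 := ((set0, set0) : vf).
Local Notation kids S := (pairs S :\ f).
Local Notation tuples S := (pfamily z0 (mem (kids S)) (fun g u => is_pure g m u)).
Local Notation tw S t := (\prod_(g in kids S) pwt chi g (t g)).

Definition clean S (t : {ffun {set T} -> vf}) :=
  [forall g in kids S, (t g).1 :&: S == g] &&
  [forall g in kids S, forall k in kids S, (g != k) ==> ((t g).1 :&: (t k).1 \subset S)].

Lemma tw_ge0 S (t : {ffun {set T} -> vf}) : 0 <= tw S t.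
Proof. by apply: prodr_ge0 => g _; apply: pwt_ge0. Qed.

Lemma marked_tuples_le S (B : {set {set T}}) v : #|S| = r -> f \in pairs S ->
  B \subset kids S -> (forall g, g \in B -> v \notin g) ->
  \sum_(t in tuples S) tw S t * \prod_(g in B) marked v (t g) <= rho ^+ D * kappa ^- #|B|.
Proof.
move=> S_r fS BS vB.
pose F g u := pwt chi g u * (if g \in B then marked v u else 1).
rewrite (eq_bigr (fun t : {ffun {set T} -> vf} => \prod_(g in kids S) F g (t g))); last first.
  move=> t _; rewrite /F big_split /=; congr (_ * _).
  rewrite [LHS]big_mkcond [RHS]big_mkcond /=; apply: eq_bigr => g _.
  case: ifP => gB; first by rewrite (subsetP BS g gB).
  by case: ifP.
rewrite -(big_distr_big_dep z0) /=.
apply: le_trans (_ : \prod_(g in kids S) (rho * (if g \in B then kappa^-1 else 1)) <= _).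
  apply: ler_prod => g gS; apply/andP; split.
    apply: sumr_ge0 => u _; rewrite mulr_ge0 ?pwt_ge0 //.
    by case: ifP => // _; apply: ler0n.
  rewrite /F; case: ifP => gB; first exact: marked_sum_le (vB g gB).
  rewrite mulr1 (eq_bigr (pwt chi g)) => [|u _]; last by rewrite mulr1.
  exact: pure_sum_const_le.
rewrite big_split /= prodr_const (card_root_out S_r fS) -big_mkcondr /= -exprVn -prodr_const.
rewrite ler_wpM2l ?exprn_ge0 // le_eqVlt; apply/orP; left; apply/eqP.
by apply: eq_bigl => g; case: (boolP (g \in B)) => [/(subsetP BS)->|_]; rewrite ?andbF.
Qed.

(** Either a tree meets the clique outside its root, with r choices of a vertex marked in one tree,
    or two trees share a vertex off the clique, with |T| choices of a vertex marked in both. Every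
    mark gains a factor 1/kappa, so for kappa of order |T| both terms are O(1/|T|). *)
Lemma dirty_le S : #|S| = r -> f \in pairs S ->
  \sum_(t in tuples S | ~~ clean S t) tw S t <=
   D%:R ^+ 2 * rho ^+ D * (r%:R / kappa + #|T|%:R / kappa ^+ 2).
Proof.
move=> S_r fS.
pose J : finType := ({set T} * {set T} * T)%type.
(* Equal pairs encode the first defect, so that [B j] is a singleton, and distinct pairs the
   second. *)
pose Q (j : J) := [&& j.1.1 \in kids S, j.1.2 \in kids S, j.2 \notin j.1.1, j.2 \notin j.1.2 &
  if j.1.1 == j.1.2 then j.2 \in S else j.2 \notin S].
pose B (j : J) := [set j.1.1; j.1.2].
apply: le_trans (_ : \sum_(t in tuples S) \sum_(j | Q j) tw S t * \prod_(g in B j) marked j.2 (t g) <= _).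
  rewrite big_mkcondr /=; apply: ler_sum => t /pfamilyP[_ tP].
  have p0 (j : J) : 0 <= \prod_(g in B j) marked j.2 (t g) by apply: prodr_ge0 => g _; apply: ler0n.
  rewrite -mulr_sumr; case: ifP => dirty; last by rewrite mulr_ge0 ?tw_ge0 // sumr_ge0.
  rewrite ler_peMr ?tw_ge0 //.
  suff [j Qj hj] : exists2 j, Q j & forall g, g \in B j -> j.2 \in (t g).1.
    rewrite (bigD1 j) //= big1 ?lerDl ?sumr_ge0 //.
    by move=> g /hj h; rewrite /marked h.
  have tg g : g \in kids S -> tr g (t g).1 (t g).2 set0.
    by move=> gS; have /andP[/asboolP] := tP g gS.
  move: dirty; rewrite negb_and => /orP[] /forall_inPn[g gS].
    move=> ne; have sub : g \subset (t g).1 :&: S.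
      by rewrite subsetI (tr_sub r5 (tg g gS)); case/setD1P: gS => _ /pairs_sub.
    have /subsetPn[v /setIP[vt vS] vg] : ~~ ((t g).1 :&: S \subset g).
      by move: ne; rewrite eqEsubset sub andbT.
    exists (g, g, v); first by rewrite /Q /= gS vg eqxx vS.
    by move=> k /set2P[] ->.
  move=> /forall_inPn[k kS]; rewrite negb_imply => /andP[ngk /subsetPn[v /setIP[vg vk] vS]].
  have out h : h \in kids S -> v \notin h.
    by case/setD1P => _ /pairs_sub/subsetP hS; apply: contra vS; apply: hS.
  exists (g, k, v); first by rewrite /Q /= gS kS (out g gS) (out k kS) (negbTE ngk) vS.
  by move=> h /set2P[] ->.
rewrite exchange_big /=.
apply: le_trans (_ : \sum_(j | Q j) rho ^+ D * kappa ^- #|B j| <= _).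
  apply: ler_sum => -[[g k] v] /and5P[/= gS kS vg vk _]; apply: marked_tuples_le => //.
    by apply/subsetP => h /set2P[] ->.
  by move=> h /set2P[] ->.
rewrite -mulr_sumr [leRHS](_ : _ = rho ^+ D * (D%:R ^+ 2 * (r%:R / kappa + #|T|%:R / kappa ^+ 2))); last by ring.
rewrite ler_wpM2l ?exprn_ge0 //.
apply: le_trans (_ : \sum_(gk : {set T} * {set T} | (gk.1 \in kids S) && (gk.2 \in kids S))
   \sum_(v : T) ((v \in S)%:R / kappa + kappa ^- 2) <= _).
  rewrite pair_big_dep /=.
  have e0 (j : J) : 0 <= (j.2 \in S)%:R / kappa + kappa ^- 2.
    by rewrite addr_ge0 ?divr_ge0 ?invr_ge0 ?exprn_ge0 ?(ltW k0).
  apply: le_trans (_ : \sum_(j | Q j) ((j.2 \in S)%:R / kappa + kappa ^- 2) <= _).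
    apply: ler_sum => -[[g k] v] /and5P[/= _ _ _ _]; rewrite /B /= cards2.
    case: eqP => _ /= vS; first by rewrite vS mul1r expr1 lerDl invr_ge0 exprn_ge0 // ltW.
    by rewrite (negbTE vS) mul0r add0r.
  by apply: ler_sum_pred => [j _|j /and5P[-> -> _ _ _]//]; apply: e0.
have -> : \sum_(v : T) ((v \in S)%:R / kappa + kappa ^- 2) = r%:R / kappa + #|T|%:R / kappa ^+ 2.
  rewrite big_split /= -mulr_suml -natr_sum sumr_const -[kappa ^- 2 *+ _]mulr_natl.
  congr (_%:R / _ + _); rewrite -[RHS]S_r -sum1_card [RHS]big_mkcond /=.
  by apply: eq_bigr => v _; case: (v \in S).
rewrite sumr_const -[X in X <= _]mulr_natl.
rewrite (_ : #|_| = (D * D)%N) ?natrM -?expr2 //.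
rewrite -(card_root_out S_r fS) -cardsX; apply: eq_card => gk; by rewrite [in RHS]inE.
Qed.

Lemma card_cliques_ge : ('C(#|T| - 2, r - 2) <= #|[set S : {set T} | (#|S| == r) && (f \in pairs S)]|)%N.
Proof.
have -> : (#|T| - 2 = #|~: f|)%N by rewrite -(cardsC f) f2 addKn.
rewrite -cards_draws; set A := [set _ | _].
have inj : {in A &, injective (fun B => B :|: f)}.
  move=> B B'; rewrite !inE => /andP[Bf _] /andP[Bf' _] E.
  have out (X : {set T}) : X \subset ~: f -> X = (X :|: f) :\: f.
    by rewrite -disjoints_subset => /setDidPl Xf; rewrite setDUl setDv setU0 Xf.
  by rewrite (out B Bf) E -(out B' Bf').
rewrite -(card_in_imset inj); apply/subset_leq_card/subsetP => _ /imsetP[B + ->].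
rewrite !inE => /andP[Bf /eqP B_r]; rewrite subsetUr f2 eqxx !andbT.
have := cardsU B f; move: Bf; rewrite -disjoints_subset => /disjoint_setI0 ->.
by rewrite cards0 B_r f2 => ->; apply/eqP; move: r5; clear; lia.
Qed.

Lemma node_pwt S (t : {ffun {set T} -> vf}) : #|S| = r -> f \in pairs S ->
  (forall g, g \in kids S -> tr g (t g).1 (t g).2 set0) -> clean S t ->
  pwt chi f (\bigcup_(g in kids S) (t g).1, \bigcup_(g in kids S) (t g).2) =
  x ^+ (r - 2) * tw S t.
Proof.
move=> S_r fS tg /andP[/forall_inP VS /forall_inP VV].
have := node_weight r5 chi 1 S_r fS tg; rewrite /wt /=.
rewrite expr1n mulr1 {1}/pwt /= => ->.
- rewrite prodr_const cardsD (setIidPr (pairs_sub fS)) f2 S_r; congr (_ * _).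
  by apply: eq_bigr => g gS; rewrite expr1n mulr1.
- by move=> g gS; apply/eqP/VS.
- by move=> g k gS kS ngk; have /forall_inP/(_ k kS)/implyP/(_ ngk) := VV g gS.
Qed.

Definition graft_node S (t : {ffun {set T} -> vf}) : vf :=
  (\bigcup_(g in kids S) (t g).1, \bigcup_(g in kids S) (t g).2).

Definition clean_tuple (i : {set T} * {ffun {set T} -> vf}) :=
  [&& #|i.1| == r, f \in pairs i.1, i.2 \in tuples i.1 & clean i.1 i.2].

Lemma clean_tuple_node i : clean_tuple i ->
  node r f i.1 (fun g => (i.2 g).1) (fun g => (i.2 g).2).
Proof.
move=> /and4P[/eqP S_r fS /pfamilyP[_ tP] /andP[/forall_inP VS /forall_inP VV]]; split => //.
- by move=> g gS; have /andP[/asboolP] := tP g gS.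
- by move=> g gS; apply/eqP/VS.
- by move=> g k gS kS ngk; have /forall_inP/(_ k kS)/implyP/(_ ngk) := VV g gS.
Qed.

(** A lower bound must not count a tree twice; [node_unique] recovers the clique and the children
    from the union. *)
Lemma graft_node_inj : {in clean_tuple &, injective (fun i => graft_node i.1 i.2)}.
Proof.
move=> [S t] [S' t'] ct ct' [eV eF].
have [/= SS ch] := node_unique r5 (clean_tuple_node ct) (clean_tuple_node ct') eV eF.
move: ct ct'; rewrite -{}SS => /and4P[/= _ _ /pfamilyP[t0 _] _] /and4P[/= _ _ /pfamilyP[t0' _] _].
congr (_, _); apply/ffunP => g; case: (boolP (g \in kids S)) => gS.
  have [] := ch g gS; case: (t g) (t' g) => [? ?] [? ?] /=; by move=> -> ->.
have out (s : {ffun {set T} -> vf}) : z0.-support s \subset kids S -> s g = z0.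
  by move=> /subsetP sub; apply/eqP/negPn/negP => ne; case/negP: gS; apply: sub.
by rewrite !out.
Qed.

Lemma graft_node_tr i : clean_tuple i -> tr f (graft_node i.1 i.2).1 (graft_node i.1 i.2).2 set0.
Proof.
move=> /clean_tuple_node[S_r fS tg VS VV].
have := TrN S_r fS tg VS VV; rewrite (_ : \bigcup_(g in _) set0 = set0) //.
by apply: big1.
Qed.

(** The single edge gives 1; all tuples of trees of size at most m over the cliques, minus the dirty
    ones, give distinct trees of size at most D m. *)
Lemma pure_sum_step (m' : nat) (s : R) : (2 <= m')%N -> (D * m <= m')%N -> 0 <= s ->
  (forall g, #|g| = 2%N -> s <= pure_sum chi m g) ->
  1 + x ^+ (r - 2) * ('C(#|T| - 2, r - 2)%:R * s ^+ D) -
  x ^+ (r - 2) * (#|[set S : {set T} | (#|S| == r) && (f \in pairs S)]|%:R *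
     (D%:R ^+ 2 * rho ^+ D * (r%:R / kappa + #|T|%:R / kappa ^+ 2)))
  <= pure_sum chi m' f.
Proof.
move=> m2 mm s0 IH.
set dirt := D%:R ^+ 2 * _ * _; set cl := [set S | _].
(* [None] stands for the tree that is a single edge. *)
pose I := option ({set T} * {ffun {set T} -> vf}).
pose P (i : I) := if i is Some j then clean_tuple j else true.
pose h (i : I) : vf := if i is Some j then graft_node j.1 j.2 else (f, [set f]).
have card_root i : clean_tuple i -> (r <= #|(graft_node i.1 i.2).1|)%N.
  move=> /clean_tuple_node[S_r fS _ VS _]; rewrite -S_r.
  exact/subset_leq_card/(node_sub r5 S_r fS VS).
have card_ge i : clean_tuple i -> (#|(graft_node i.1 i.2).1| <= m')%N.
  move=> /and4P[/eqP S_r fS /pfamilyP[_ tP] _]; apply: leq_trans mm.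
  apply: leq_trans (leq_card_bigcup _ _) _; rewrite -(card_root_out S_r fS) -sum_nat_const.
  by apply: leq_sum => g gS; have /andP[] := tP g gS.
have inj : {in P &, injective h}.
  have neq j : clean_tuple j -> graft_node j.1 j.2 <> (f, [set f]).
    move=> /card_root cj E; move: cj; rewrite E /= f2; move: r5; clear; lia.
  move=> [j|] [j'|] //; rewrite !unfold_in /= => Pj Pj'.
  - by move/(graft_node_inj Pj Pj') => ->.
  - by move/(neq _ Pj).
  - by move/esym/(neq _ Pj').
apply: le_trans (_ : \sum_(u in h @: P) pwt chi f u <= _); last first.
  apply: ler_sum_pred => [u _|u /imsetP[[j|] Pj ->]]; first exact: pwt_ge0.
    rewrite /is_pure card_ge // andbT; apply/asboolP; exact: graft_node_tr Pj.
  by rewrite /is_pure /= f2 m2 andbT; apply/asboolP; apply: TrG.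
rewrite big_imset //= (bigD1 None) //= {1}/pwt /= setDv big_set0.
rewrite -addrA lerD2l.
apply: le_trans (_ : \sum_(j | clean_tuple j) x ^+ (r - 2) * tw j.1 j.2 <= _); last first.
  rewrite (reindex_omap Some (fun i : I => i)) /=; last by case=> [j|] /andP[].
  rewrite le_eqVlt; apply/orP; left; apply/eqP; apply: eq_big => [j|j].
    by rewrite eqxx !andbT.
  move=> ct; have /and4P[/eqP S_r fS _ cl'] := ct.
  by rewrite node_pwt //; have [] := clean_tuple_node ct.
rewrite -mulr_sumr -mulrBr ler_wpM2l ?exprn_ge0 //.
apply: le_trans (_ : \sum_(S in cl) (s ^+ D - dirt) <= _).
  rewrite sumr_const -[X in _ <= X]mulr_natl mulrBr lerD2r; apply: ler_wpM2r; first exact: exprn_ge0.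
  by rewrite ler_nat card_cliques_ge.
apply: le_trans (_ : \sum_(S in cl) \sum_(t in tuples S | clean S t) tw S t <= _); last first.
  rewrite pair_big_dep /=; apply: ler_sum_pred => [j _|[S t]]; first exact: tw_ge0.
  by rewrite inE => /andP[/andP[S_r fS] /andP[tS ct]]; rewrite /clean_tuple /= S_r fS tS ct.
apply: ler_sum => S; rewrite inE => /andP[/eqP S_r fS]; rewrite lerBlDr.
apply: le_trans (_ : \sum_(t in tuples S) tw S t <= _).
  rewrite -(big_distr_big_dep z0) /= -(card_root_out S_r fS) -prodr_const.
  by apply: ler_prod => g /setD1P[_ /pairs_card g2]; rewrite s0 IH.
by rewrite (bigID (clean S)) /= lerD2l dirty_le.
Qed.

End Recursion.
End PureTrees.

From mathcomp Require Import archimedean reals exp.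
Import Order.TTheory GRing.Theory Num.Theory.

(** * Second moment *)

Section SecondMoment.
Local Open Scope ring_scope.
Variables (R : realType) (T : finType) (r : nat).
Hypothesis r5 : (4 < r)%N.
Local Notation D := ('C(r, 2) - 1)%N.
Local Notation alpha := (r - 2)%N.
Local Notation beta := ('C(r, 2) - 2)%N.
Local Notation tr := (@tr T r).
Local Notation vf := (vf T).
Local Notation lam := (lam R r).
Local Notation phi := (phi R r).
Implicit Types (f g h e : {set T}) (V S : {set T}) (u : vf).

Variable p : R.
Hypotheses (p0 : 0 < p) (p1 : p <= 1).
Local Notation x := (p `^ lam).
Local Notation K := (pairs [set: T]).
Local Notation EX := (EX K p).
Local Notation Pr := (Pr K p).
Local Notation pure_sum := (pure_sum (T := T) r (fun=> x)).

Lemma expr_le_powR (a : nat) (b : R) : b <= a%:R -> p ^+ a <= p `^ b.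
Proof. by move=> ba; rewrite -powR_mulrn ?(ltW p0) //; apply: ger_powR; rewrite ?p0. Qed.

Lemma powRDp (a b : R) : p `^ (a + b) = p `^ a * p `^ b.
Proof. by rewrite powRD // (gt_eqF p0) implybT. Qed.

Lemma powR_lam (k : nat) : p `^ (lam * k%:R) = x ^+ k.
Proof. by rewrite powRrM powR_mulrn // powR_ge0. Qed.

(** As |F| = lambda (|V| - 2) + 1, there is one factor p for the root pair and p^lambda for every
    other vertex. *)
Lemma pure_prob f V F : tr f V F set0 -> p ^+ #|F| = p * pwt (fun=> x) f (V, F).
Proof.
move=> t; have cF := tr_countR R r5 t; rewrite cards0 subr0 in cF.
have [fV f2] := tr_root r5 t.
have vE : (#|V :\: f|)%:R = #|V|%:R - 2 :> R.
  by rewrite cardsD (setIidPr fV) f2 natrB // -f2 subset_leq_card.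
rewrite /pwt prodr_const -powR_lam /= vE -[p ^+ _]powR_mulrn ?ltW // cF /phi addrC powRDp.
by rewrite powRr1 // ltW.
Qed.

Definition tree_at : finType := ({set T} * vf)%type.
Implicit Types (w : tree_at).
Variable m : nat.
Definition is_tree_at w : bool := (w.1 \in K) && is_pure r w.1 m w.2.
Local Notation Q := is_tree_at.
Local Notation F_ w := w.2.2.
Local Notation V_ w := w.2.1.

Definition tree_count (G : {set {set T}}) : R := \sum_(w | Q w) (F_ w \subset G)%:R.
Definition reached (G : {set {set T}}) : {set {set T}} :=
  [set e in K | [exists u, is_pure r e m u && (u.2 \subset G)]].
Definition mean : R := p * \sum_(e in K) pure_sum m e.

Lemma tree_at_tr w : Q w -> tr w.1 (V_ w) (F_ w) set0.
Proof. by case/andP => _ /andP[/asboolP]. Qed.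

Lemma tree_at_sub w : Q w -> F_ w \subset K.
Proof. move=> /tree_at_tr/tr_leaves[FV _]; apply: subset_trans FV _; exact/pairsS/subsetT. Qed.

Lemma EX_tree_count : EX tree_count = mean.
Proof.
rewrite EX_sum (eq_bigr (fun w => p * pwt (fun=> x) w.1 w.2)); last first.
  move=> w Qw; rewrite EX_sub ?tree_at_sub // (pure_prob (tree_at_tr Qw)).
  by case: (w.2).
rewrite -mulr_sumr /mean; congr (_ * _); rewrite /pure_sum pair_big_dep /=.
by apply: eq_bigl.
Qed.

Definition pair_sum : R := \sum_(w | Q w) \sum_(w' | Q w') x ^+ #|V_ w :|: V_ w'|.

(** Both edge counts equal phi, so every edge by which the intersection falls short of phi(|V ∩ V'|)
    is a further factor p in the union; [gap] bounds this shortage from below. *)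
Lemma pair_prob w w' (gap : R) : Q w -> Q w' ->
  #|F_ w :&: F_ w'|%:R <= phi #|V_ w :&: V_ w'| - gap ->
  p ^+ #|F_ w :|: F_ w'| <= p `^ (1 - 2 * lam + gap) * x ^+ #|V_ w :|: V_ w'|.
Proof.
move=> /tree_at_tr t /tree_at_tr t' le.
rewrite -powR_lam -powRDp; apply: expr_le_powR.
have := tr_countR R r5 t; have := tr_countR R r5 t'; rewrite cards0 !subr0.
have cF : (#|F_ w :|: F_ w'|%:R = #|F_ w|%:R + #|F_ w'|%:R - #|F_ w :&: F_ w'|%:R :> R).
  by rewrite -natrD -cardsUI natrD addrK.
have cV : (#|V_ w :|: V_ w'|%:R = #|V_ w|%:R + #|V_ w'|%:R - #|V_ w :&: V_ w'|%:R :> R).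
  by rewrite -natrD -cardsUI natrD addrK.
rewrite cF cV; move: le; rewrite /phi.
move: (#|F_ w|%:R) (#|F_ w'|%:R) (#|F_ w :&: F_ w'|%:R) (#|V_ w|%:R) (#|V_ w'|%:R) (#|V_ w :&: V_ w'|%:R) => a b c d e g.
by move=> h1 h2 h3; rewrite h2 h3; move: h1; rewrite !mulrBr !mulrDr; lra.
Qed.

Lemma common_edges_le w w' : Q w -> Q w' -> F_ w :&: F_ w' != set0 ->
  #|F_ w :&: F_ w'|%:R <= phi #|V_ w :&: V_ w'| - 0.
Proof.
move=> Qw Qw' /set0Pn[f /setIP[fF fF']]; rewrite subr0.
have t := tree_at_tr Qw; have t' := tree_at_tr Qw'.
have fp := subsetP (tr_leaves t).1 _ fF; have fp' := subsetP (tr_leaves t').1 _ fF'.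
have v2 : (2 <= #|V_ w :&: V_ w'|)%N.
  by rewrite -(pairs_card fp) subset_leq_card // subsetI !pairs_sub.
have sub : F_ w :&: F_ w' \subset ins (F_ w) (V_ w').
  apply/subsetP => g /setIP[gF gF']; rewrite inE gF /=.
  exact: pairs_sub (subsetP (tr_leaves t').1 _ gF').
have := tr_density r5 t (V_ w'); rewrite /bound ltnNge v2 /= => le.
have {le} : (alpha * #|F_ w :&: F_ w'| <= beta * (#|V_ w :&: V_ w'| - 2) + alpha)%N.
  by apply: leq_trans le; rewrite leq_mul2l subset_leq_card // orbT.
rewrite -(ler_nat R) natrD !natrM (natrB _ v2) -(lamE R r5) /phi.
have := r2_gt0 R r5; move: (alpha%:R : R) => a a0.
by rewrite -[X in _ + X]mulr1 (mulrC lam) -mulrA -mulrDr ler_pM2l.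
Qed.

(** Distinct trees with the same root are not tight on their intersection by [pure_overlap], and a
    deficiency is a multiple of 1 / (r - 2). *)
Lemma common_edges_root_le w w' : Q w -> Q w' -> w.1 = w'.1 -> w != w' ->
  #|F_ w :&: F_ w'|%:R <= phi #|V_ w :&: V_ w'| - alpha%:R^-1.
Proof.
move=> Qw Qw' ww ne; have t := tree_at_tr Qw; have t' := tree_at_tr Qw'.
have v2 : (2 <= #|V_ w :&: V_ w'|)%N.
  by rewrite -(tr_card2 r5 t) subset_leq_card // subsetI (tr_sub r5 t) ww (tr_sub r5 t').
have : (alpha * #|F_ w :&: F_ w'| < beta * (#|V_ w :&: V_ w'| - 2) + alpha)%N.
  rewrite ltnNge; apply/negP => le; case/eqP: ne.
  rewrite -ww in t'; have [] := pure_overlap r5 t t' le.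
  by case: (w) (w') ww => [? [? ?]] [? [? ?]] /= -> -> ->.
rewrite -(ler_nat R) -addn1 !natrD !natrM (natrB _ v2) -(lamE R r5) /phi.
have := r2_gt0 R r5; move: (alpha%:R : R) => a a0.
move=> le; rewrite lerBrDr -(ler_pM2l a0) mulrDr mulfV ?gt_eqF //; apply: le_trans le _.
by rewrite [leRHS]mulrDr mulr1 mulrA (mulrC a).
Qed.

Definition cross : R := \sum_(w | Q w) \sum_(w' | Q w' && (F_ w :&: F_ w' != set0)) p ^+ #|F_ w :|: F_ w'|.
Definition coincide : R := \sum_(w | Q w) \sum_(w' | Q w' && ((w'.1 == w.1) && (w' != w))) p ^+ #|F_ w :|: F_ w'|.

Lemma cross_le : cross <= p `^ (1 - 2 * lam) * pair_sum.
Proof.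
rewrite /cross /pair_sum mulr_sumr; apply: ler_sum => w Qw.
rewrite mulr_sumr [leRHS](bigID (fun w' => F_ w :&: F_ w' != set0)) /= -[leLHS]addr0; apply: lerD.
  apply: ler_sum => w' /andP[Qw' ne]; rewrite -[1 - _]addr0.
  exact: pair_prob Qw Qw' (common_edges_le Qw Qw' ne).
by apply: sumr_ge0 => w' _; rewrite mulr_ge0 ?exprn_ge0 ?powR_ge0.
Qed.

Lemma coincide_le : coincide <= p `^ (1 - 2 * lam + alpha%:R^-1) * pair_sum.
Proof.
rewrite /coincide /pair_sum mulr_sumr; apply: ler_sum => w Qw.
rewrite mulr_sumr [leRHS](bigID (fun w' => (w'.1 == w.1) && (w' != w))) /= -[leLHS]addr0; apply: lerD.
  apply: ler_sum => w' /andP[Qw' /andP[/eqP ww ne]].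
  by apply: pair_prob Qw Qw' (common_edges_root_le Qw Qw' _ _); rewrite 1?eq_sym.
by apply: sumr_ge0 => w' _; rewrite mulr_ge0 ?exprn_ge0 ?powR_ge0.
Qed.

(** Each vertex is in neither set, with weight 1, or in exactly one or both, with weight x in each
    of three ways. *)
Lemma union_weight : \sum_(V : {set T}) \sum_(V' : {set T}) x ^+ #|V :|: V'| = (1 + 3 * x) ^+ #|T|.
Proof.
have E V : \sum_(V' : {set T}) x ^+ #|V :|: V'| = \prod_(t : T) (if t \in V then 2 * x else 1 + x).
  rewrite (eq_bigr (fun V' : {set T} => \prod_(t : T) if t \in V' then x else if t \in V then x else 1)).
    rewrite -bigA_distr /=; apply: eq_bigr => t _; case: ifP => _; first by ring.
    by rewrite addrC.
  move=> V' _; rewrite -prodr_const big_mkcond /=; apply: eq_bigr => t _.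
  by rewrite in_setU; case: (t \in V); case: (t \in V').
rewrite (eq_bigr _ (fun V _ => E V)) -bigA_distr /= prodr_const; congr (_ ^+ _).
by ring.
Qed.

(** Bounds the choices of a root and a leaf set on a given set of at most m vertices. *)
Definition shapes : nat := (2 ^ m * 2 ^ (2 ^ m))%N.

Lemma tree_at_sum (w_ : {set T} -> R) : (forall V, 0 <= w_ V) ->
  \sum_(w | Q w) w_ (V_ w) <= shapes%:R * \sum_(V : {set T}) w_ V.
Proof.
move=> w0; rewrite (partition_big (fun w : tree_at => V_ w) predT) //= mulr_sumr.
apply: ler_sum => V _; rewrite (eq_bigr (fun=> w_ V)); last by move=> w /andP[_ /eqP ->].
rewrite sumr_const -[X in X <= _]mulr_natl ler_wpM2r // ler_nat.
have [Vm|Vm] := leqP #|V| m; last first.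
  rewrite eq_card0 // => w; rewrite !inE; apply/negP => /andP[/andP[_ /andP[_ le]] /eqP E].
  by rewrite E leqNgt Vm in le.
apply: (@leq_trans #|setX (powerset V) (powerset (powerset V))|); last first.
  rewrite cardsX !card_powerset leq_mul // leq_exp2l // leq_exp2l //.
pose k w := (w.1, F_ w).
have inj : {in [pred w | Q w && (V_ w == V)] &, injective k}.
  by move=> [e [W F]] [e' [W' F']] /andP[_ /eqP /= ->] /andP[_ /eqP /= ->] [-> ->].
rewrite -(card_in_image inj); apply/subset_leq_card/subsetP => _ /imageP[w /andP[Qw /eqP E] ->].
have t := tree_at_tr Qw; rewrite /k inE /= !powersetE -E (tr_sub r5 t) /=.
apply/subsetP => g /(subsetP (tr_leaves t).1); rewrite powersetE; exact: pairs_sub.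
Qed.

Lemma pair_sum_le : pair_sum <= shapes%:R ^+ 2 * (1 + 3 * x) ^+ #|T|.
Proof.
have x0 : 0 <= x by apply: powR_ge0.
rewrite -union_weight expr2 -mulrA.
apply: le_trans (_ : \sum_(w | Q w) shapes%:R * (\sum_(V' : {set T}) x ^+ #|V_ w :|: V'|) <= _).
  by apply: ler_sum => w _; apply: tree_at_sum (fun V' => x ^+ #|V_ w :|: V'|) _ => V'; apply: exprn_ge0.
rewrite -mulr_sumr ler_wpM2l ?ler0n //.
apply: (tree_at_sum (w_ := fun V => \sum_(V' : {set T}) x ^+ #|V :|: V'|)) => V.
by apply: sumr_ge0 => V' _; apply: exprn_ge0.
Qed.

Lemma EX_pair w w' : Q w -> Q w' ->
  EX (fun G => (F_ w \subset G)%:R * (F_ w' \subset G)%:R) = p ^+ #|F_ w :|: F_ w'|.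
Proof.
move=> Qw Qw'; rewrite -(EX_sub p (K := K)); last by rewrite subUset !tree_at_sub.
by apply: eq_bigr => G _; rewrite subUset -natrM mulnb.
Qed.

(** Trees without a common edge are independent and cancel against the squared mean. *)
Lemma tree_count_variance : EX (fun G => (tree_count G - mean) ^+ 2) <= cross.
Proof.
have -> : EX (fun G => (tree_count G - mean) ^+ 2) =
    EX (fun G => tree_count G ^+ 2 + (- (2 * mean) * tree_count G + mean ^+ 2)).
  by apply: eq_bigr => G _; congr (_ * _); ring.
rewrite EXD EXD EXZ EX_const EX_tree_count.
have -> : EX (fun G => tree_count G ^+ 2) = \sum_(w | Q w) \sum_(w' | Q w') p ^+ #|F_ w :|: F_ w'|.
  rewrite (_ : EX _ = EX (fun G => \sum_(w | Q w) \sum_(w' | Q w') (F_ w \subset G)%:R * (F_ w' \subset G)%:R)).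
    rewrite EX_sum; apply: eq_bigr => w Qw; rewrite EX_sum; apply: eq_bigr => w' Qw'; exact: EX_pair.
  apply: eq_bigr => G _; congr (_ * _); rewrite expr2 /tree_count mulr_suml.
  by apply: eq_bigr => w _; rewrite mulr_sumr.
suff : \sum_(w | Q w) \sum_(w' | Q w') p ^+ #|F_ w :|: F_ w'| <= mean ^+ 2 + cross by nra.
have -> : mean ^+ 2 = \sum_(w | Q w) \sum_(w' | Q w') p ^+ (#|F_ w| + #|F_ w'|).
  have -> : mean = \sum_(w | Q w) p ^+ #|F_ w|.
    rewrite -EX_tree_count EX_sum; apply: eq_bigr => w Qw; exact/EX_sub/tree_at_sub.
  rewrite expr2 mulr_suml; apply: eq_bigr => w _; rewrite mulr_sumr.
  by apply: eq_bigr => w' _; rewrite exprD.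
rewrite -big_split /=; apply: ler_sum => w Qw.
rewrite (bigID (fun w' => F_ w :&: F_ w' != set0)) /= addrC; apply: lerD => //.
apply: le_trans (_ : \sum_(w' | Q w' && ~~ (F_ w :&: F_ w' != set0)) p ^+ (#|F_ w| + #|F_ w'|) <= _).
  apply: ler_sum => w' /andP[_]; rewrite negbK => /eqP I0.
  by rewrite -cardsUI I0 cards0 addn0.
by apply: ler_sum_pred => [w' _|w' /andP[]//]; rewrite exprn_ge0 // ltW.
Qed.

(* Per pair: c - c (c - 1) <= 1 if c > 0, and = 0 if c = 0. *)
Lemma reached_ge G : tree_count G -
   \sum_(w | Q w) \sum_(w' | Q w' && ((w'.1 == w.1) && (w' != w))) (F_ w \subset G)%:R * (F_ w' \subset G)%:R
  <= #|reached G|%:R.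
Proof.
pose c e : R := \sum_(w | Q w && (w.1 == e)) (F_ w \subset G)%:R.
have -> : tree_count G = \sum_(e in K) c e.
  by apply: partition_big => w /andP[].
rewrite (partition_big (fun w : tree_at => w.1) (mem K)) /=; last by move=> w /andP[].
rewrite -sumrB -sum1_card natr_sum [leRHS]big_mkcond [leLHS]big_mkcond; apply: ler_sum => e _.
rewrite [e \in reached G]inE; case: (boolP (e \in K)) => //= eK.
have -> : \sum_(w | Q w && (w.1 == e)) \sum_(w' | Q w' && ((w'.1 == w.1) && (w' != w)))
     (F_ w \subset G)%:R * (F_ w' \subset G)%:R =
   \sum_(w | Q w && (w.1 == e)) (F_ w \subset G)%:R * (c e - (F_ w \subset G)%:R) :> R.
  apply: eq_bigr => w /andP[Qw /eqP we]; rewrite -mulr_sumr; congr (_ * _).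
  rewrite /c [in RHS](bigD1 w) ?Qw ?we ?eqxx //= addrAC subrr add0r.
  by apply: eq_bigl => w'; rewrite !andbA.
have -> : \sum_(w | Q w && (w.1 == e)) (F_ w \subset G)%:R * (c e - (F_ w \subset G)%:R) = c e * (c e - 1).
  rewrite {2}/c mulr_suml; apply: eq_bigr => w _.
  by case: (_ \subset _); rewrite ?mul0r // !mul1r.
have [/existsP[u /andP[pu uG]]|no] := boolP [exists u, is_pure r e m u && (u.2 \subset G)].
  rewrite mulrBr mulr1; have := sqr_ge0 (c e - 1); rewrite sqrrB1 -expr2; move: (c e) (c e ^+ 2) => y z; rewrite mulr2n; lra.
have -> : c e = 0.
  apply: big1 => w /andP[/andP[_ pw] /eqP we]; rewrite -we in no.
  move/existsPn: no => /(_ w.2); rewrite pw /= => /negbTE -> //.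
by rewrite mul0r subr0.
Qed.

(** Chebyshev's inequality for the number of trees and Markov's for the coincidences of roots. *)
Lemma reached_lower (a b : R) : 0 < a -> 0 < b ->
  Pr (fun G => (#|reached G|%:R < mean - a - b)) <= cross / a ^+ 2 + coincide / b.
Proof.
move=> a0 b0; pose cc (G : {set {set T}}) : R := \sum_(w | Q w) \sum_(w' | Q w' && ((w'.1 == w.1) && (w' != w)))
   (F_ w \subset G)%:R * (F_ w' \subset G)%:R.
have cc0 G : 0 <= cc G by apply: sumr_ge0 => w _; apply: sumr_ge0 => w' _; rewrite mulr_ge0 ?ler0n.
have Ecc : EX cc = coincide.
  rewrite EX_sum; apply: eq_bigr => w Qw; rewrite EX_sum; apply: eq_bigr => w' /andP[Qw' _].
  exact: EX_pair.
apply: le_trans (_ : Pr (fun G => (a ^+ 2 <= (tree_count G - mean) ^+ 2) || (b <= cc G)) <= _).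
  apply: (Pr_sub (ltW p0) p1) => G _ lt; have := reached_ge G; rewrite -/(cc G) => ge.
  case: (leP b (cc G)) => bc; rewrite ?orbT // orbF.
  have : a <= mean - tree_count G by move: lt ge bc; rewrite /cc; lra.
  move=> am; rewrite -[leRHS]sqrrN opprB lerXn2r // nnegrE; lra.
apply: le_trans (Pr_or _ (ltW p0) p1 _ _) _; apply: lerD.
  apply: le_trans (markov (c := a ^+ 2) (f := fun G => (tree_count G - mean) ^+ 2) (ltW p0) p1 _ _ _) _.
  - by rewrite exprn_gt0.
  - by move=> G _; apply: sqr_ge0.
  - by [].
  apply: ler_wpM2r; [by rewrite invr_ge0 exprn_ge0 // ltW | exact: tree_count_variance].
by rewrite -Ecc; apply: (markov (ltW p0) p1 b0).
Qed.

End SecondMoment.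

(** * First moments of scripts *)

Section UpperBounds.
Local Open Scope ring_scope.
Variables (R : realType) (T : finType) (r : nat).
Hypothesis r5 : (4 < r)%N.
Local Notation D := ('C(r, 2) - 1)%N.
Local Notation tr := (@tr T r).
Local Notation scr := (@scr T r).
Local Notation vf := (vf T).
Local Notation lam := (lam R r).
Local Notation c0 := (c0 R r).
Local Notation phi := (phi R r).
Implicit Types (f g h e : {set T}) (V S : {set T}) (F G : {set {set T}}) (u : vf).

Variables (p w rho : R) (L M : nat).
Hypotheses (p0 : 0 < p) (p1 : p <= 1) (w1 : 1 <= w) (rho0 : 0 <= rho).
Local Notation x := (p `^ lam).
Local Notation y := (p `^ (c0 / 2)).
Local Notation K := (pairs [set: T]).
Local Notation EX := (EX K p).
Local Notation Pr := (Pr K p).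
Local Notation sigma := (y * M%:R + w * x * #|T|%:R).
Hypothesis fixpt : 1 + y + sigma ^+ (r - 2) / (r - 2)`!%:R * rho ^+ D <= rho.
Local Notation q := (y * (rho * sigma ^+ 2)).
Hypothesis q_small : q <= 2^-1.

Let w0 : 0 < w. Proof. exact: lt_le_trans w1. Qed.
Let x0 : 0 <= x. Proof. exact: powR_ge0. Qed.
Let y0 : 0 <= y. Proof. exact: powR_ge0. Qed.

(** The constant term of phi gives the exponent 1 - 2 lambda; beyond it every vertex costs x and
    every unit of excess p^c. *)
Lemma scr_prob th V F (c d : R) : scr th V F ->
  phi #|V| + c * (th%:R - #|V|%:R) + d <= #|F|%:R ->
  p ^+ #|F| <= p `^ (1 - 2 * lam + d) * (x ^+ #|V| * (p `^ c) ^+ (th - #|V|)).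
Proof.
move=> s le; have [lt _] := scr_lt r5 s; have {}lt : (#|V| <= th)%N by apply: leq_trans lt; apply: leq_addr.
rewrite -(powR_lam r p) -(@powR_mulrn _ (p `^ c)) ?powR_ge0 // -powRrM -!(powRDp p0).
apply: (expr_le_powR p0 p1); apply: le_trans le; rewrite natrB // /phi mulrBr.
by rewrite -subr_ge0 (_ : _ - _ = 0) //; ring.
Qed.

Variable b : nat.
Definition script : finType := ('I_b * vf)%type.
Implicit Types (i : script).
Definition is_script i : bool := is_scr r M i.1 i.2 && (0 < i.1)%N.

Lemma weighted_scripts : \sum_(i | is_script i) swt (w * x) y i.1 i.2 <= 2 * q.
Proof.
by apply: (scr_sum_le r5 _ y0 rho0 fixpt q_small); rewrite mulr_ge0 // ltW.
Qed.

Definition crossing i : bool := [&& is_script i, i.2.2 \subset pairs i.2.1, (L < #|i.2.1|)%N &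
  phi #|i.2.1| + c0 * (i.1%:R - #|i.2.1|%:R - 4 * D%:R) <= #|i.2.2|%:R].

Definition bad i : bool := [&& is_script i, i.2.2 \subset pairs i.2.1, (#|i.2.1| <= L)%N &
  phi #|i.2.1| + c0 / 2 * (i.1%:R - #|i.2.1|%:R) <= #|i.2.2|%:R].

(** These scripts have more than L vertices, so raising the vertex weight from x to w x, which the
    fixed point inequality tolerates, gains the factor w^L. *)
Lemma crossing_sum :
  \sum_(i | crossing i) p ^+ #|i.2.2| <= p `^ (1 - 2 * lam - 4 * D%:R * c0) / w ^+ L.
Proof.
apply: le_trans (_ : \sum_(i | crossing i) p `^ (1 - 2 * lam - 4 * D%:R * c0) / w ^+ L *
   swt (w * x) y i.1 i.2 <= _).
  apply: ler_sum => -[th [V F]] /and4P[/= /andP[/andP[/asboolP /= s _] _] _ LV le].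
  rewrite /swt /=; apply: le_trans (scr_prob (c := c0) (d := - (4 * D%:R * c0)) s _) _.
    by apply: le_trans le; rewrite le_eqVlt; apply/orP; left; apply/eqP; ring.
  move: (powR_ge0 p (1 - 2 * lam - 4 * D%:R * c0)); set A := p `^ (1 - _ - _) => A0.
  rewrite -mulrA ler_wpM2l // mulrA; apply: ler_pM; rewrite ?exprn_ge0 ?powR_ge0 //.
    rewrite exprMn mulrA ler_peMl ?exprn_ge0 // mulrC ler_pdivlMr ?exprn_gt0 // mul1r.
    by rewrite ler_weXn2l // ltnW.
  rewrite lerXn2r ?nnegrE ?powR_ge0 //; apply: ger_powR; rewrite ?p0 //.
  by have := c0_gt0 R r5; lra.
rewrite -mulr_sumr -[leRHS]mulr1; apply: ler_wpM2l.
  by rewrite divr_ge0 ?powR_ge0 ?exprn_ge0 ?(ltW w0).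
apply: le_trans (_ : \sum_(i | is_script i) swt (w * x) y i.1 i.2 <= _).
  apply: ler_sum_pred => [i _|i /and4P[]//].
  by rewrite /swt mulr_ge0 ?exprn_ge0 ?mulr_ge0 // ltW.
by apply: le_trans weighted_scripts _; have := q_small; lra.
Qed.

(** A script covers at most L^2 pairs; the factor 2 q comes from its containing at least one
    tree. *)
Lemma bad_sum : \sum_(i | bad i) p ^+ #|i.2.2| * #|pairs i.2.1|%:R <=
  L%:R ^+ 2 * p `^ (1 - 2 * lam) * (2 * q).
Proof.
apply: le_trans (_ : \sum_(i | bad i) L%:R ^+ 2 * p `^ (1 - 2 * lam) * swt (w * x) y i.1 i.2 <= _).
  apply: ler_sum => -[th [V F]] /and4P[/= /andP[/andP[/asboolP /= s _] _] _ LV le].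
  rewrite /swt /= mulrC -mulrA; apply: ler_pM; rewrite ?exprn_ge0 ?(ltW p0) //.
    rewrite -natrX ler_nat card_pairs; apply: leq_trans (_ : 2 * 'C(#|V|, 2) <= _)%N.
      by rewrite leq_pmull.
    by rewrite twice_bin2 expnS expn1 leq_mul // (leq_trans (leq_pred _)).
  apply: le_trans (scr_prob (c := c0 / 2) (d := 0) s _) _; first by rewrite addr0.
  rewrite addr0 ler_wpM2l ?powR_ge0 // ler_wpM2r ?exprn_ge0 //.
  by rewrite lerXn2r ?nnegrE ?mulr_ge0 ?(ltW w0) // ler_peMl.
rewrite -mulr_sumr; apply: ler_wpM2l.
  by rewrite mulr_ge0 ?exprn_ge0 ?powR_ge0.
apply: le_trans weighted_scripts; apply: ler_sum_pred => [i _|i /and4P[]//].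
by rewrite /swt mulr_ge0 ?exprn_ge0 ?mulr_ge0 // ltW.
Qed.

End UpperBounds.

(** * Crossing scripts and bad pairs in the random graph *)

Section Upper.
Local Open Scope ring_scope.
Variables (R : realType) (T : finType) (r : nat).
Hypothesis r5 : (4 < r)%N.
Local Notation D := ('C(r, 2) - 1)%N.
Local Notation scr := (@scr T r).
Local Notation lam := (lam R r).
Local Notation c0 := (c0 R r).
Local Notation phi := (phi R r).
Implicit Types (V : {set T}) (F G Z : {set {set T}}).

Variables (p w rho : R) (L M : nat).
Hypotheses (p0 : 0 < p) (p1 : p <= 1) (w1 : 1 <= w) (rho0 : 0 <= rho).
Local Notation x := (p `^ lam).
Local Notation y := (p `^ (c0 / 2)).
Local Notation K := (pairs [set: T]).
Local Notation EX := (EX K p).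
Local Notation Pr := (Pr K p).
Local Notation sigma := (y * M%:R + w * x * #|T|%:R).
Hypothesis fixpt : 1 + y + sigma ^+ (r - 2) / (r - 2)`!%:R * rho ^+ D <= rho.
Local Notation q := (y * (rho * sigma ^+ 2)).
Hypothesis q_small : q <= 2^-1.

(** The density inequality bounds the excess of a script in terms of |F| <= |K|, so [b] exceeds
    every th that can occur. *)
Let b : nat := Num.bound ((#|K|%:R + 2 * lam) * 2 / c0 + (#|T|%:R + 4 * D%:R)).

Let script_lt (th : nat) V F : F \subset K ->
  (0 <= (th%:R - #|V|%:R - 4 * D%:R : R) ->
    c0 / 2 * (th%:R - #|V|%:R - 4 * D%:R) <= #|F|%:R - phi #|V|) -> (th < b)%N.
Proof.
move=> FK h; have cp := c0_gt0 R r5; have lp := lam_ge1 R r5.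
have VT : #|V|%:R <= #|T|%:R :> R by rewrite ler_nat max_card.
have FT : #|F|%:R <= #|K|%:R :> R by rewrite ler_nat subset_leq_card.
have K0 : 0 <= (#|K|%:R + 2 * lam) * 2 / c0.
  by rewrite divr_ge0 ?(ltW cp) // mulr_ge0 // addr_ge0 //; lra.
rewrite -(ltr_nat R); apply: le_lt_trans (archi_boundP _); last first.
  by rewrite !addr_ge0 // mulr_ge0.
have [e0|e0] := leP 0 (th%:R - #|V|%:R - 4 * D%:R : R); last by lra.
rewrite -[leLHS](subrK (#|V|%:R + 4 * D%:R)); apply: lerD; last by rewrite lerD2r.
rewrite ler_pdivlMr // opprD addrA mulrC -ler_pdivrMr // mulrAC; apply: le_trans (h e0) _.
have phiV : 1 - 2 * lam <= phi #|V|.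
  rewrite /phi mulrBr; have : 0 <= lam * #|V|%:R by rewrite mulr_ge0 //; lra.
  lra.
lra.
Qed.

Let script_of th V F : scr th V F -> F \subset K -> (#|V| <= M)%N -> V != set0 ->
  (0 <= (th%:R - #|V|%:R - 4 * D%:R : R) ->
    c0 / 2 * (th%:R - #|V|%:R - 4 * D%:R) <= #|F|%:R - phi #|V|) ->
  exists2 i : script T b, is_script r M i & [/\ th = i.1, V = i.2.1 & F = i.2.2].
Proof.
move=> s FK VM V0 h; exists (Ordinal (script_lt FK h), (V, F)) => //.
rewrite /is_script /is_scr /= VM andbT; apply/andP; split; first exact/asboolP.
by have [_ ->] := scr_lt r5 s.
Qed.

Lemma crossing_prob : Pr (fun G => ~~ `[< no_crossing r R G L M >]) <=
  p `^ (1 - 2 * lam - 4 * D%:R * c0) / w ^+ L.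
Proof.
apply: le_trans (crossing_sum r5 L p0 p1 w1 rho0 fixpt q_small b).
apply: (union_bound (ltW p0) p1) => [i /and4P[_ /subset_trans + _ _]|G GK].
  by apply; apply/pairsS/subsetT.
move=> /asboolPn no; apply: contrapT => nex; apply: no => th V F FG FV s le VM.
rewrite leqNgt; apply/negP => LV; apply: nex.
have V0 : V != set0 by rewrite -card_gt0; apply: leq_ltn_trans LV.
have [] := script_of s (subset_trans FG GK) VM V0.
  move=> e0; have := c0_gt0 R r5 => cp.
  have : c0 / 2 * (th%:R - #|V|%:R - 4 * D%:R) <= c0 * (th%:R - #|V|%:R - 4 * D%:R).
    by rewrite ler_wpM2r //; lra.
  lra.
move=> i si [eth eV eF]; exists i; last by rewrite -eF.
by rewrite /crossing si -eF -eV -eth FV LV le.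
Qed.

Definition bad_pairs G : {set {set T}} := [set e in K | `[< exists V F (th : nat),
  [/\ e \subset V, F \subset G, F \subset pairs V & (#|V| <= L)%N] /\
  [/\ scr th V F, (#|V| < th)%N & phi #|V| + c0 / 2 * (th%:R - #|V|%:R) <= #|F|%:R] >] ].

Lemma bad_mean : (L <= M)%N -> EX (fun G => #|bad_pairs G|%:R) <= L%:R ^+ 2 * p `^ (1 - 2 * lam) * (2 * q).
Proof.
move=> LM; apply: le_trans (bad_sum r5 L p0 p1 w1 rho0 fixpt q_small b).
rewrite (eq_bigr (fun i : script T b => EX (fun G => #|pairs i.2.1|%:R * (i.2.2 \subset G)%:R))); last first.
  move=> i /and4P[_ iV _ _].
  have iK : i.2.2 \subset K by apply: subset_trans iV _; apply/pairsS/subsetT.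
  rewrite -(EX_sub p iK) mulrC.
  exact: (esym (EXZ K p #|pairs i.2.1|%:R (fun G => (i.2.2 \subset G)%:R))).
rewrite -(EX_sum K p (bad R r L M (b := b)) (fun i G => #|pairs i.2.1|%:R * (i.2.2 \subset G)%:R)).
apply: (EX_le (ltW p0) p1) => G GK.
apply: le_trans (_ : #|\bigcup_(i in [pred i : script T b | bad R r L M i && (i.2.2 \subset G)]) pairs i.2.1|%:R <= _).
  rewrite ler_nat subset_leq_card //; apply/subsetP => e; rewrite inE => /andP[eK /asboolP].
  move=> [V [F [th [[eV FG FV VL] [s lt le]]]]].
  have V0 : V != set0.
    by rewrite -card_gt0; apply: leq_trans (subset_leq_card eV); rewrite (pairs_card eK).
  have [] := script_of s (subset_trans FG GK) (leq_trans VL LM) V0.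
    move=> e0; have := c0_gt0 R r5 => cp.
    have : c0 / 2 * (th%:R - #|V|%:R - 4 * D%:R) <= c0 / 2 * (th%:R - #|V|%:R).
      by rewrite ler_wpM2l //; [lra | rewrite gerBl mulr_ge0].
    lra.
  move=> i si [eth eVi eF]; apply/bigcupP; exists i.
    by rewrite !inE /bad si -eF -eVi -eth FV VL le FG.
  by rewrite -eVi pairsP // (pairs_card eK).
apply: le_trans (_ : (\sum_(i | bad R r L M i && (i.2.2 \subset G)) #|pairs i.2.1|)%N%:R <= _).
  rewrite ler_nat; apply: (big_rec2 (fun (A : {set {set T}}) k => (#|A| <= k)%N)); first by rewrite cards0.
  move=> i k A _ leAk; rewrite cardsU; apply: leq_trans (leq_subr _ _) _.
  by rewrite leq_add2l.
rewrite natr_sum big_mkcondr /=; apply: ler_sum => i _.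
by case: (_ \subset _); rewrite ?mulr1 ?mulr0.
Qed.

Lemma closure_cover G Z : G \subset K -> no_crossing r R G L M -> (1 < L)%N ->
  (L * L * L + (D + 3) * L <= M)%N -> Z \subset K ->
  (forall Z', G \subset Z' -> closed_E r Z' -> Z \subset Z') ->
  (#|Z| <= #|reached r L G| + #|bad_pairs G|)%N.
Proof.
move=> GK noX L1 LM ZK minZ.
apply: leq_trans (leq_card_setU _ _); apply/subset_leq_card/subsetP => e eZ.
have eK := subsetP ZK e eZ.
have [[V [F [t FG VL]]]|h] := structure r5 LM noX L1 GK minZ eZ.
  rewrite !inE; apply/orP; left; move: eK; rewrite inE => -> /=.
  apply/existsP; exists (V, F); rewrite /is_pure /= VL FG !andbT; exact/asboolP.
by rewrite inE; apply/orP; right; rewrite inE eK; apply/asboolP.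
Qed.

End Upper.

From mathcomp Require Import all_order all_algebra.
From mathcomp Require Import ring lra.
Import Order.TTheory GRing.Theory Num.Theory.

(** * The closure and its witness trees *)

Section Closure.
Variables (n r : nat).
Local Notation K := (pairs [set: 'I_n]).
Implicit Types (G Z E : {set {set 'I_n}}) (e f S V : {set 'I_n}).

Lemma KnE : Kn n = K.
Proof. by apply/setP => e; rewrite !inE subsetT. Qed.

Lemma Gnp_probE (R : realType) (p : R) A : Gnp_prob n p A = Pr K p A.
Proof. by rewrite /Gnp_prob /Pr KnE. Qed.

Lemma Kr_stepP E e : e \in Kr_step r E <->
  e \in E \/ exists S, [/\ #|S| = r, e \in pairs S & pairs S :\ e \subset E].
Proof.
rewrite !inE; split=> [/orP[->|]|[->//|[S [S_r eS sub]]]]; first by left.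
  move=> /andP[e2 /existsP[S /and3P[/eqP S_r eS /forall_inP h]]]; right; exists S; split => //.
    by rewrite inE eS e2.
  apply/subsetP => f /setD1P[nfe fS].
  have := h f; rewrite inE (pairs_card fS) eqxx (pairs_sub fS) (negbTE nfe) /=.
  by apply.
apply/orP; right; rewrite (pairs_card eS) eqxx /=; apply/existsP; exists S.
rewrite S_r eqxx (pairs_sub eS) /=; apply/forall_inP => f; rewrite inE => f2; apply/implyP => fS.
case: eqP => //= /eqP nfe; apply: (subsetP sub); rewrite in_setD1 nfe inE fS.
exact: f2.
Qed.

Lemma sub_Kr_step E : E \subset Kr_step r E.
Proof. by apply/subsetP => e eE; apply/Kr_stepP; left. Qed.

Lemma Kr_step_sub E : E \subset K -> Kr_step r E \subset K.
Proof.
move=> EK; apply/subsetP => e /Kr_stepP[/(subsetP EK)//|[S [_ eS _]]].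
exact: (subsetP (pairsS (subsetT S))).
Qed.

Lemma iter_Kr_step_sub k G : G \subset K -> iter k (Kr_step r) G \subset K.
Proof. by move=> GK; elim: k => //= k /Kr_step_sub. Qed.

Lemma sub_iter_Kr_step k G : G \subset iter k (Kr_step r) G.
Proof. elim: k => //= k IH; exact: subset_trans IH (sub_Kr_step _). Qed.

Lemma iter_Kr_step_fix k G : Kr_step r (iter k (Kr_step r) G) = iter k (Kr_step r) G \/
  k < #|iter k.+1 (Kr_step r) G|.
Proof.
elim: k => [|k [IH|IH]].
- have [->|ne] := eqVneq (Kr_step r G) G; first by left.
  right; rewrite /= card_gt0; apply: contraNneq ne => E0.
  by have := sub_Kr_step G; rewrite E0 subset0 eq_sym.
- by left; rewrite /= !IH.
have [E|ne] := eqVneq (Kr_step r (iter k.+1 (Kr_step r) G)) (iter k.+1 (Kr_step r) G); first by left.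
right; apply: leq_ltn_trans IH _; rewrite [in leqRHS]iterS; apply: proper_card.
by rewrite properEneq eq_sym ne sub_Kr_step.
Qed.

Lemma Kr_closure_fix G : G \subset K -> Kr_step r (Kr_closure r G) = Kr_closure r G.
Proof.
move=> GK; have [//|] := iter_Kr_step_fix #|Kn n| G.
by rewrite ltnNge KnE subset_leq_card // iter_Kr_step_sub.
Qed.

Lemma Kr_closure_sub G : G \subset K -> Kr_closure r G \subset K.
Proof. exact: iter_Kr_step_sub. Qed.

Lemma Kr_closure_closed G : G \subset K -> closed_E r (Kr_closure r G).
Proof.
move=> GK S e S_r eS sub; rewrite -Kr_closure_fix //; apply/Kr_stepP; right; by exists S.
Qed.

Lemma Kr_closure_min G Z : G \subset Z -> closed_E r Z -> Kr_closure r G \subset Z.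
Proof.
move=> GZ cZ; rewrite /Kr_closure; elim: #|Kn n| => //= k IH.
apply/subsetP => e /Kr_stepP[/(subsetP IH)//|[S [S_r eS sub]]].
by apply: cZ S_r eS (subset_trans sub IH).
Qed.

Lemma tr_closed Z e V F P : closed_E r Z -> tr r e V F P -> P = set0 -> F \subset Z -> e \in Z.
Proof.
move=> cZ; elim=> {e V F P} [f f2|f f2|f S V F P S_r fS tg IH VS VV].
- by rewrite sub1set.
- by move=> /setP/(_ f); rewrite !inE eqxx.
move=> P0 FZ; apply: (cZ S f S_r fS); apply/subsetP => g gS; apply: IH => //.
  by apply/eqP; rewrite -subset0 -P0; apply: (bigcup_sup g).
by apply: subset_trans FZ; apply: (bigcup_sup g).
Qed.

Lemma reached_sub_closure m G : G \subset K -> reached r m G \subset Kr_closure r G.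
Proof.
move=> GK; apply/subsetP => e; rewrite 2!inE => /andP[_ /existsP[[V F] /andP[/andP[/asboolP t _] FG]]].
apply: (tr_closed (Kr_closure_closed GK) t erefl).
exact: subset_trans FG (sub_iter_Kr_step _ _).
Qed.

End Closure.

(** * From a first moment and a lower tail to concentration *)

Section Concentration.
Local Open Scope ring_scope.
Variables (R : realFieldType) (X : finType) (K : {set X}) (p : R).
Hypotheses (p0 : 0 <= p) (p1 : p <= 1).
Implicit Types (G : {set X}).

(* Since a <= b and the lower tail of a is controlled, the upper tail of b only needs
   its first moment. *)
Lemma concentration (a b c d : {set X} -> R) (A : {set X} -> bool) (mu delta eps e1 e2 e3 : R) :
  0 < mu -> 0 < eps -> 0 <= delta <= eps -> delta <= 1 -> 
  (forall G, G \subset K -> 0 <= a G <= b G) -> (forall G, G \subset K -> b G <= c G) ->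
  (forall G, G \subset K -> 0 <= d G) ->
  (forall G, G \subset K -> ~~ A G -> c G <= b G + d G) ->
  EX K p b <= mu -> EX K p d <= e3 * mu ->
  Pr K p (fun G => a G < (1 - delta) * mu) <= e1 -> Pr K p A <= e2 ->
  Pr K p (fun G => eps < `|c G / mu - 1|) <= e1 + e2 + 2 * e3 / eps + 2 * (delta + e1) / eps.
Proof.
move=> mu0 eps0 /andP[d0 de] d1 ab bc dd cbd Eb Ed Pa PA.
pose ev1 G := a G < (1 - delta) * mu.
(* [b] can drop below its lower bound only on [ev1], where the last term compensates; so [Z] is
   nonnegative and Markov's inequality applies. *)
pose Z G : R := b G + (- ((1 - delta) * mu)) + (1 - delta) * mu * (ev1 G)%:R.
have mu1 : 0 <= (1 - delta) * mu by rewrite mulr_ge0 ?(ltW mu0) // subr_ge0.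
have Z0 G : G \subset K -> 0 <= Z G.
  move=> GK; have /andP[a0 aG] := ab G GK; rewrite /Z /ev1.
  by case: (ltP (a G)) => h; rewrite ?mulr1 ?mulr0; lra.
have EZ : EX K p Z <= (delta + e1) * mu.
  rewrite /Z EXD EXD EX_const EXZ -PrE.
  have : (1 - delta) * mu * Pr K p ev1 <= mu * e1.
    apply: ler_pM => //; first exact: Pr_ge0.
    by rewrite ler_piMl ?(ltW mu0) // gerBl.
  by move: (Pr K p ev1) => z; lra.
apply: le_trans (_ : Pr K p (fun G => (ev1 G || A G) || ((eps / 2 * mu <= d G) || (eps / 2 * mu <= Z G))) <= _).
  apply: Pr_sub => // G GK; rewrite -orbA; case: (boolP (ev1 G)) => //= n1'; have n1 := n1'; case: (boolP (A G)) => //= nA.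
  have /andP[a0 aG] := ab G GK; have bcG := bc G GK; have cG := cbd G GK nA.
  rewrite /ev1 -leNgt in n1; rewrite ltr_normr => /orP[].
    rewrite ltrBrDl ltr_pdivlMr // => cmu; case: (leP _ (d G)) => //= dl.
    rewrite /Z (negbTE (n1' : ~~ ev1 G)) mulr0 addr0.
    have : 0 <= delta * mu by rewrite mulr_ge0 // ltW.
    lra.
  rewrite opprB ltrBrDr -ltrBrDl ltr_pdivrMr // => cmu.
  have : delta * mu <= eps * mu by rewrite ler_wpM2r // ltW.
  lra.
apply: le_trans (Pr_or _ p0 p1 _ _) _; rewrite -addrA; apply: lerD.
  by apply: le_trans (Pr_or _ p0 p1 _ _) _; apply: lerD.
have eps2 : 0 < eps / 2 * mu by rewrite mulr_gt0 // divr_gt0.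
apply: le_trans (Pr_or _ p0 p1 _ _) _; apply: lerD.
  apply: le_trans (markov p0 p1 eps2 dd _) _ => //.
  rewrite ler_pdivrMr //; apply: le_trans Ed _; rewrite le_eqVlt; apply/orP; left; apply/eqP.
  by field; rewrite gt_eqF.
apply: le_trans (markov p0 p1 eps2 Z0 _) _ => //.
rewrite ler_pdivrMr //; apply: le_trans EZ _; rewrite le_eqVlt; apply/orP; left; apply/eqP.
by field; rewrite gt_eqF.
Qed.

End Concentration.

From mathcomp Require Import classical_sets topology normedtype sequences.
Import Order.TTheory GRing.Theory Num.Theory.

(** * Asymptotics *)

Section FirstRoot.
Local Open Scope ring_scope.
Variable R : realType.

Lemma bernoulli (z : R) k : 0 <= z <= 1 -> 1 - k%:R * z <= (1 - z) ^+ k.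
Proof.
move=> /andP[z0 z1]; elim: k => [|k IH]; first by rewrite mul0r subr0 expr0.
rewrite exprSr; apply: le_trans (_ : (1 - k%:R * z) * (1 - z) <= _).
  have : 0 <= k%:R * (z * z) by rewrite !mulr_ge0.
  by rewrite -natr1; lra.
by rewrite ler_wpM2r // subr_ge0.
Qed.

(** If t < rho were not good, the supremum s of the good values would be below rho and satisfy 1 +
    s^d / a <= s. Then a (z - 1) - z^d changes sign on [1, s] and has a root strictly between 1 and
    rho. *)
Lemma below_first_root (Good : R -> Prop) (a rho : R) (d : nat) : 0 < a ->
  Good 0 -> (forall t, Good t -> 0 <= t) ->
  (forall t u, Good t -> 0 <= u -> u <= t -> Good u) ->
  (forall t u, Good t -> 0 <= u -> u < 1 + t ^+ d / a -> Good u) ->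
  (forall z : R, 1 < z < rho -> z ^+ d != a * (z - 1)) ->
  forall t, 0 <= t -> t < rho -> Good t.
Proof.
move=> a0 G0 Gge Gdown Gstep noroot t0 t00 t0rho; apply: contrapT => nG.
have ub t : Good t -> t <= t0.
  by move=> Gt; rewrite leNgt; apply/negP => lt; apply: nG; apply: Gdown Gt t00 (ltW lt).
have hs : has_sup Good by split; [exists 0 | exists t0 => t /ub].
set s := sup Good; have sub t : Good t -> t <= s by move=> Gt; apply: sup_upper_bound hs _ Gt.
have st0 : s <= t0 by apply: ge_sup; [exists 0 | move=> t /ub].
have step t : Good t -> 1 + t ^+ d / a <= s.
  move=> Gt; rewrite leNgt; apply/negP => lt.
  have s0 : 0 <= s by apply: sub.
  have : Good ((s + (1 + t ^+ d / a)) / 2) by apply: Gstep Gt _ _; lra.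
  by move/sub; lra.
have s1 : 1 <= s.
  apply: le_trans (step 0 G0); by rewrite lerDl divr_ge0 ?(ltW a0) // exprn_ge0.
have s0 : 0 <= s by apply: le_trans s1.
have fix_le : 1 + s ^+ d / a <= s.
  rewrite leNgt; apply/negP => lt.
  set c := s ^+ d / a in lt; have c0 : 0 <= c by rewrite divr_ge0 ?(ltW a0) // exprn_ge0.
  (* Continuity made explicit: by Bernoulli's inequality, replacing s by (1 - eta) s lowers the step
     by at most half of the gap 1 + c - s. *)
  pose eta : R := Num.min 1 ((1 + c - s) / (2 * (d%:R * c + 1))).
  have dc0 : 0 <= d%:R * c by rewrite mulr_ge0.
  have dc : 0 < 2 * (d%:R * c + 1) by rewrite mulr_gt0 // ltr_pwDr.
  have eta0 : 0 < eta by rewrite lt_min ltr01 divr_gt0 //; lra.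
  have eta1 : eta <= 1 by rewrite ge_min lexx.
  have etac : eta * (2 * (d%:R * c + 1)) <= 1 + c - s.
    by rewrite -ler_pdivlMr // ge_min lexx orbT.
  have [t Gt lt_t] := sup_adherent (mulr_gt0 eta0 (lt_le_trans ltr01 s1)) hs.
  have := step t Gt; rewrite leNgt => /negP; apply.
  apply: lt_le_trans (_ : 1 + (1 - d%:R * eta) * c <= _).
    have : 0 < eta * 2 by lra.
    nra.
  rewrite lerD2l /c mulrA ler_pdivlMr // divfK ?gt_eqF //.
  apply: le_trans (_ : ((1 - eta) * s) ^+ d <= _).
    by rewrite exprMn ler_wpM2r ?exprn_ge0 // bernoulli // eta1 (ltW eta0).
  have e1 : 0 <= (1 - eta) * s by rewrite mulr_ge0 ?subr_ge0 //; lra.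
  apply: lerXn2r; rewrite ?nnegrE // ?Gge //.
  by apply: ltW; apply: le_lt_trans lt_t; rewrite -/s mulrBl mul1r.
pose P : {poly R} := a *: ('X - 1%:P) - 'X^d.
have PE z : P.[z] = a * (z - 1) - z ^+ d by rewrite /P !hornerE.
have P1 : P.[1] <= 0 by rewrite PE subrr mulr0 expr1n; lra.
have Ps : 0 <= P.[s].
  by rewrite PE subr_ge0 mulrC -ler_pdivrMr //; lra.
have [|z /andP[z1 zs]] := poly_ivt s1 (p := P); first by rewrite P1 Ps.
rewrite rootE PE subr_eq0 eq_sym => /eqP rz.
suff /noroot : 1 < z < rho by rewrite rz eqxx.
rewrite (le_lt_trans (le_trans zs st0) t0rho) andbT lt_neqAle z1 andbT.
apply/eqP => E; move: rz; rewrite -E subrr mulr0 expr1n => /eqP.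
by rewrite oner_eq0.
Qed.

End FirstRoot.

Lemma ffact_ge N k : (k <= N)%N -> ((N - k) ^ k <= N ^_ k)%N.
Proof.
elim: k N => [|k IH] [|N] //= kN; rewrite ffactnS /= expnS leq_mul ?leq_subr //.
by apply: leq_trans (IH N kN); rewrite subSS.
Qed.

(** * The recursion below the first root *)

Section TreeDensity.
Local Open Scope ring_scope.
Variables (R : realType) (r : nat).
Hypothesis r5 : (4 < r)%N.
Local Notation D := ('C(r, 2) - 1)%N.
Variables (gamma gb : R).
Hypotheses (gamma0 : 0 < gamma) (gamma_gb : gamma < gb).
Hypothesis gammaE : (r - 2)`!%:R * gamma ^+ (r - 2) = D%:R ^+ D / (D - 1)%N%:R ^+ (D - 1).
Let a : R := (r - 2)`!%:R * gb ^+ (r - 2).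

(* D / (D - 1) maximizes (t - 1) / t ^ D, hence satisfies the fixed point inequality
   strictly for every weight below the critical one. *)
Definition rho' : R := D%:R / (D - 1)%N%:R.
(** A total vertex weight strictly between the actual one, 1 / gb, and the critical one, 1 /
    gamma. *)
Definition s0 : R := ((gamma + gb) / 2)^-1.

Lemma gb_gt0 : 0 < gb. Proof. exact: lt_trans gamma_gb. Qed.

Lemma D_gt1 : (1 < D)%N.
Proof. by have := bin2_ge10 r5; move: ('C(r, 2)) => c; clear; lia. Qed.

Lemma rho'_gt1 : 1 < rho'.
Proof.
have := D_gt1; case E: D => [|[|d]] // _.
by rewrite /rho' E !subSS subn0 ltr_pdivlMr ?ltr0n // mul1r ltr_nat.
Qed.

Lemma rho'_fix : rho' ^+ D = (rho' - 1) * (D%:R ^+ D / (D - 1)%N%:R ^+ (D - 1)).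
Proof.
rewrite /rho'; have := D_gt1; case: D => [|[|d]] // _; rewrite !subSS subn0.
have d0 : d.+1%:R != 0 :> R by rewrite pnatr_eq0.
have -> : d.+2%:R / d.+1%:R - 1 = d.+1%:R^-1 :> R.
  by rewrite -[d.+2%:R]natr1; move: d0; move: (d.+1%:R : R) => z z0; field.
rewrite expr_div_n (exprS d.+1%:R d.+1); have : d.+1%:R ^+ d.+1 != 0 :> R by rewrite expf_neq0.
by move: (_ ^+ d.+1) (_ ^+ d.+2) d0 => u v; move: (d.+1%:R : R) => z z0 u0; field; rewrite ?z0 ?u0.
Qed.

Lemma s0_gt0 : 0 < s0.
Proof. by rewrite /s0 invr_gt0 divr_gt0 // addr_gt0 // gb_gt0. Qed.

Lemma gb_s0 : 1 < gb * s0.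
Proof. rewrite /s0 ltr_pdivlMr; last by rewrite divr_gt0 // addr_gt0 // gb_gt0.
by have := gamma_gb; lra. Qed.

(** The critical equation turns the left side into 1 + (rho' - 1) (s0 gamma)^(r - 2), and s0 gamma <
    1. *)
Lemma slack : 1 + s0 ^+ (r - 2) / (r - 2)`!%:R * rho' ^+ D < rho'.
Proof.
rewrite rho'_fix -gammaE.
have f0 : (r - 2)`!%:R != 0 :> R by rewrite pnatr_eq0 -lt0n fact_gt0.
have -> : s0 ^+ (r - 2) / (r - 2)`!%:R * ((rho' - 1) * ((r - 2)`!%:R * gamma ^+ (r - 2))) =
   (rho' - 1) * (s0 * gamma) ^+ (r - 2).
  rewrite exprMn; move: (s0 ^+ _) (gamma ^+ _) => u v; by field.
rewrite -ltrBrDl gtr_pMr ?subr_gt0 ?rho'_gt1 //.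
have sg : 0 <= s0 * gamma by rewrite mulr_ge0 ?ltW ?s0_gt0.
rewrite exprn_ilt1 //; first by rewrite -lt0n subn_gt0; apply: leq_trans r5.
rewrite /s0 mulrC ltr_pdivrMr; last by rewrite divr_gt0 // addr_gt0 // gb_gt0.
by have := gamma_gb; lra.
Qed.

Lemma a_gt0 : 0 < a.
Proof. by rewrite mulr_gt0 ?ltr0n ?fact_gt0 // exprn_gt0 // gb_gt0. Qed.

Lemma under_slack z : 0 <= z -> z <= s0 ->
  1 + z ^+ (r - 2) / (r - 2)`!%:R * rho' ^+ D <= rho'.
Proof.
move=> z0 zs; apply: le_trans (ltW slack); rewrite lerD2l ler_wpM2r //.
  by rewrite exprn_ge0 // ltW // (lt_trans _ rho'_gt1).
by rewrite ler_wpM2r ?invr_ge0 // lerXn2r // nnegrE // ltW // s0_gt0.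
Qed.

Lemma clique_weight_ge n : (r <= n)%N ->
  (1 - (r - 2)%N%:R * (r%:R / n%:R)) / a <= (gb * n%:R)^-1 ^+ (r - 2) * 'C(n - 2, r - 2)%:R.
Proof.
move=> rn; have n0 : 0 < n%:R :> R by rewrite ltr0n; apply: leq_trans rn; apply: leq_trans r5.
have gb0 := gb_gt0.
rewrite ler_pdivrMr ?a_gt0 //.
apply: le_trans (bernoulli _ _) _.
  by rewrite divr_ge0 //= ler_pdivrMr // mul1r ler_nat.
have -> : 1 - r%:R / n%:R = (n - r)%N%:R / n%:R :> R.
  by rewrite natrB // mulrBl divff // gt_eqF.
have : (n - r)%N%:R ^+ (r - 2) <= 'C(n - 2, r - 2)%:R * (r - 2)`!%:R :> R.
  rewrite -natrX -natrM ler_nat bin_ffact.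
  have := @ffact_ge (n - 2) (r - 2); rewrite leq_sub2r // => /(_ isT).
  by rewrite (_ : (n - 2 - (r - 2) = n - r)%N) //; move: r5 rn; clear; lia.
rewrite /a expr_div_n exprVn [(gb * _) ^+ _]exprMn => le.
rewrite ler_pdivrMr ?exprn_gt0 //; apply: le_trans le _.
rewrite le_eqVlt; apply/orP; left; apply/eqP.
have : gb ^+ (r - 2) != 0 by rewrite expf_neq0 // gt_eqF.
have : n%:R ^+ (r - 2) != 0 :> R by rewrite expf_neq0 // gt_eqF.
move: (gb ^+ _) (n%:R ^+ _) => u v v0 u0; field.
by rewrite v0 u0.
Qed.

Lemma clique_weight_le n (f : {set 'I_n}) : (0 < n)%N -> #|f| = 2%N ->
  (gb * n%:R)^-1 ^+ (r - 2) * #|[set S : {set 'I_n} | (#|S| == r) && (f \in pairs S)]|%:R <= a^-1.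
Proof.
move=> n0 f2; have gb0 := gb_gt0; have nR : 0 < n%:R :> R by rewrite ltr0n.
have := @clique_sum R 'I_n r (fun=> 1) (fun=> ler01) f f2.
rewrite sumr_const card_ord (eq_bigr (fun=> 1)) => [|S _]; last by rewrite big1.
rewrite sumr_const -[1 *+ _]/(_%:R) -[1 *+ _]/(_%:R) => le.
have -> : #|[set S : {set 'I_n} | (#|S| == r) && (f \in pairs S)]| =
   #|[pred S : {set 'I_n} | (#|S| == r) && (f \in pairs S)]|.
  by apply: eq_card => S; rewrite inE.
rewrite exprVn ler_pdivrMl ?exprn_gt0 ?mulr_gt0 //; apply: le_trans le _.
rewrite le_eqVlt; apply/orP; left; apply/eqP; rewrite /a exprMn invfM.
have : gb ^+ (r - 2) != 0 by rewrite expf_neq0 // gt_eqF.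
have f0 : (r - 2)`!%:R != 0 :> R by rewrite pnatr_eq0 -lt0n fact_gt0.
move: (gb ^+ _) (n%:R ^+ _) => u v u0; field.
by rewrite f0 u0.
Qed.

Local Open Scope classical_set_scope.

Definition good (t : R) : Prop := 0 <= t /\ exists m, \forall n \near \oo,
  forall f : {set 'I_n}, #|f| = 2%N -> t <= pure_sum r (fun=> (gb * n%:R)^-1) m f.

Lemma good_step t u : good t -> 0 <= u -> u < 1 + t ^+ D / a -> good u.
Proof.
move=> [t0 [m nm]] u0 ut; split=> //; exists (D * m + 2)%N.
(* With kappa = c n the total weight x (n + kappa) is exactly [s0]. *)
pose c := gb * s0 - 1; have c0 : 0 < c by rewrite subr_gt0 gb_s0.
have gb0 := gb_gt0.
pose B := D%:R ^+ 2 * rho' ^+ D * (r%:R / c + 1 / c ^+ 2).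
(* C / n is the total error: the first term comes from the number of cliques, the second from dirty
   tuples. *)
pose C := (r - 2)%N%:R * r%:R * (t ^+ D / a) + a^-1 * B.
near=> n => f f2.
have rn : (r <= n)%N by near: n; apply: nbhs_infty_ge.
have n0 : (0 < n)%N by apply: leq_trans rn; apply: leq_trans r5.
have nR : 0 < n%:R :> R by rewrite ltr0n.
have kap1 : 1 <= c * n%:R.
  by rewrite -ler_pdivrMl // mulr1; near: n; apply: nbhs_infty_ger.
have Cn : C / n%:R <= 1 + t ^+ D / a - u.
  rewrite ler_pdivrMr // mulrC -ler_pdivrMr ?subr_gt0 //; near: n; apply: nbhs_infty_ger.
have x0 : 0 <= (gb * n%:R)^-1 by rewrite invr_ge0 mulr_ge0 // ltW.
have rho0 : 0 <= rho' by rewrite ltW // (lt_trans _ rho'_gt1).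
have fx : 1 + ((gb * n%:R)^-1 * (#|'I_n|%:R + c * n%:R)) ^+ (r - 2) / (r - 2)`!%:R * rho' ^+ D <= rho'.
  apply: under_slack; first by rewrite mulr_ge0 // addr_ge0 // mulr_ge0 // ltW.
  rewrite card_ord le_eqVlt; apply/orP; left; apply/eqP; rewrite /c; field.
  by rewrite !gt_eqF.
have IH : forall g : {set 'I_n}, #|g| = 2%N -> t <= pure_sum r (fun=> (gb * n%:R)^-1) m g.
  by near: n.
have := pure_sum_step r5 x0 rho0 kap1 fx f2 (leq_addl _ 2) (leq_addr _ _) t0 IH.
apply: le_trans; rewrite card_ord.
have dirtE : D%:R ^+ 2 * rho' ^+ D * (r%:R / (c * n%:R) + n%:R / (c * n%:R) ^+ 2) = B / n%:R.
  rewrite /B; move: (D%:R ^+ 2 * rho' ^+ D) => z; field.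
  by rewrite !gt_eqF.
rewrite dirtE mulrA [X in _ - X]mulrA.
have w1 := clique_weight_ge rn; have w2 := clique_weight_le n0 f2.
have B0 : 0 <= B.
  by rewrite /B !mulr_ge0 ?exprn_ge0 // addr_ge0 // divr_ge0 ?exprn_ge0 ?(ltW c0).
apply: le_trans (_ : 1 + (1 - (r - 2)%N%:R * (r%:R / n%:R)) / a * t ^+ D - a^-1 * (B / n%:R) <= _).
  have -> : 1 + (1 - (r - 2)%N%:R * (r%:R / n%:R)) / a * t ^+ D - a^-1 * (B / n%:R) =
     1 + t ^+ D / a - C / n%:R.
    rewrite /C; move: (t ^+ D) => z; field.
    by rewrite !gt_eqF // a_gt0.
  by lra.
apply: lerB; first by rewrite lerD2l ler_wpM2r // exprn_ge0.
by rewrite ler_wpM2r // divr_ge0 // ltW.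
Unshelve. all: by end_near.
Qed.

Lemma good_lt (rho : R) : (forall z : R, 1 < z < rho -> z ^+ D != a * (z - 1)) ->
  forall t, 0 <= t -> t < rho -> good t.
Proof.
move=> noroot; apply: (below_first_root a_gt0 _ _ _ _ noroot).
- split=> //; exists 0%N; near=> n => f _; apply: pure_sum_ge0 => _.
  by rewrite invr_ge0 mulr_ge0 // ltW // gb_gt0.
- by move=> t [].
- move=> t u [t0 [m nm]] u0 ut; split=> //; exists m; near=> n => f f2; apply: le_trans ut _.
  by move: f f2; near: n.
- exact: good_step.
Unshelve. all: by end_near.
Qed.

End TreeDensity.

(** * Geometric against polynomial decay *)

Section ExpBound.
Local Open Scope ring_scope.
Variable R : realType.

Lemma expR_ge_pow (v : R) k : 0 <= v -> (v / k.+1%:R) ^+ k.+1 <= expR v.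
Proof.
move=> v0; have -> : expR v = expR (v / k.+1%:R) ^+ k.+1.
  by rewrite -expRM_natr divfK // pnatr_eq0.
apply: lerXn2r; rewrite ?nnegrE ?divr_ge0 ?expR_ge0 //.
by apply: le_trans (expR_ge1Dx _); rewrite lerDr.
Qed.

(** Rounding down 1/z loses one factor w, and exp v >= (v / (j + 1))^(j + 1) at v = ln w / z leaves
    one power of z to spare. *)
Lemma geometric_beats_power (w : R) j : 1 < w -> exists C, 0 <= C /\
  forall z : R, 0 < z -> (z^-1) ^+ j / w ^+ Num.truncn (z^-1) <= C * z.
Proof.
move=> w1; have u0 := ln_gt0 w1; have w0 : 0 < w by apply: lt_trans w1.
exists (w * (j.+1%:R / ln w) ^+ j.+1); split.
  by rewrite mulr_ge0 ?exprn_ge0 ?divr_ge0 ?ltW.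
move=> z z0; set L := Num.truncn _.
have zi : 0 <= z^-1 by rewrite invr_ge0 ltW.
have /andP[_ Lz] := truncn_itv zi.
have le : (z^-1 * ln w / j.+1%:R) ^+ j.+1 <= w ^+ L.+1.
  apply: le_trans (expR_ge_pow _ _) _; first by rewrite mulr_ge0 // ltW.
  rewrite -[in leRHS](@lnK R w) ?posrE // -expRM_natl ler_expR ler_pM2r //.
  exact: ltW.
rewrite ler_pdivrMr ?exprn_gt0 //.
apply: le_trans (_ : (j.+1%:R / ln w) ^+ j.+1 * z * w ^+ L.+1 <= _); last first.
  by rewrite (exprS w L); move: (w ^+ L) (_ ^+ j.+1) => a b; rewrite le_eqVlt; apply/orP; left; apply/eqP; ring.
have E : (z^-1) ^+ j = (j.+1%:R / ln w) ^+ j.+1 * z * (z^-1 * ln w / j.+1%:R) ^+ j.+1.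
  have -> : (j.+1%:R / ln w) ^+ j.+1 * z * (z^-1 * ln w / j.+1%:R) ^+ j.+1 =
      z * ((j.+1%:R / ln w) * (z^-1 * ln w / j.+1%:R)) ^+ j.+1.
    by rewrite [in RHS]exprMn; ring.
  have -> : j.+1%:R / ln w * (z^-1 * ln w / j.+1%:R) = z^-1.
    have : j.+1%:R != 0 :> R by rewrite pnatr_eq0.
    by move: (j.+1%:R : R) => J J0; field; rewrite J0 !gt_eqF.
  by rewrite exprS mulrA divff ?mul1r // gt_eqF.
by rewrite E ler_wpM2l // !mulr_ge0 ?exprn_ge0 ?divr_ge0 ?ltW.
Qed.

End ExpBound.

Section Reached.
Local Open Scope ring_scope.
Variables (R : realType) (T : finType) (r : nat).
Hypothesis r5 : (4 < r)%N.
Local Notation K := (pairs [set: T]).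
Implicit Types (G : {set {set T}}).

Lemma reachedS m m' G : (m <= m')%N -> reached r m G \subset reached r m' G.
Proof.
move=> mm; apply/fintype.subsetP => e; rewrite !finset.inE => /andP[-> /existsP[u /andP[/andP[tu um] uG]]] /=.
by apply/existsP; exists u; rewrite /is_pure tu uG (leq_trans um mm).
Qed.

Lemma reached_le_count m G : #|reached r m G|%:R <= tree_count R r m G.
Proof.
rewrite /tree_count -sum1_card natr_sum.
apply: le_trans (@sum_cover R _ _ (mem (reached r m G))
  (fun w : tree_at T => is_tree_at r m w && (w.2.2 \subset G)) (fun w => w.1) (fun=> 1) _ _) _ => //.
  move=> e eR; move: (eR : e \in reached r m G); rewrite !finset.inE => /andP[eK /existsP[u /andP[pu uG]]].
  by exists (e, u) => //; rewrite /is_tree_at /= finset.inE eK pu.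
by rewrite big_mkcondr; apply: ler_sum => w _; case: (_ \subset _).
Qed.

Variables (p rho : R).
Hypotheses (p0 : 0 < p) (p1 : p <= 1) (rho0 : 0 <= rho).
Hypothesis fx : 1 + (p `^ lam R r * #|T|%:R) ^+ (r - 2) / (r - 2)`!%:R * rho ^+ ('C(r, 2) - 1) <= rho.

Lemma reached_mean m : EX K p (fun G => #|reached r m G|%:R) <= rho * (p * 'C(#|T|, 2)%:R).
Proof.
apply: le_trans (EX_le (ltW p0) p1 (g := tree_count R r m) _) _.
  by move=> G _; apply: reached_le_count.
rewrite (EX_tree_count _ r5 p0) /mean mulrCA ler_wpM2l ?(ltW p0) //.
apply: le_trans (_ : \sum_(e in K) rho <= _).
  apply: ler_sum => e _; apply: (pure_sum_le r5) => // [v|]; first exact: powR_ge0.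
  by rewrite sumr_const -[_ *+ _]mulr_natr.
by rewrite sumr_const -[_ *+ _]mulr_natr card_pairs cardsT.
Qed.

End Reached.

(** * Tail estimates as n grows *)

Section Asymptotics.
Local Open Scope classical_set_scope.
Local Open Scope ring_scope.
Variables (R : realType) (r : nat).
Hypothesis r5 : (4 < r)%N.
Local Notation D := ('C(r, 2) - 1)%N.
Local Notation lam := (lam R r).
Local Notation c0 := (c0 R r).
Variables (gamma gb : R).
Hypotheses (gamma0 : 0 < gamma) (gamma_gb : gamma < gb).
Hypothesis gammaE : (r - 2)`!%:R * gamma ^+ (r - 2) = D%:R ^+ D / (D - 1)%N%:R ^+ (D - 1).
Local Notation a := ((r - 2)`!%:R * gb ^+ (r - 2)).
Variable rho : R.
Hypotheses (rho1 : 1 < rho) (rhoE : rho ^+ D = a * (rho - 1)).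
Hypothesis noroot : forall z : R, 1 < z < rho -> z ^+ D != a * (z - 1).

Definition edge_prob (n : nat) : R := (gb * n%:R) `^ (- lam^-1).
Local Notation p := edge_prob.
Local Notation K n := (pairs [set: 'I_n]%SET).
Local Notation edges n := (p n * 'C(n, 2)%:R).

Let gb0 : 0 < gb. Proof. exact: gb_gt0 gamma_gb. Qed.
Let lam0 : 0 < lam. Proof. exact: lt_le_trans ltr01 (lam_ge1 R r5). Qed.

Lemma p_gt0 n : (0 < n)%N -> 0 < p n.
Proof. by move=> n0; rewrite powR_gt0 // mulr_gt0 // ltr0n. Qed.

Lemma p_lam n : (0 < n)%N -> p n `^ lam = (gb * n%:R)^-1.
Proof.
by move=> n0; rewrite -powRrM mulNr mulVf ?gt_eqF // powR_inv1 // mulr_ge0 // ltW.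
Qed.

Lemma p_small (b delta : R) : 0 < b -> 0 < delta -> \forall n \near \oo, p n `^ b < delta.
Proof.
move=> b0 d0; pose c := b / lam; have c_gt0 : 0 < c by rewrite divr_gt0.
near=> n.
have -> : p n `^ b = ((gb * n%:R) `^ c)^-1.
  by rewrite -powRN -powRrM /c; congr (_ `^ _); rewrite mulNr mulrC.
rewrite -[delta]invrK ltf_pV2 ?posrE ?invr_gt0 //; last first.
  rewrite powR_gt0 // mulr_gt0 // ltr0n; near: n; exact: nbhs_infty_gt.
have -> : delta^-1 = (delta^-1 `^ c^-1) `^ c.
  by rewrite -powRrM mulVf ?gt_eqF // powRr1 // invr_ge0 ltW.
apply: gt0_ltr_powR; rewrite ?nnegrE ?powR_ge0 ?mulr_ge0 ?(ltW gb0) //.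
rewrite mulrC -ltr_pdivrMr //; near: n; exact: nbhs_infty_gtr.
Unshelve. all: by end_near.
Qed.

Lemma p_le1 : \forall n \near \oo, p n <= 1.
Proof.
near=> n; have : p n `^ 1 < 1 by near: n; apply: p_small.
by rewrite powRr1 ?powR_ge0 // => /ltW.
Unshelve. all: by end_near.
Qed.

(** The volume factor in all pair and script estimates equals p (gb n)^2, hence is of the order of
    the expected number of edges. *)
Lemma edges_ge n : (1 < n)%N -> p n `^ (1 - 2 * lam) <= 4 * gb ^+ 2 * edges n.
Proof.
move=> n1; have n0 : (0 < n)%N by apply: ltnW.
have pp := p_gt0 n0; have nR : 0 < n%:R :> R by rewrite ltr0n.
rewrite (powRDp pp) powRr1 ?(ltW pp) // [4 * gb ^+ 2 * _]mulrCA ler_pM2l //.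
have -> : p n `^ (- (2 * lam)) = (gb * n%:R) ^+ 2.
  rewrite powRN mulrC powRrM p_lam // powR_mulrn ?invr_ge0 ?mulr_ge0 ?(ltW gb0) //.
  by rewrite exprVn invrK.
rewrite exprMn [4 * _]mulrC -[leRHS]mulrA ler_pM2l ?exprn_gt0 //.
rewrite -natrX -natrM ler_nat; have := twice_bin2 n; move: n1; clear; case: n => // n.
by rewrite /= => n1; rewrite (_ : 4 = 2 * 2)%N // -mulnA => ->; nia.
Qed.

Lemma edges_gt0 n : (1 < n)%N -> 0 < edges n.
Proof. by move=> n1; rewrite mulr_gt0 ?p_gt0 ?ltr0n ?bin_gt0 // ltnW. Qed.

Lemma edges_inv n : (1 < n)%N -> p n <= 1 -> (edges n)^-1 <= 4 * gb ^+ 2 * p n.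
Proof.
move=> n1 p1; have pp := p_gt0 (ltnW n1); have e0 := edges_gt0 n1.
have h : (p n)^-1 <= 4 * gb ^+ 2 * edges n.
  apply: le_trans (edges_ge n1); rewrite -[(p n)^-1]powR_inv1 ?(ltW pp) //.
  by apply: ger_powR; rewrite ?pp //; have := lam_ge1 R r5; lra.
move: h e0; move: (edges n) (4 * gb ^+ 2) => N c h N0.
by rewrite -[leLHS]mul1r ler_pdivrMr // mulrAC -ler_pdivrMr // mul1r.
Qed.

Lemma lower_tail (delta e : R) : 0 < delta -> delta <= 1 -> 0 < e -> exists m, \forall n \near \oo,
  Pr (K n) (p n) (fun G => #|reached r m G|%:R < (1 - delta) * (rho * edges n)) <= e.
Proof.
move=> d0 d1 e0; have rp : 0 < rho by apply: lt_trans rho1.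
have dr : 0 < delta * rho by rewrite mulr_gt0.
have [||_ [m nm]] := good_lt r5 gamma0 gamma_gb gammaE noroot (t := (1 - delta / 2) * rho).
- by rewrite mulr_ge0 ?(ltW rp) //; lra.
- by lra.
exists m; pose c1 := 4 * gb ^+ 2; pose Kc : R := (shapes m)%:R ^+ 2 * expR (3 / gb).
(* Half of delta goes to the recursion, which only approaches rho, and a quarter to each deviation
   in [reached_lower]. *)
pose k := delta * rho / 4; have k0 : 0 < k by rewrite divr_gt0.
have c10 : 0 < c1 by rewrite mulr_gt0 ?exprn_gt0.
have Kc0 : 0 < Kc by rewrite mulr_gt0 ?expR_gt0 // exprn_gt0 // ltr0n muln_gt0 !expn_gt0.
have q1 : 0 < c1 ^+ 2 * Kc / k ^+ 2.
  exact: (divr_gt0 (mulr_gt0 (exprn_gt0 2 c10) Kc0) (exprn_gt0 2 k0)).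
have q2 : 0 < c1 * Kc / k by exact: (divr_gt0 (mulr_gt0 c10 Kc0) k0).
near=> n.
have n1 : (1 < n)%N by near: n; exact: nbhs_infty_gt.
have n0 := ltnW n1; have pp := p_gt0 n0; have ep := edges_gt0 n1.
have p1 : p n <= 1 by near: n; exact: p_le1.
have nR : 0 < n%:R :> R by rewrite ltr0n.
set N := edges n; have N0 : 0 < N by []; have A0 : 0 < k * N by rewrite mulr_gt0.
have meanE : (1 - delta / 2) * rho * N <= mean 'I_n r (p n) m.
  rewrite /mean /N mulrCA ler_pM2l // mulrC.
  apply: le_trans (_ : \sum_(f in K n) (1 - delta / 2) * rho <= _).
    by rewrite sumr_const card_pairs cardsT card_ord mulr_natl.
  by rewrite p_lam //; apply: ler_sum => f /pairs_card f2; move: f f2; near: n.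
apply: le_trans (_ : Pr (K n) (p n) (fun G => #|reached r m G|%:R < mean 'I_n r (p n) m - k * N - k * N) <= _).
  apply: (Pr_sub (ltW pp) p1) => G _ lt; apply: lt_le_trans lt _.
  have -> : (1 - delta) * (rho * N) = (1 - delta / 2) * rho * N - k * N - k * N by rewrite /k; field.
  by rewrite !lerD2r.
apply: le_trans (reached_lower _ r5 pp p1 m A0 A0) _.
have psum : pair_sum 'I_n r (p n) m <= Kc.
  apply: le_trans (pair_sum_le _ r5 _ _) _; rewrite card_ord ler_wpM2l ?exprn_ge0 //.
  rewrite p_lam //; apply: le_trans (_ : expR (3 * (gb * n%:R)^-1) ^+ n <= _).
    by rewrite lerXn2r ?nnegrE ?expR_ge0 ?expR_ge1Dx // addr_ge0 // mulr_ge0 // invr_ge0 mulr_ge0 ?(ltW gb0).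
  rewrite -expRM_natr ler_expR le_eqVlt; apply/orP; left; apply/eqP; field.
  by rewrite !gt_eqF.
have pi := edges_inv n1 p1; have vol := edges_ge n1; rewrite -/N -/c1 in pi vol.
have crossE : cross 'I_n r (p n) m / (k * N) ^+ 2 <= c1 ^+ 2 * Kc / k ^+ 2 * p n.
  rewrite ler_pdivrMr ?exprn_gt0 //; apply: le_trans (cross_le _ r5 pp p1 m) _.
  apply: le_trans (_ : c1 * N * Kc <= _).
    by apply: ler_pM => //; [exact: powR_ge0 | apply: sumr_ge0 => w _; apply: sumr_ge0 => w' _; rewrite exprn_ge0 // powR_ge0].
  have -> : c1 ^+ 2 * Kc / k ^+ 2 * p n * (k * N) ^+ 2 = c1 * N * Kc * (c1 * p n * N).
    by field; rewrite gt_eqF.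
  rewrite -[X in X <= _]mulr1; apply: ler_wpM2l; first exact: (mulr_ge0 (mulr_ge0 (ltW c10) (ltW N0)) (ltW Kc0)).
  by rewrite -(mulVf (lt0r_neq0 N0)) ler_pM2r.
have coinE : coincide 'I_n r (p n) m / (k * N) <= c1 * Kc / k * p n `^ ((r - 2)%N%:R^-1).
  rewrite ler_pdivrMr //; apply: le_trans (coincide_le _ r5 pp p1 m) _.
  apply: le_trans (_ : c1 * N * p n `^ ((r - 2)%N%:R^-1) * Kc <= _).
    rewrite (powRDp pp); apply: ler_pM; rewrite ?mulr_ge0 ?powR_ge0 //; last by rewrite ler_wpM2r ?powR_ge0.
    by apply: sumr_ge0 => w _; apply: sumr_ge0 => w' _; rewrite exprn_ge0 // powR_ge0.
  move: (p n `^ _) => z; rewrite le_eqVlt; apply/orP; left; apply/eqP; field.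
  by rewrite gt_eqF.
apply: le_trans (lerD crossE coinE) _; rewrite [leRHS]splitr; apply: lerD.
  rewrite mulrC -ler_pdivlMr // -[p n]powRr1 ?(ltW pp) //.
  by apply: ltW; near: n; apply: p_small => //; rewrite divr_gt0 // divr_gt0.
rewrite mulrC -ler_pdivlMr //.
apply: ltW; near: n; apply: p_small; first by rewrite invr_gt0 r2_gt0.
by rewrite divr_gt0 // divr_gt0.
Unshelve. all: by end_near.
Qed.

(* The size bound L is the integer part of (small n)^-1, and a unit of excess in a
   script costs (small n) ^ 4. *)
Definition small (n : nat) : R := p n `^ (c0 / 8).

Lemma small_le (A B : R) : 0 <= A -> 0 < B -> \forall n \near \oo, small n * A <= B.
Proof.
move=> A0 B0; have A1 : 0 < A + 1 by rewrite ltr_wpDl.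
near=> n; have : small n < B / (A + 1).
  by near: n; apply: p_small; rewrite divr_gt0 // c0_gt0.
rewrite ltr_pdivlMr // mulrDr mulr1 => lt; have : 0 <= small n by apply: powR_ge0.
by move: lt; lra.
Unshelve. all: by end_near.
Qed.

Lemma upper_tail (e : R) m : 0 < e -> \forall n \near \oo, exists L M,
  [/\ (m <= L)%N, (1 < L)%N, (L * L * L + (D + 3) * L <= M)%N,
   Pr (K n) (p n) (fun G => ~~ `[< no_crossing r R G L M >]) <= e &
   EX (K n) (p n) (fun G => #|bad_pairs R r L G|%:R) <= e * (rho * edges n)].
Proof.
move=> e0; have rp : 0 < rho by apply: lt_trans rho1.
have cp := c0_gt0 R r5; have lam1 := lam_ge1 R r5.
have sp : 0 < s0 gamma gb by apply: s0_gt0.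
have gs : 1 < gb * s0 gamma gb by apply: gb_s0.
set s := s0 gamma gb in sp gs *.
have s1 : gb^-1 < s by rewrite -[_^-1]mulr1 ltr_pdivrMl.
have rho'p : 0 < rho' R r by rewrite (lt_trans _ (rho'_gt1 R r5)).
have sl : 0 < rho' R r - (1 + s ^+ (r - 2) / (r - 2)`!%:R * rho' R r ^+ D).
  by rewrite subr_gt0; apply: slack.
(* Then w x n is the midpoint of 1 / gb and s, and half of the gap remains for the old vertices, of
   weight y M. *)
pose w := (gb * s + 1) / 2; have w1 : 1 < w by rewrite /w; lra.
pose K1 := 2 * lam - 1 + 4 * D%:R * c0.
have K10 : 0 <= K1.
  have : 0 <= 4 * D%:R * c0 by exact: (mulr_ge0 (mulr_ge0 (ler0n _ 4) (ler0n _ _)) (ltW cp)).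
  by rewrite /K1; lra.
(* Chosen so that p^(-K1), the factor by which [crossing_sum] exceeds w^(-L), is at most [small n]
   to the power -j. *)
pose j := Num.bound (8 * K1 / c0).
have jK : 8 * K1 / c0 < j%:R.
  by apply: archi_boundP; rewrite divr_ge0 ?(ltW cp) // mulr_ge0.
have [C [C0 geo]] := geometric_beats_power j w1.
pose c1 := 4 * gb ^+ 2; have c10 : 0 < c1 by rewrite mulr_gt0 ?exprn_gt0.
pose q0 := rho' R r * s ^+ 2; have q00 : 0 <= q0 by rewrite mulr_ge0 ?exprn_ge0 ?ltW.
near=> n.
have n1 : (1 < n)%N by near: n; exact: nbhs_infty_gt.
have n0 := ltnW n1; have pp := p_gt0 n0; have ep := edges_gt0 n1.
have p1 : p n <= 1 by near: n; exact: p_le1.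
have nR : 0 < n%:R :> R by rewrite ltr0n.
have zp : 0 < small n by apply: powR_gt0.
have z2 : small n * 2 <= 1 by near: n; apply: small_le.
have z1 : small n <= 1 by move: z2 zp; generalize (small n) => z; lra.
have zm : small n * m%:R <= 1 by near: n; apply: small_le.
have zC : small n * C <= e by near: n; apply: small_le.
have zD : small n * (D%:R + 4) <= (s - gb^-1) / 2.
  by near: n; apply: small_le; rewrite ?addr_ge0 //; lra.
have zs : small n * 1 <= rho' R r - (1 + s ^+ (r - 2) / (r - 2)`!%:R * rho' R r ^+ D).
  by near: n; apply: small_le.
have zq : small n * q0 <= 2^-1 by near: n; apply: small_le; rewrite ?invr_gt0.
have zb : small n * (2 * c1 * q0) <= e * rho.
  near: n; apply: small_le; last exact: mulr_gt0.
  exact: (mulr_ge0 (mulr_ge0 (ler0n _ 2) (ltW c10)) q00).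
have yE : p n `^ (c0 / 2) = small n ^+ 4.
  have -> : c0 / 2 = c0 / 8 * 4%:R by generalize c0 => c; lra.
  by rewrite (powRrM (p n)) powR_mulrn // powR_ge0.
have crossE : p n `^ (1 - 2 * lam - 4 * D%:R * c0) <= (small n)^-1 ^+ j.
  have -> : p n `^ (1 - 2 * lam - 4 * D%:R * c0) = small n `^ (- (8 * K1 / c0)).
    rewrite /small -(powRrM (p n)); apply: (congr1 (powR (p n))); rewrite /K1.
    by move: (lt0r_neq0 cp); generalize c0 lam (D%:R : R) => c l d cn; field.
  move: (small n) zp z2 => z zp z2; rewrite exprVn -(powR_invn j (ltW zp)).
  by apply: (ger_powR (a := z)); [rewrite zp; lra | rewrite lerN2 ltW].
move: z1 z2 zm zC zD zs zq zb yE crossE; move: (small n) zp => z zp z1 z2 zm zC zD zs zq zb yE crossE.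
set L := Num.truncn z^-1; pose M := (L * L * L + (D + 3) * L)%N.
have zi : 0 < z^-1 by rewrite invr_gt0.
have zz : z * z^-1 = 1 by rewrite divff // gt_eqF.
have h2 : 2 <= z^-1 by rewrite -(ler_pM2l zp) zz.
have hm : m%:R <= z^-1 by rewrite -(ler_pM2l zp) zz.
have /andP[Lh hL] := truncn_itv (ltW zi); rewrite -/L in Lh hL.
have L1 : (1 < L)%N by rewrite -ltnS -(ltr_nat R) (le_lt_trans h2).
have mL : (m <= L)%N by rewrite -ltnS -(ltr_nat R) (le_lt_trans hm).
have LM : (L <= M)%N by rewrite /M; move: L1; clear; nia.
(* L is about 1/z and M about z^(-3), so y = z^4 still makes y M vanish. *)
have yM : z ^+ 4 * M%:R <= z * (D%:R + 4).
  rewrite /M natrD !natrM natrD; move: (L%:R : R) Lh (ler0n R L) => l lh l0.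
  have zl : z * l <= 1 by rewrite -zz ler_pM2l.
  have zl0 : 0 <= z * l by rewrite mulr_ge0 // ltW.
  have D0 : 0 <= D%:R :> R by [].
  have -> : z ^+ 4 * (l * l * l + (D%:R + 3) * l) =
     z * ((z * l) ^+ 3 + (D%:R + 3) * ((z * l) * z ^+ 2)) by ring.
  rewrite ler_pM2l //; have -> : D%:R + 4 = 1 + (D%:R + 3) * 1 :> R by ring.
  apply: lerD; first by rewrite exprn_ile1.
  by rewrite ler_wpM2l ?addr_ge0 // mulr_ile1 ?exprn_ge0 ?(ltW zp) // exprn_ile1 // ltW.
have sigmaE : w * p n `^ lam * #|'I_n|%:R = (s + gb^-1) / 2.
  by rewrite p_lam // card_ord /w; field; rewrite !gt_eqF.
have sig0 : 0 <= p n `^ (c0 / 2) * M%:R + w * p n `^ lam * #|'I_n|%:R.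
  rewrite sigmaE yE; apply: addr_ge0; first by rewrite mulr_ge0 // exprn_ge0 // ltW.
  by rewrite divr_ge0 // addr_ge0 ?(ltW sp) // invr_ge0 ltW.
have sig : p n `^ (c0 / 2) * M%:R + w * p n `^ lam * #|'I_n|%:R <= s.
  by rewrite sigmaE yE; move: yM zD; lra.
have z41 : z ^+ 4 <= z.
  by rewrite exprS ler_piMr ?(ltW zp) // exprn_ile1 // ltW.
have fx : 1 + p n `^ (c0 / 2) + (p n `^ (c0 / 2) * M%:R + w * p n `^ lam * #|'I_n|%:R) ^+ (r - 2)
    / (r - 2)`!%:R * rho' R r ^+ D <= rho' R r.
  apply: le_trans (_ : 1 + z + s ^+ (r - 2) / (r - 2)`!%:R * rho' R r ^+ D <= _); last first.
    move: zs; rewrite mulr1; generalize (s ^+ (r - 2) / (r - 2)`!%:R * rho' R r ^+ D) (rho' R r) => u v zs; lra.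
  apply: lerD; first by rewrite lerD2l yE.
  rewrite ler_wpM2r ?exprn_ge0 ?(ltW rho'p) // ler_wpM2r ?invr_ge0 // lerXn2r // nnegrE.
  exact: ltW.
have qle : p n `^ (c0 / 2) * (rho' R r * (p n `^ (c0 / 2) * M%:R + w * p n `^ lam * #|'I_n|%:R) ^+ 2)
    <= z ^+ 4 * q0.
  rewrite -yE ler_wpM2l ?powR_ge0 // /q0 ler_wpM2l ?(ltW rho'p) // lerXn2r // nnegrE.
  exact: ltW.
have q_small : p n `^ (c0 / 2) * (rho' R r * (p n `^ (c0 / 2) * M%:R + w * p n `^ lam * #|'I_n|%:R) ^+ 2)
    <= 2^-1.
  by apply: le_trans qle (le_trans _ zq); rewrite ler_wpM2r.
exists L, M; split => //.
  apply: le_trans (crossing_prob r5 L pp p1 (ltW w1) (ltW rho'p) fx q_small) _.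
  apply: le_trans zC; rewrite mulrC [leRHS]mulrC; apply: le_trans (geo z zp).
  by rewrite mulrC ler_wpM2r // invr_ge0 exprn_ge0 // ltW // (lt_trans ltr01).
apply: le_trans (bad_mean r5 pp p1 (ltW w1) (ltW rho'p) fx q_small LM) _.
(* L^2 costs z^(-2), and the first tree of a bad script gains z^4; z^2 is left. *)
apply: le_trans (_ : z^-1 ^+ 2 * (c1 * edges n) * (2 * (z ^+ 4 * q0)) <= _).
  have LX : L%:R ^+ 2 <= z^-1 ^+ 2 by rewrite lerXn2r ?nnegrE // ltW.
  apply: ler_pM.
  - by apply: mulr_ge0; [exact: exprn_ge0 | exact: powR_ge0].
  - apply: mulr_ge0 => //; apply: mulr_ge0; first exact: powR_ge0.
    by apply: mulr_ge0; [exact: ltW | exact: exprn_ge0].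
  - apply: ler_pM => //; [exact: exprn_ge0 | exact: powR_ge0 | exact: edges_ge].
  by rewrite ler_pM2l.
have -> : z^-1 ^+ 2 * (c1 * edges n) * (2 * (z ^+ 4 * q0)) = z * (z * (2 * c1 * q0)) * edges n.
  by field; rewrite gt_eqF.
rewrite [leRHS]mulrA ler_pM2r //; apply: le_trans zb; rewrite ler_piMl //.
rewrite mulr_ge0 ?(ltW zp) //.
exact: (mulr_ge0 (mulr_ge0 (ler0n _ 2) (ltW c10)) q00).
Unshelve. all: by end_near.
Qed.

End Asymptotics.

(* Convergence in probability *)
From HB Require Import structures.
From mathcomp Require Import all_boot all_order all_algebra.
From mathcomp Require Import all_classical all_reals all_analysis.
Import Order.TTheory GRing.Theory Num.Theory.
Import numFieldNormedType.Exports.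
Local Open Scope classical_set_scope.
Local Open Scope ring_scope.

Theorem theorem1p2 (R : realType) (r : nat) (gamma gammabar rho : R) :
  (5 <= r)%N ->
  0 < gamma ->
  (r - 2)%N`!%:R * gamma ^+ (r - 2)%N = alpha_d ('C(r, 2) - 2)%N ->
  gamma < gammabar ->
  let lambda : R := ('C(r, 2) - 2)%N%:R / (r - 2)%N%:R in
  let alphabar : R := (r - 2)%N`!%:R * gammabar ^+ (r - 2)%N in
  1 < rho ->
  rho ^+ ('C(r, 2) - 1)%N = alphabar * (rho - 1) ->
  (forall x : R, 1 < x < rho -> x ^+ ('C(r, 2) - 1)%N != alphabar * (x - 1)) ->
  let p : nat -> R := fun n => powR (gammabar * n%:R) (- lambda^-1) in
  forall eps : R, 0 < eps ->
    (fun n : nat =>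
       Gnp_prob n (p n) (fun G =>
         eps < `| (#|Kr_closure r G|)%:R / (rho * p n * 'C(n, 2)%:R) - 1 |))
      @ \oo --> (0 : R).
Proof.
move=> r5 gamma0 gammaE gamma_gb lambda alphabar rho1 rhoE noroot p eps eps0.
have gammaE' : (r - 2)`!%:R * gamma ^+ (r - 2) =
    ('C(r, 2) - 1)%N%:R ^+ ('C(r, 2) - 1) / ('C(r, 2) - 1 - 1)%N%:R ^+ ('C(r, 2) - 1 - 1).
  have C10 := bin2_ge10 r5; rewrite gammaE /alpha_d.
  have -> : ('C(r, 2) - 2).+1 = ('C(r, 2) - 1)%N by move: C10; clear; lia.
  by have -> : ('C(r, 2) - 2 = 'C(r, 2) - 1 - 1)%N by move: C10; clear; lia.
have gb0 : 0 < gammabar by apply: lt_trans gamma_gb.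
have rp : 0 < rho by apply: lt_trans rho1.
apply/cvgrPdist_le => eta eta0.
(* With delta and all errors equal to e, [concentration] gives 2 e + 6 e / eps, and the last two
   minima make each summand at most eta / 2. *)
pose e := Num.min (Num.min 1 eps) (Num.min (eta / 4) (eps * eta / 12)).
have e0 : 0 < e by rewrite !lt_min ltr01 eps0 !divr_gt0 // mulr_gt0.
have e1 : e <= 1 by rewrite !ge_min lexx.
have e_eps : e <= eps by rewrite !ge_min lexx orbT.
have e_eta : 4 * e <= eta by rewrite mulrC -ler_pdivlMr // !ge_min lexx !orbT.
have e_both : 12 * e <= eps * eta by rewrite mulrC -ler_pdivlMr // !ge_min lexx !orbT.
have [m low] := lower_tail r5 gamma0 gamma_gb gammaE' rho1 noroot e0 e1 e0.
near=> n.
have n1 : (1 < n)%N by near: n; exact: nbhs_infty_gt.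
have n0 := ltnW n1; have nR : 0 < n%:R :> R by rewrite ltr0n.
have pp : 0 < p n := p_gt0 r gamma0 gamma_gb n0.
have p1 : p n <= 1 by near: n; exact: (p_le1 r5 gamma0 gamma_gb).
have [L [M [mL L1 LM PrX EXbad]]] : exists L M, [/\ (m <= L)%N, (1 < L)%N,
   (L * L * L + ('C(r, 2) - 1 + 3) * L <= M)%N,
   Pr (pairs [set: 'I_n]%SET) (p n) (fun G => ~~ `[< no_crossing r R G L M >]) <= e &
   EX (pairs [set: 'I_n]%SET) (p n) (fun G => #|bad_pairs R r L G|%:R) <= e * (rho * (p n * 'C(n, 2)%:R))].
  by near: n; exact: (upper_tail r5 gamma0 gamma_gb gammaE' rho1 m e0).
have lowE : Pr (pairs [set: 'I_n]%SET) (p n)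
   (fun G => #|reached r m G|%:R < (1 - e) * (rho * (p n * 'C(n, 2)%:R))) <= e by near: n.
have mu0 : 0 < rho * (p n * 'C(n, 2)%:R) by rewrite !mulr_gt0 // ltr0n bin_gt0.
have fx : 1 + (p n `^ lam R r * #|'I_n|%:R) ^+ (r - 2) / (r - 2)`!%:R * rho ^+ ('C(r, 2) - 1) <= rho.
  rewrite rhoE (p_lam r5 gamma0 gamma_gb n0) card_ord invfM mulfVK ?gt_eqF //.
  rewrite le_eqVlt; apply/orP; left; apply/eqP; rewrite exprVn /alphabar.
  have f0 : (r - 2)`!%:R != 0 :> R by rewrite pnatr_eq0 -lt0n fact_gt0.
  have : gammabar ^+ (r - 2) != 0 by rewrite expf_neq0 // gt_eqF.
  by move: f0; move: (gammabar ^+ _) ((r - 2)`!%:R : R) => u v v0 u0; field; rewrite u0 v0.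
have Eb := reached_mean r5 pp p1 (ltW rp) fx L; rewrite card_ord in Eb.
rewrite Gnp_probE distrC subr0 ger0_norm ?Pr_ge0 ?(ltW pp) //.
have pe (x : R) : rho * p n * x = rho * (p n * x) by rewrite mulrA.
(* Trees of the fixed size m give the lower tail, trees of size at most L the first moment; without
   crossings the closure exceeds the latter by at most the bad pairs. *)
rewrite pe; apply: le_trans (concentration (ltW pp) p1 mu0 eps0 _ e1 _ _ _ _ Eb EXbad lowE PrX) _.
- by rewrite (ltW e0).
- by move=> G _; rewrite ler0n ler_nat subset_leq_card // reachedS.
- by move=> G GK; rewrite ler_nat subset_leq_card // reached_sub_closure.
- by move=> G _.
- move=> G GK; rewrite negbK => /asboolP noX; rewrite -natrD ler_nat.
  apply: (closure_cover r5 GK noX L1 LM); first exact: Kr_closure_sub.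
  by move=> Z; apply: Kr_closure_min.
have : (2 * e / eps) + (2 * (e + e) / eps) <= eta / 2.
  by rewrite -mulrDl ler_pdivrMr //; move: e_both; lra.
by move: e_eta; lra.
Unshelve. all: by end_near.
Qed.
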